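(* Let $L$ be a rank one Lagrangian surface of $(T\Sigma,\mathbb{J},\mathbb{G},\Omega)$. Then, locally, $L$ is an affine normal bundle over a curve $\gamma$ of $\Sigma$ (i.e. every point of $L$ has a neighbourhood in $L$ that is an open piece of such an affine normal bundle). Moreover $L$ is Hamiltonian stationary (H-minimal), and the metric induced by $\mathbb{G}$ on $L$ is flat. Finally, $L$ is minimal if and only if the base curve $\gamma$ is a geodesic of $(\Sigma,g)$.
   Context: $(\Sigma,g)$ is an oriented Riemannian surface, $\nabla$ its Levi-Civita connection, $j$ its canonical complex structure (rotation by $+\pi/2$ in each tangent plane), and $\pi:T\Sigma\to\Sigma$ the projection. For $\xi\in T_{(p,V)}T\Sigma$ put $P\xi=d\pi(\xi)\in T_p\Sigma$, and let $K\xi\in T_p\Sigma$ be the image of $\xi$ under the connection map: if $\alpha(s)=(p(s),V(s))$ is a curve in $T\Sigma$ with $\alpha'(0)=\xi$, then $K\xi$ is the covariant derivative at $s=0$ of $V(s)$ along $p(s)$. The map $\xi\mapsto(P\xi,K\xi)$ is an isomorphism $T_{(p,V)}T\Sigma\simeq T_p\Sigma\oplus T_p\Sigma$. Define on $T\Sigma$ the symplectic form $\Omega(X,Y)=g(KX,PY)-g(PX,KY)$, the almost complex structure $\mathbb{J}=j\oplus j$ and the neutral (signature $(2,2)$) pseudo-Riemannian metric $\mathbb{G}(X,Y)=\Omega(\mathbb{J}X,Y)$. A surface $L$ of $T\Sigma$ is a smooth immersed 2-dimensional submanifold; it is Lagrangian if $\Omega$ restricts to zero on $L$; it has rank one if the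 restriction of $\pi$ to $L$ has rank one everywhere. The mean curvature vector $\vec H$ is one half of the trace, with respect to the (non-degenerate) induced metric, of the second fundamental form; $L$ is minimal if $\vec H=0$. A Lagrangian surface is Hamiltonian stationary (H-minimal) if it is critical for the area with respect to compactly supported Hamiltonian variations; equivalently $\operatorname{div}(\mathbb{J}\vec H)=0$, with $\operatorname{div}$ the divergence of the induced metric on $L$. Given a regular curve $\gamma:I\to\Sigma$ parametrized by arclength and a real function $a$ on $I$, the image of $X(s,t)=(\gamma(s),\,a(s)\gamma'(s)+t\,j\gamma'(s))$ is called an affine normal bundle over $\gamma$. *)

(* Defs.v *)
From HB Require Import structures.
From mathcomp Require Import all_boot all_order all_algebra.
From mathcomp Require Import all_classical all_reals all_analysis.
From mathcomp Require Import ring.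

Set Implicit Arguments.
Unset Strict Implicit.
Unset Printing Implicit Defensive.

Import Order.TTheory GRing.Theory Num.Theory.
Import numFieldNormedType.Exports.

Local Open Scope classical_set_scope.
Local Open Scope ring_scope.

(* Vectors are row vectors: the differential of f at p is v |-> v *m 'J f p,
   and a bilinear form with matrix A is (u, v) |-> u *m A *m v^T. *)

Section Calculus.
Context {R : realType}.

Fixpoint Ck_on (V W : normedModType R) (k : nat) (U : set V) (f : V -> W)
    : Prop :=
  if k is k'.+1 then
    (forall x, U x -> differentiable f x) /\
    (forall v : V, Ck_on k' U (fun x => 'D_v f x))
  else forall x, U x -> {for x, continuous f}.

(* Only meant for open U *)
Definition smooth_on (V W : normedModType R) (U : set V) (f : V -> W) : Prop :=
  forall k, Ck_on k U f.

Definition pd (n : nat) (W : normedModType R) (i : 'I_n)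
    (f : 'rV[R]_n -> W) : 'rV[R]_n -> W :=
  fun x => 'D_(delta_mx 0 i) f x.

Definition inner (n : nat) (A : 'M[R]_n) (u v : 'rV[R]_n) : R :=
  (u *m A *m v^T) 0 0.

End Calculus.

(* Levi-Civita calculus of a pseudo-Riemannian metric g given in coordinates *)
Section LeviCivita.
Context {R : realType} {n : nat}.
Variable g : 'rV[R]_n -> 'M[R]_n.

(* Gamma^k_ij *)
Definition christoffel (x : 'rV[R]_n) (k i j : 'I_n) : R :=
  2^-1 * \sum_(l < n) invmx (g x) k l *
    (pd i (fun y => g y j l) x + pd j (fun y => g y i l) x
     - pd l (fun y => g y i j) x).

(* Gamma(u, v)^k = Gamma^k_ij u^i v^j *)
Definition christoffel_form (x u v : 'rV[R]_n) : 'rV[R]_n :=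
  \row_k \sum_(i < n) \sum_(j < n) christoffel x k i j * u 0 i * v 0 j.

(* The l-th component of R(d_i, d_j) d_k *)
Definition curvature (x : 'rV[R]_n) (l k i j : 'I_n) : R :=
  pd i (fun y => christoffel y l j k) x - pd j (fun y => christoffel y l i k) x
  + \sum_(m < n) (christoffel x l i m * christoffel x m j k
                  - christoffel x l j m * christoffel x m i k).

Definition divergence (Z : 'rV[R]_n -> 'rV[R]_n) (x : 'rV[R]_n) : R :=
  \sum_(i < n) (pd i (fun y => Z y 0 i) x
                + \sum_(j < n) christoffel x i i j * Z x 0 j).

End LeviCivita.

(* Extrinsic geometry of an immersion X in a space with coordinate metric G *)
Section Immersion.
Context {R : realType} {m n : nat}.
Variables (G : 'rV[R]_n -> 'M[R]_n) (X : 'rV[R]_m -> 'rV[R]_n).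

Definition induced_metric (u : 'rV[R]_m) : 'M[R]_m :=
  'J X u *m G (X u) *m ('J X u)^T.

(* The component of xi orthogonal to the image of the differential of X *)
Definition normal_part (u : 'rV[R]_m) (xi : 'rV[R]_n) : 'rV[R]_n :=
  xi - xi *m G (X u) *m ('J X u)^T *m invmx (induced_metric u) *m 'J X u.

Definition second_fundamental_form (u : 'rV[R]_m) (a b : 'I_m) : 'rV[R]_n :=
  normal_part u
    (pd a (pd b X) u + christoffel_form G (X u) (pd a X u) (pd b X u)).

End Immersion.

Section MeanCurvature.
Context {R : realType} {n : nat}.
Variables (G : 'rV[R]_n -> 'M[R]_n) (X : 'rV[R]_2 -> 'rV[R]_n).

Definition mean_curvature (u : 'rV[R]_2) : 'rV[R]_n :=
  2^-1 *: \sum_(a < 2) \sum_(b < 2)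
    invmx (induced_metric G X u) a b *: second_fundamental_form G X u a b.

End MeanCurvature.

(* Coordinate expressions, in an oriented chart of Sigma with metric g, of the
   structures of T Sigma.  A point of T Sigma is z = (x, y), with x the
   coordinates of the base point and y the components of the vector. *)
Section TangentBundleStructures.
Context {R : realType}.

Definition pair4 (x y : 'rV[R]_2) : 'rV[R]_4 := @row_mx R 1 2 2 x y.
Definition fst4 (z : 'rV[R]_4) : 'rV[R]_2 := @lsubmx R 1 2 2 z.
Definition snd4 (z : 'rV[R]_4) : 'rV[R]_2 := @rsubmx R 1 2 2 z.

(* Rotation by +pi/2 for the inner product A; jrot_spec shows that it is. *)
Definition jrot (A : 'M[R]_2) (v : 'rV[R]_2) : 'rV[R]_2 :=
  let w := v *m A in
  (Num.sqrt (\det A))^-1 *: \row_k (if k == 0 then - w 0 1 else w 0 0).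

Lemma jrot_spec (A : 'M[R]_2) (v : 'rV[R]_2) :
  A^T = A -> 0 < \det A -> 0 < inner A v v ->
  [/\ inner A v (jrot A v) = 0,
      inner A (jrot A v) (jrot A v) = inner A v v &
      0 < v 0 0 * jrot A v 0 1 - v 0 1 * jrot A v 0 0].
Proof.
have E2 (f : 'I_2 -> R) : \sum_i f i = f 0 + f 1.
  by rewrite big_ord_recl big_ord1; congr (_ + f _); exact/val_inj.
have det2 : \det A = A 0 0 * A 1 1 - A 0 1 * A 1 0.
  rewrite (expand_det_row _ 0) E2 /cofactor !det_mx11 !mxE /= expr0 expr1 mul1r.
  have -> : lift (0 : 'I_2) 0 = 1 by exact/val_inj.
  have -> : lift (1 : 'I_2) 0 = 0 by exact/val_inj.
  by rewrite mulN1r mulrN.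
move=> As dA vA; have A10 : A 1 0 = A 0 1 by rewrite -[in LHS]As mxE.
set r := (Num.sqrt (\det A))^-1.
have r0 : 0 < r by rewrite invr_gt0 sqrtr_gt0.
have rr : r * r * (A 0 0 * A 1 1 - A 0 1 * A 0 1) = 1.
  have <- : \det A = A 0 0 * A 1 1 - A 0 1 * A 0 1 by rewrite det2 A10.
  rewrite -expr2 exprVn sqr_sqrtr ?ltW// mulVf//; exact: lt0r_neq0.
move: vA; rewrite /jrot -/r /inner !(mxE, E2) /= !A10 => vA.
split.
- ring.
- set p := v 0 0; set q := v 0 1.
  transitivity (r * r * (A 0 0 * A 1 1 - A 0 1 * A 0 1) *
    ((p * A 0 0 + q * A 0 1) * p + (p * A 0 1 + q * A 1 1) * q)).
    ring.
  by rewrite rr mul1r.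
- rewrite (_ : _ - _ = r * ((v 0 0 * A 0 0 + v 0 1 * A 0 1) * v 0 0 +
      (v 0 0 * A 0 1 + v 0 1 * A 1 1) * v 0 1)); last by ring.
  exact: mulr_gt0.
Qed.

Variable g : 'rV[R]_2 -> 'M[R]_2.

Definition Pmap (xi : 'rV[R]_4) : 'rV[R]_2 := fst4 xi.

(* The connection map at z: dV^k + Gamma^k_ij dx^i V^j *)
Definition Kmap (z xi : 'rV[R]_4) : 'rV[R]_2 :=
  snd4 xi + christoffel_form g (fst4 z) (fst4 xi) (snd4 z).

Definition Omega (z xi eta : 'rV[R]_4) : R :=
  inner (g (fst4 z)) (Kmap z xi) (Pmap eta)
  - inner (g (fst4 z)) (Pmap xi) (Kmap z eta).

(* The vector whose images under P and K are j (P xi) and j (K xi) *)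
Definition JJ (z xi : 'rV[R]_4) : 'rV[R]_4 :=
  let jP := jrot (g (fst4 z)) (Pmap xi) in
  let jK := jrot (g (fst4 z)) (Kmap z xi) in
  pair4 jP (jK - christoffel_form g (fst4 z) jP (snd4 z)).

Lemma JJ_spec (z xi : 'rV[R]_4) :
  Pmap (JJ z xi) = jrot (g (fst4 z)) (Pmap xi) /\
  Kmap z (JJ z xi) = jrot (g (fst4 z)) (Kmap z xi).
Proof.
by rewrite /Kmap /Pmap /JJ /fst4 /snd4 /pair4 !row_mxKl !row_mxKr subrK.
Qed.

Definition GG (z : 'rV[R]_4) : 'M[R]_4 :=
  \matrix_(i, j) Omega z (JJ z (delta_mx 0 i)) (delta_mx 0 j).

End TangentBundleStructures.

Record smooth_surface (R : realType) := SmoothSurface {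
  points :> topologicalType;
  points_hausdorff : hausdorff_space points;
  points_second_countable : @second_countable points;
  chart : Type;
  cdom : chart -> set points;
  coord : chart -> points -> 'rV[R]_2;
  param : chart -> 'rV[R]_2 -> points;
  cdom_open : forall c, open (cdom c);
  cimg_open : forall c, open (coord c @` cdom c);
  coordK : forall c p, cdom c p -> param c (coord c p) = p;
  coord_continuous : forall c p, cdom c p -> {for p, continuous (coord c)};
  param_continuous : forall c u, (coord c @` cdom c) u ->
    {for u, continuous (param c)};
  chart_cover : forall p, exists c, cdom c p;
  transition_smooth : forall c d,
    smooth_on (coord c @` (cdom c `&` cdom d)) (coord d \o param c) }.

Record oriented_riemannian_surface (R : realType) := OrientedRiemannianSurface {
  surface_of :> smooth_surface R;
  oriented_atlas : forall (c d : chart surface_of) p, cdom c p -> cdom d p ->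
    0 < \det ('J (coord d \o param c) (coord c p));
  metric : chart surface_of -> 'rV[R]_2 -> 'M[R]_2;
  metric_smooth : forall c, smooth_on (coord c @` cdom c) (metric c);
  metric_sym : forall c p, cdom c p ->
    (metric c (coord c p))^T = metric c (coord c p);
  metric_pos : forall c p v, cdom c p -> v != 0 ->
    0 < inner (metric c (coord c p)) v v;
  metric_change : forall (c d : chart surface_of) p, cdom c p -> cdom d p ->
    metric c (coord c p) =
      'J (coord d \o param c) (coord c p) *m metric d (coord d p)
        *m ('J (coord d \o param c) (coord c p))^T }.

(* A tangent vector is given by its components in all the charts around its
   base point; the value 0 at the other charts makes this family unique. *)
Record tangent_bundle (R : realType) (S : smooth_surface R) := TangentVector {
  base : S;
  comp : chart S -> 'rV[R]_2;
  comp_change : forall c d, cdom c base -> cdom d base ->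
    comp d = comp c *m 'J (coord d \o param c) (coord c base);
  comp_out : forall c, ~ cdom c base -> comp c = 0 }.

Section Surfaces.
Context {R : realType} {S : oriented_riemannian_surface R}
  {L : smooth_surface R}.
Variable X : L -> tangent_bundle S.

(* X read in the chart c of L and the chart of T Sigma over the chart d of
   Sigma; it is meaningful on the open set ldom c d. *)
Definition ldom (c : chart L) (d : chart S) : set 'rV[R]_2 :=
  [set u | (coord c @` cdom c) u /\ cdom d (base (X (param c u)))].

Definition lbase (c : chart L) (d : chart S) (u : 'rV[R]_2) : 'rV[R]_2 :=
  coord d (base (X (param c u))).

Definition lrep (c : chart L) (d : chart S) (u : 'rV[R]_2) : 'rV[R]_4 :=
  pair4 (lbase c d u) (comp (X (param c u)) d).

Definition immersed_surface : Prop :=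
  [/\ continuous (fun q => base (X q)),
      forall c d, smooth_on (ldom c d) (lrep c d) &
      forall c d u, ldom c d u -> \rank ('J (lrep c d) u) = 2%N].

Definition lagrangian : Prop :=
  forall c d u, ldom c d u -> forall v w : 'rV[R]_2,
    Omega (metric d) (lrep c d u)
      (v *m 'J (lrep c d) u) (w *m 'J (lrep c d) u) = 0.

Definition rank_one : Prop :=
  forall c d u, ldom c d u -> \rank ('J (lbase c d) u) = 1%N.

Definition lmetric (c : chart L) (d : chart S) : 'rV[R]_2 -> 'M[R]_2 :=
  induced_metric (GG (metric d)) (lrep c d).

Definition flat_induced_metric : Prop :=
  forall c d u, ldom c d u ->
    lmetric c d u \in unitmx /\
    forall l k i j, curvature (lmetric c d) u l k i j = 0.

Definition minimal_on (N : set L) : Prop :=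
  forall c d u, ldom c d u -> N (param c u) ->
    mean_curvature (GG (metric d)) (lrep c d) u = 0.

Definition minimal : Prop := minimal_on setT.

(* div (J H) = 0, where Z is the vector field J H expressed in the coordinates
   of L; J H is tangent when L is Lagrangian. *)
Definition hamiltonian_stationary : Prop :=
  forall c d, exists Z : 'rV[R]_2 -> 'rV[R]_2, forall u, ldom c d u ->
    JJ (metric d) (lrep c d u) (mean_curvature (GG (metric d)) (lrep c d) u)
      = Z u *m 'J (lrep c d) u /\
    divergence (lmetric c d) Z u = 0.

End Surfaces.

Section Curves.
Context {R : realType} {S : oriented_riemannian_surface R}.
Variables (I : set R) (gamma : R -> S).

Definition velocity (d : chart S) (s : R) : 'rV[R]_2 :=
  'D_1 (coord d \o gamma) s.

Definition unit_speed_curve : Prop :=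
  [/\ open I, is_interval I,
      forall s, I s -> {for s, continuous gamma},
      forall d, smooth_on [set s | I s /\ cdom d (gamma s)]
        (coord d \o gamma) &
      forall d s, I s -> cdom d (gamma s) ->
        inner (metric d (coord d (gamma s))) (velocity d s) (velocity d s) = 1].

Definition geodesic : Prop :=
  forall d s, I s -> cdom d (gamma s) ->
    'D_1 (velocity d) s
      + christoffel_form (metric d) (coord d (gamma s))
          (velocity d s) (velocity d s) = 0.

(* xi = (gamma s, a s * gamma' s + t * j (gamma' s)) *)
Definition affine_normal_point (a : R -> R) (s t : R)
    (xi : tangent_bundle S) : Prop :=
  base xi = gamma s /\
  forall d, cdom d (gamma s) ->
    comp xi d = a s *: velocity d s
      + t *: jrot (metric d (coord d (gamma s))) (velocity d s).

End Curves.

(* psi is a diffeomorphism from the open set W of the plane onto the open set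
   N of L *)
Definition local_parametrization (R : realType) (L : smooth_surface R)
    (W : set 'rV[R]_2) (N : set L) (psi : 'rV[R]_2 -> L) : Prop :=
  [/\ open W /\ open N,
      set_bij W N psi,
      forall w, W w -> {for w, continuous psi},
      forall c, smooth_on [set w | W w /\ cdom c (psi w)] (coord c \o psi) &
      forall c w, W w -> cdom c (psi w) -> \rank ('J (coord c \o psi) w) = 2%N].

(* The open subset N of L is an open piece of the affine normal bundle over
   gamma : I -> Sigma with function a.  The curve is cut down to the interval
   I of the parameters s that occur in the piece: what happens on the rest of
   a longer curve is not visible on N. *)
Definition affine_normal_piece (R : realType) (S : oriented_riemannian_surface R)
    (L : smooth_surface R) (X : L -> tangent_bundle S) (N : set L)
    (I : set R) (gamma : R -> S) (a : R -> R)
    (W : set 'rV[R]_2) (psi : 'rV[R]_2 -> L) : Prop :=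
  [/\ unit_speed_curve I gamma,
      smooth_on I a,
      local_parametrization W N psi,
      (fun w : 'rV[R]_2 => w 0 0) @` W = I &
      forall w, W w ->
        affine_normal_point gamma a (w 0 0) (w 0 1) (X (psi w))].

(* Main.v *)
(* A rank one map has locally a curve gamma as its projection, parametrized by
   arclength s.  Write the vector part in the frame T = gamma', N = jT as aT + tN.
   The Lagrangian condition says ds /\ da = 0, so a is a function of s, and the
   immersion condition makes (s, t) a coordinate system: this is the affine normal
   bundle.  For the map (s, t) |-> (gamma, aT + tN) the induced metric is
   E(s) ds^2 - 2 ds dt, which is flat and whose inverse has no ss-entry.  Hence the mean
   curvature only sees the second fundamental form on (d_t, d_t), which is 0, and on
   (d_s, d_t), which is (0, jA) with A the geodesic acceleration of gamma.  So
   H = - (0, jA) and J H = (0, A) = kappa(s) d_t, which is divergence free; and H = 0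
   exactly when A = 0. *)
Require Import Defs.
From HB Require Import structures.
From mathcomp Require Import all_boot all_order all_algebra.
From mathcomp Require Import all_classical all_reals all_analysis.
From mathcomp Require Import ring lra.

Set Implicit Arguments.
Unset Strict Implicit.
Unset Printing Implicit Defensive.

Import Order.TTheory GRing.Theory Num.Theory.
Import numFieldNormedType.Exports.

Local Open Scope classical_set_scope.
Local Open Scope ring_scope.

(** * Smooth functions *)

(** Curvature and divergence are defined by Christoffel symbols in an arbitrary chart of L, while
    the coordinates (s, t) come out of a construction. Only the mean curvature is transported by a
    change of variables, being a vector of the ambient space. For the rest, a primitive P of E gives
    phi = (s, t - P(s)/2), in which the metric is a constant matrix. In any chart the Christoffel
    symbols of such a metric express the second derivatives of phi in the frame d_k phi; flatness is
    then the commutation of third derivatives of phi, and the divergence of a field is read off in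
    this frame. On the side of T Sigma the obstacle is the Levi-Civita connection of G. As G(X, Y) =
    area(KX, PY) + area(KY, PX) with a parallel area form, its Christoffel form is simple once one
    argument is vertical, and the missing ss-entry of the inverse metric makes these values
    sufficient. Finally s and t arise as functions on L; the inverse function theorem, derived from
    Banach's fixed point theorem, turns them into a parametrization. *)

Section Differentiability.
Context {R : numFieldType} {V W : normedModType R}.
Implicit Types (f g : V -> W) (x : V) (L : {linear V -> W}).

(** The little-o definition in epsilon form. The inverse of a map is shown differentiable in this
    way, its differential being identified at the same time. *)
Lemma differentiable_remainder f x L : continuous L ->
  (forall e : R, 0 < e ->
     \forall h \near (0 : V), `|f (h + x) - f x - L h| <= e * `|h|) ->
  differentiable f x /\ 'd f x = L :> (V -> W).
Proof.
move=> Lc fL; have E : f \o shift x = cst (f x) + L +o_ 0 id.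
  apply/eqaddoP => e /fL; apply: filterS => h.
  by rewrite !fctE/= opprD addrA.
have dE : 'd f x = L :> (V -> W) by exact: diff_unique.
by split=> //; apply/diff_locallyP; rewrite dE.
Qed.

Lemma diff_remainder f x : differentiable f x ->
  forall e : R, 0 < e ->
    \forall h \near (0 : V), `|f (h + x) - f x - 'd f x h| <= e * `|h|.
Proof.
move=> /diff_locally /eqaddoP fL e /fL; apply: filterS => h.
by rewrite !fctE/= opprD addrA.
Qed.

Lemma near_eq_differentiable f g x :
  {near x, f =1 g} -> differentiable f x -> differentiable g x.
Proof.
move=> fg fx; apply: (proj1 (@differentiable_remainder g x ('d f x) _ _)).
  exact: diff_continuous.
move=> e e0; have gx := nbhs_singleton fg.
have fg0 : \forall h \near (0 : V), f (h + x) = g (h + x).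
  by move: fg; rewrite (near_shift 0 x); apply: filterS => h; rewrite /= subr0.
near=> h; rewrite -gx -(near fg0 h)//; near: h; exact: diff_remainder.
Unshelve. all: by end_near. Qed.

Lemma near_eq_derive_on (U : set V) f g (v : V) : open U ->
  {in U, f =1 g} -> {in U, 'D_v f =1 'D_v g}.
Proof.
move=> Uo fg x /set_mem Ux; apply: near_eq_derive.
by move: (open_nbhs_nbhs (conj Uo Ux)); apply: filterS => y Uy; apply/fg/mem_set.
Qed.

End Differentiability.

(** * Closure properties of maps of class C^k *)

Section CkGeneral.
Context {R : realType} {V W : normedModType R}.
Implicit Types (U : set V) (f g : V -> W).

Lemma Ck_onW k U f : Ck_on k.+1 U f -> Ck_on k U f.
Proof.
elim: k f => [|k IH] f [df Df]; first by move=> x /df /differentiable_continuous.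
by split=> // v; exact/IH/Df.
Qed.

Lemma sub_Ck_on k U U' f : U `<=` U' -> Ck_on k U' f -> Ck_on k U f.
Proof.
move=> UU'; elim: k f => [|k IH] f /=; first by move=> fU x /UU' /fU.
by case=> df Df; split=> [x /UU' /df//|v]; exact/IH/Df.
Qed.

(** Openness of [U] turns equality on [U] into equality near each of its points, which directional
    derivatives respect; the induction on [k] rests on this. *)
Lemma eq_Ck_on k U f g : open U -> {in U, f =1 g} -> Ck_on k U f -> Ck_on k U g.
Proof.
move=> Uo; elim: k f g => [|k IH] f g fg /=.
  move=> fU x Ux; have fgx : {near x, f =1 g}.
    by move: (open_nbhs_nbhs (conj Uo Ux)); apply: filterS => y Uy; apply/fg/mem_set.
  move: (fU _ Ux); rewrite /prop_for/= /continuous_at -(nbhs_singleton fgx).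
  by apply: cvg_trans; apply: near_eq_cvg; apply: filterS fgx => y ->.
case=> df Df; split=> [x Ux|v].
  apply: near_eq_differentiable (df _ Ux).
  by move: (open_nbhs_nbhs (conj Uo Ux)); apply: filterS => y Uy; apply/fg/mem_set.
by apply: IH (Df v) => x Ux; exact: near_eq_derive_on Ux.
Qed.

Lemma sub_smooth_on U U' f : U `<=` U' -> smooth_on U' f -> smooth_on U f.
Proof. by move=> UU' fU k; exact: sub_Ck_on (fU k). Qed.

Lemma eq_smooth_on U f g :
  open U -> {in U, f =1 g} -> smooth_on U f -> smooth_on U g.
Proof. by move=> Uo fg fU k; exact: eq_Ck_on (fU k). Qed.

Lemma smooth_on_differentiable U f x :
  smooth_on U f -> U x -> differentiable f x.
Proof. by move=> /(_ 1%N) [df _]; exact: df. Qed.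

Lemma smooth_on_continuous U f x : smooth_on U f -> U x -> {for x, continuous f}.
Proof. by move=> fU; exact: (fU 0%N). Qed.

Lemma smooth_on_derive U f v : smooth_on U f -> smooth_on U ('D_v f).
Proof. by move=> fU k; exact: (fU k.+1).2. Qed.

Lemma Ck_on_cst k U (c : W) : Ck_on k U (cst c).
Proof.
elim: k c => [|k IH] c /=; first by move=> x _; exact: cvg_cst.
split=> [x _|v]; first exact: differentiable_cst.
by rewrite (_ : 'D_v _ = cst 0)//; apply/funext => x; rewrite derive_cst.
Qed.

Lemma Ck_on_linear k U (f : {linear V -> W}) : continuous f -> Ck_on k U f.
Proof.
move=> fc; case: k => [|k]; first by move=> x _; exact: fc.
split=> [x _|v]; first exact: linear_differentiable.
rewrite (_ : 'D_v _ = cst (f v)); first exact: Ck_on_cst.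
by apply/funext => x; rewrite deriveE ?diff_lin//; exact: linear_differentiable.
Qed.

Lemma Ck_onD k U f g : open U ->
  Ck_on k U f -> Ck_on k U g -> Ck_on k U (f \+ g).
Proof.
move=> Uo; elim: k f g => [|k IH] f g /=.
  by move=> fU gU x Ux; apply: cvgD; [exact: fU|exact: gU].
move=> [df Df] [dg Dg]; split=> [x Ux|v].
  by apply: differentiableD; [exact: df|exact: dg].
apply: eq_Ck_on (IH _ _ (Df v) (Dg v)) => // x /set_mem Ux.
by rewrite -[LHS]deriveD//; apply: diff_derivable; [exact: df|exact: dg].
Qed.

Lemma Ck_onZ k U (c : R) f : open U -> Ck_on k U f -> Ck_on k U (c \*: f).
Proof.
move=> Uo; elim: k f => [|k IH] f /=.
  by move=> fU x Ux; apply: cvgZl_tmp; exact: fU.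
move=> [df Df]; split=> [x Ux|v]; first by apply: differentiableZ; exact: df.
apply: eq_Ck_on (IH _ (Df v)) => // x /set_mem Ux.
by rewrite -[LHS]deriveZ//; apply: diff_derivable; exact: df.
Qed.

Lemma Ck_on_sum k U n (f : 'I_n -> V -> W) : open U ->
  (forall i, Ck_on k U (f i)) -> Ck_on k U (fun x => \sum_(i < n) f i x).
Proof.
move=> Uo; elim: n f => [|n IH] f fU.
  apply: eq_Ck_on (@Ck_on_cst k U 0) => // x _; by rewrite big_ord0.
apply: eq_Ck_on (Ck_onD Uo (IH (fun i => f (widen_ord (leqnSn n) i)) _)
  (fU ord_max)) => [//|x _|i]; last exact: fU.
by rewrite /= big_ord_recr.
Qed.

End CkGeneral.

(** * Products, inverses and square roots of scalar functions *)

Section CkScalar.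
Context {R : realType} {V : normedModType R}.
Implicit Types (U : set V) (f g : V -> R).

Lemma Ck_onM k U f g : open U ->
  Ck_on k U f -> Ck_on k U g -> Ck_on k U (f \* g).
Proof.
move=> Uo; elim: k f g => [|k IH] f g.
  by move=> fU gU x Ux; apply: cvgM; [exact: fU|exact: gU].
move=> cf cg; have [df Df] := cf; have [dg Dg] := cg; split=> [x Ux|v].
  by apply: differentiableM; [exact: df|exact: dg].
have h := Ck_onD Uo (IH _ _ (Ck_onW cf) (Dg v)) (IH _ _ (Ck_onW cg) (Df v)).
apply: eq_Ck_on h => // x /set_mem Ux.
by rewrite -[RHS]/('D_v (f * g) x) deriveM//; apply: diff_derivable;
  [exact: df|exact: dg].
Qed.

Lemma Ck_onN k U f : open U -> Ck_on k U f -> Ck_on k U (\- f).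
Proof.
move=> Uo fU; apply: eq_Ck_on (Ck_onZ (-1) Uo fU) => // x _.
by rewrite /= scaleN1r.
Qed.

(** The derivative - (1/f)^2 D_v f involves 1/f again, but only to the order that the induction has
    already supplied. *)
Lemma Ck_onV k U f : open U -> (forall x, U x -> f x != 0) ->
  Ck_on k U f -> Ck_on k U (fun x => (f x)^-1).
Proof.
move=> Uo f0; elim: k => [|k IH].
  by move=> fU x Ux; apply: cvgV; [exact: f0|exact: fU].
move=> cf; have [df Df] := cf; split=> [x Ux|v].
  by apply: differentiableV; [exact: df|exact: f0].
have h := Ck_onN Uo (Ck_onM Uo (Ck_onM Uo (IH (Ck_onW cf)) (IH (Ck_onW cf))) (Df v)).
apply: eq_Ck_on h => // x /set_mem Ux.
rewrite deriveV ?f0//; last by apply: diff_derivable; exact: df.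
by rewrite /= -mulNr -[(f x)^-2]exprVn expr2 /GRing.scale/=.
Qed.

Lemma is_derive_sqrt_comp f x v : 0 < f x -> differentiable f x ->
  differentiable (Num.sqrt \o f) x /\
  'D_v (Num.sqrt \o f) x = (2 * Num.sqrt (f x))^-1 * 'D_v f x.
Proof.
move=> fx0 df; have [ds Ds] := is_derive1_sqrt fx0.
have ds' : differentiable Num.sqrt (f x) by exact/derivable1_diffP.
have dsf : differentiable (Num.sqrt \o f) x by exact: differentiable_comp.
have E : 'd Num.sqrt (f x) 1 = (2 * Num.sqrt (f x))^-1 by rewrite -deriveE.
split=> //; rewrite !deriveE// diff_comp//=.
rewrite -[X in 'd Num.sqrt _ X]mulr1 -[_ * 1]/('d f x v *: 1) linearZ/=.
by rewrite E; exact: mulrC.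
Qed.

(** The derivative (2 sqrt f)^-1 D_v f is built from sqrt f itself, so order [k] of the square root
    yields order [k.+1]. *)
Lemma Ck_on_sqrt k U f : open U -> (forall x, U x -> 0 < f x) ->
  Ck_on k U f -> Ck_on k U (Num.sqrt \o f).
Proof.
move=> Uo f0; elim: k => [|k IH].
  move=> fU x Ux; apply: continuous_comp; first exact: fU.
  exact: sqrt_continuous.
move=> cf; have [df Df] := cf; split=> [x Ux|v].
  exact: (is_derive_sqrt_comp 0 (f0 _ Ux) (df _ Ux)).1.
have h : Ck_on k U (fun x => (2 * Num.sqrt (f x))^-1).
  apply: Ck_onV => // [x Ux|].
    by rewrite mulf_neq0// gt_eqF// sqrtr_gt0 f0.
  exact: (Ck_onZ 2 Uo (IH (Ck_onW cf))).
apply: eq_Ck_on (Ck_onM Uo h (Df v)) => // x /set_mem Ux.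
by rewrite (is_derive_sqrt_comp v (f0 _ Ux) (df _ Ux)).2.
Qed.

End CkScalar.

(** * Matrix-valued maps, entry by entry *)

Section CkMatrix.
Context {R : realType} {V : normedModType R} {m n : nat}.
Implicit Types (U : set V) (M : V -> 'M[R]_(m, n)).

Lemma differentiable_mxP M x : differentiable M x <->
  forall i j, differentiable (fun y => M y i j) x.
Proof.
split=> [dM i j|dM].
  apply: (@differentiable_comp _ _ _ _ M (fun N : 'M[R]_(m, n) => N i j)) => //.
  exact: differentiable_coord.
rewrite (_ : M = \sum_i \sum_j (fun y => M y i j *: (delta_mx i j : 'M[R]_(m, n)))).
  do 2![apply: differentiable_sum => ?]; exact: differentiableZl.
apply/funext => y; rewrite fct_sumE [LHS]matrix_sum_delta.
by apply: eq_bigr => i _; rewrite fct_sumE.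
Qed.

Lemma derive_mxE M x v i j : differentiable M x ->
  ('D_v M x) i j = 'D_v (fun y => M y i j) x.
Proof. by move=> dM; rewrite derive_mx ?mxE//; exact: diff_derivable. Qed.

Lemma Ck_on_mxP k U M : open U ->
  Ck_on k U M <-> forall i j, Ck_on k U (fun x => M x i j).
Proof.
move=> Uo; elim: k M => [|k IH] M.
  split=> [MU i j x Ux|MU x Ux].
    apply: (@continuous_comp _ _ _ M (fun N : 'M[R]_(m, n) => N i j)).
      exact: MU.
    exact: coord_continuous.
  apply/cvgrPdist_le => e e0; near=> y.
  rewrite /Num.Def.normr/= mx_normrE (bigmax_le _ (ltW e0))//= => i _.
  rewrite !mxE/=; move: i; near: y; apply: filter_forall => /= i.
  exact: ((cvgrPdist_le _ _).1 (MU i.1 i.2 x Ux)).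
split=> [[dM DM] i j|MU].
  split=> [x /dM /differentiable_mxP//|v].
  have /(IH _).1 h := DM v; apply: eq_Ck_on (h i j) => // x /set_mem Ux.
  by rewrite derive_mxE//; exact: dM.
have dM x : U x -> differentiable M x.
  by move=> Ux; apply/differentiable_mxP => i j; exact: (MU i j).1.
split=> // v; apply/IH => i j; apply: eq_Ck_on ((MU i j).2 v) => // x /set_mem Ux.
by rewrite derive_mxE//; exact: dM.
Unshelve. all: by end_near. Qed.

Lemma smooth_on_mxP U M : open U ->
  smooth_on U M <-> forall i j, smooth_on U (fun x => M x i j).
Proof.
move=> Uo; split=> [MU i j k|MU k]; first exact: ((Ck_on_mxP _ _ Uo).1 (MU k)).
by apply/Ck_on_mxP => // i j; exact: MU.
Qed.

End CkMatrix.

(** * Chain rule and composition of maps of class C^k *)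

Section Composition.
Context {R : realType}.

Lemma derive_sum_delta (W : normedModType R) n (f : 'rV[R]_n -> W) x v :
  differentiable f x -> 'D_v f x = \sum_i v 0 i *: 'D_(delta_mx 0 i) f x.
Proof.
move=> df; rewrite deriveE// {1}(row_sum_delta v) linear_sum.
by apply: eq_bigr => i _; rewrite linearZ deriveE.
Qed.

Lemma derive_comp (V W : normedModType R) n (f : 'rV[R]_n -> W)
    (g : V -> 'rV[R]_n) x v :
  differentiable g x -> differentiable f (g x) ->
  'D_v (f \o g) x = 'D_('D_v g x) f (g x).
Proof.
by move=> dg df; rewrite !deriveE//; [rewrite diff_comp|exact: differentiable_comp].
Qed.

Lemma derive_comp_normed (V V' W : normedModType R) (f : V' -> W)
    (g : V -> V') x v :
  differentiable g x -> differentiable f (g x) ->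
  'D_v (f \o g) x = 'D_('D_v g x) f (g x).
Proof.
by move=> dg df; rewrite !deriveE//; [rewrite diff_comp|exact: differentiable_comp].
Qed.

Lemma derive_comp_R (V W : normedModType R) (f : R -> W) (g : V -> R) x v :
  differentiable g x -> differentiable f (g x) ->
  'D_v (f \o g) x = 'D_v g x *: 'D_1 f (g x).
Proof.
move=> dg df; rewrite !deriveE//; last exact: differentiable_comp.
rewrite diff_comp//=; rewrite -linearZ; congr ('d f _ _).
by rewrite /GRing.scale/= mulr1.
Qed.

Lemma derive_rVE (V : normedModType R) n (g : V -> 'rV[R]_n) x v i :
  differentiable g x -> ('D_v g x) 0 i = 'D_v (fun y => g y 0 i) x.
Proof. exact: derive_mxE. Qed.

Lemma differentiable_rVP (V : normedModType R) n (g : V -> 'rV[R]_n) x :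
  differentiable g x <-> forall i, differentiable (fun y => g y 0 i) x.
Proof.
rewrite differentiable_mxP; split=> [h i|h i j]; first exact: h.
by rewrite ord1.
Qed.

(** By the chain rule D_v (f o g) is the sum over i of (D_v g)_i times (d_i f) o g. The partial
    derivatives of [f] fall under the induction hypothesis, [g] being kept fixed. *)
Lemma Ck_on_comp_scalar (V : normedModType R) n k (U : set V)
    (U' : set 'rV[R]_n) (f : 'rV[R]_n -> R) (g : V -> 'rV[R]_n) :
  open U -> (forall x, U x -> U' (g x)) ->
  Ck_on k U' f -> Ck_on k U g -> Ck_on k U (f \o g).
Proof.
move=> Uo UU'; elim: k f => [|k IH] f.
  by move=> fU gU x Ux; apply: continuous_comp; [exact: gU|exact/fU/UU'].
move=> [df Df] cg; have [dg Dg] := cg; split=> [x Ux|v].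
  by apply: differentiable_comp; [exact: dg|exact/df/UU'].
have h : Ck_on k U (fun x => \sum_i ('D_v g x) 0 i *
    ('D_(delta_mx 0 i) f \o g) x).
  apply: Ck_on_sum => // i; apply: Ck_onM => //.
    exact: ((Ck_on_mxP k _ Uo).1 (Dg v)).
  exact: IH (Df _) (Ck_onW cg).
apply: eq_Ck_on h => // x /set_mem Ux; have UgX := UU' _ Ux.
rewrite derive_comp; [|exact: dg|exact: df].
by rewrite derive_sum_delta//; exact: df.
Qed.

Lemma Ck_on_comp_R_scalar (V : normedModType R) k (U : set V)
    (U' : set R) (f : R -> R) (g : V -> R) :
  open U -> (forall x, U x -> U' (g x)) ->
  Ck_on k U' f -> Ck_on k U g -> Ck_on k U (f \o g).
Proof.
move=> Uo UU'; elim: k f => [|k IH] f.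
  by move=> fU gU x Ux; apply: continuous_comp; [exact: gU|exact/fU/UU'].
move=> [df Df] cg; have [dg Dg] := cg; split=> [x Ux|v].
  by apply: differentiable_comp; [exact: dg|exact/df/UU'].
have h := Ck_onM Uo (Dg v) (IH _ (Df 1) (Ck_onW cg)).
apply: eq_Ck_on h => // x /set_mem Ux; have UgX := UU' _ Ux.
by rewrite derive_comp_R; [|exact: dg|exact: df].
Qed.

End Composition.

Lemma Ck_on_comp (R : realType) (V : normedModType R) m n p k (U : set V)
    (U' : set 'rV[R]_p) (f : 'rV[R]_p -> 'M[R]_(m, n)) (g : V -> 'rV[R]_p) :
  open U -> open U' -> (forall x, U x -> U' (g x)) ->
  Ck_on k U' f -> Ck_on k U g -> Ck_on k U (f \o g).
Proof.
move=> Uo U'o UU' fU gU; apply/Ck_on_mxP => // i j.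
apply: (Ck_on_comp_scalar Uo UU' (f := fun y => f y i j)) gU.
exact: ((Ck_on_mxP k f U'o).1 fU i j).
Qed.

Section Smooth.
Context {R : realType} {V : normedModType R}.
Implicit Types (U : set V) (f g : V -> R).

Lemma smooth_on_cst (W : normedModType R) U (c : W) : smooth_on U (fun=> c).
Proof. by move=> k; exact: Ck_on_cst. Qed.

Lemma smooth_on_linear (W : normedModType R) U (f : {linear V -> W}) :
  continuous f -> smooth_on U f.
Proof. by move=> fc k; exact: Ck_on_linear. Qed.

Lemma smooth_onD (W : normedModType R) U (f g : V -> W) : open U ->
  smooth_on U f -> smooth_on U g -> smooth_on U (fun x => f x + g x).
Proof. by move=> Uo fU gU k; exact: Ck_onD. Qed.

Lemma smooth_onZ (W : normedModType R) U c (f : V -> W) : open U ->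
  smooth_on U f -> smooth_on U (fun x => c *: f x).
Proof. by move=> Uo fU k; exact: Ck_onZ. Qed.

Lemma smooth_on_sum (W : normedModType R) U n (f : 'I_n -> V -> W) : open U ->
  (forall i, smooth_on U (f i)) -> smooth_on U (fun x => \sum_i f i x).
Proof. by move=> Uo fU k; apply: Ck_on_sum => // i; exact: fU. Qed.

Lemma smooth_onN U f : open U -> smooth_on U f -> smooth_on U (fun x => - f x).
Proof. by move=> Uo fU k; exact: Ck_onN. Qed.

Lemma smooth_onB U f g : open U ->
  smooth_on U f -> smooth_on U g -> smooth_on U (fun x => f x - g x).
Proof. by move=> Uo fU gU; apply: smooth_onD => //; exact: smooth_onN. Qed.

Lemma smooth_onM U f g : open U ->
  smooth_on U f -> smooth_on U g -> smooth_on U (fun x => f x * g x).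
Proof. by move=> Uo fU gU k; exact: Ck_onM. Qed.

Lemma smooth_onV U f : open U -> (forall x, U x -> f x != 0) ->
  smooth_on U f -> smooth_on U (fun x => (f x)^-1).
Proof. by move=> Uo f0 fU k; exact: Ck_onV. Qed.

Lemma smooth_on_sqrt U f : open U -> (forall x, U x -> 0 < f x) ->
  smooth_on U f -> smooth_on U (fun x => Num.sqrt (f x)).
Proof. by move=> Uo f0 fU k; exact: Ck_on_sqrt. Qed.

Lemma smooth_on_comp m n p U (U' : set 'rV[R]_p) (f : 'rV[R]_p -> 'M[R]_(m, n))
    (g : V -> 'rV[R]_p) : open U -> open U' -> (forall x, U x -> U' (g x)) ->
  smooth_on U' f -> smooth_on U g -> smooth_on U (f \o g).
Proof. by move=> Uo U'o UU' fU gU k; exact: Ck_on_comp (fU k) (gU k). Qed.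

Lemma smooth_on_comp_scalar p U (U' : set 'rV[R]_p) (f : 'rV[R]_p -> R)
    (g : V -> 'rV[R]_p) : open U -> (forall x, U x -> U' (g x)) ->
  smooth_on U' f -> smooth_on U g -> smooth_on U (f \o g).
Proof. by move=> Uo UU' fU gU k; exact: Ck_on_comp_scalar (fU k) (gU k). Qed.

Lemma smooth_on_comp_R m n U (U' : set R) (f : R -> 'M[R]_(m, n))
    (g : V -> R) : open U -> open U' -> (forall x, U x -> U' (g x)) ->
  smooth_on U' f -> smooth_on U g -> smooth_on U (f \o g).
Proof.
move=> Uo U'o UU' fU gU; apply/smooth_on_mxP => // i j k.
apply: (Ck_on_comp_R_scalar Uo UU' (f := fun y => f y i j)) (gU k).
exact: ((smooth_on_mxP _ U'o).1 fU).
Qed.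

Lemma smooth_on_comp_R_scalar U (U' : set R) (f : R -> R)
    (g : V -> R) : open U -> (forall x, U x -> U' (g x)) ->
  smooth_on U' f -> smooth_on U g -> smooth_on U (f \o g).
Proof. by move=> Uo UU' fU gU k; exact: Ck_on_comp_R_scalar (fU k) (gU k). Qed.

Lemma smooth_on_rVP n U (g : V -> 'rV[R]_n) : open U ->
  smooth_on U g <-> forall i, smooth_on U (fun x => g x 0 i).
Proof.
move=> Uo; rewrite smooth_on_mxP//; split=> [h i|h i j]; first exact: h.
by rewrite ord1.
Qed.

Lemma smooth_on_mulmx m n p U (A : V -> 'M[R]_(m, n)) (B : V -> 'M[R]_(n, p)) :
  open U -> smooth_on U A -> smooth_on U B -> smooth_on U (fun x => A x *m B x).
Proof.
move=> Uo /(smooth_on_mxP _ Uo) AU /(smooth_on_mxP _ Uo) BU.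
apply/smooth_on_mxP => // i j.
apply: eq_smooth_on (smooth_on_sum Uo (fun l => smooth_onM Uo (AU i l) (BU l j))).
  by [].
by move=> x _; rewrite mxE.
Qed.

Lemma smooth_on_det n U (A : V -> 'M[R]_n) : open U ->
  smooth_on U A -> smooth_on U (fun x => \det (A x)).
Proof.
move=> Uo /(smooth_on_mxP _ Uo) AU.
elim: n A AU => [|n IH] A AU.
  apply: eq_smooth_on (@smooth_on_cst R U 1) => // x _; by rewrite det_mx00.
apply: eq_smooth_on (smooth_on_sum Uo (fun j => smooth_onM Uo (AU 0 j)
  (smooth_onZ ((-1) ^+ (0 + j)%N) Uo (IH (fun x => row' 0 (col' j (A x))) _)))) => //.
  by move=> x _; rewrite (expand_det_row _ 0).
move=> j i l; apply: eq_smooth_on (AU (lift 0 i) (lift j l)) => // x _.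
by rewrite !mxE.
Qed.

(** Cramer's rule: the entries are cofactors divided by a nonvanishing determinant. *)
Lemma smooth_on_invmx n U (A : V -> 'M[R]_n) : open U ->
  (forall x, U x -> A x \in unitmx) ->
  smooth_on U A -> smooth_on U (fun x => invmx (A x)).
Proof.
move=> Uo Au AU; have dU := smooth_on_det Uo AU.
have iU : smooth_on U (fun x => (\det (A x))^-1).
  by apply: smooth_onV => // x /Au; rewrite unitmxE unitfE.
apply/smooth_on_mxP => // i j.
have cU : smooth_on U (fun x => cofactor (A x) j i).
  apply: smooth_onZ => //; apply: smooth_on_det => //.
  apply/smooth_on_mxP => // a b.
  apply: eq_smooth_on ((smooth_on_mxP _ Uo).1 AU (lift j a) (lift i b)) => // x _.
  by rewrite !mxE.
apply: eq_smooth_on (smooth_onM Uo iU cU) => // x /set_mem /Au Ax.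
by rewrite /invmx Ax !mxE.
Qed.

End Smooth.

(** * Jacobian matrices *)

Section Jacobian.
Context {R : realType}.

Lemma row_jacobian m n (f : 'rV[R]_m -> 'rV[R]_n) x i :
  differentiable f x -> row i ('J f x) = pd i f x.
Proof. by move=> df; rewrite /pd deriveEjacobian// -rowE. Qed.

Lemma jacobianE m n (f : 'rV[R]_m -> 'rV[R]_n) x i j :
  differentiable f x -> 'J f x i j = pd i (fun y => f y 0 j) x.
Proof.
move=> df; rewrite -[RHS](@derive_rVE _ _ _ f)//.
by rewrite -/(pd i f x) -row_jacobian// [RHS]mxE.
Qed.

Lemma jacobian_comp m n p (g : 'rV[R]_n -> 'rV[R]_p) (f : 'rV[R]_m -> 'rV[R]_n) x :
  differentiable f x -> differentiable g (f x) ->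
  'J (g \o f) x = 'J f x *m 'J g (f x).
Proof.
move=> df dg; apply/row_matrixP => i.
rewrite row_mul row_jacobian; last exact: differentiable_comp.
by rewrite /pd derive_comp// !deriveEjacobian// -rowE.
Qed.

Lemma near_eq_jacobian m n (f g : 'rV[R]_m -> 'rV[R]_n) x :
  {near x, f =1 g} -> differentiable f x -> 'J f x = 'J g x.
Proof.
move=> fg df; have dg := near_eq_differentiable fg df.
apply/row_matrixP => i.
apply: etrans (row_jacobian i df) _.
apply: etrans _ (esym (row_jacobian i dg)).
exact: (@near_eq_derive _ _ _ _ _ _ _ fg).
Qed.

Lemma jacobian_id m (x : 'rV[R]_m) : 'J id x = 1%:M.
Proof.
by apply/row_matrixP => i; rewrite row_jacobian// /pd derive_id row1.
Qed.

Lemma smooth_on_jacobian m n (U : set 'rV[R]_m) (f : 'rV[R]_m -> 'rV[R]_n) :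
  open U -> smooth_on U f -> smooth_on U (jacobian f).
Proof.
move=> Uo fU; apply/smooth_on_mxP => // i j.
have /(smooth_on_rVP _ Uo)/(_ j) h := @smooth_on_derive _ _ _ _ _ (delta_mx 0 i) fU.
apply: eq_smooth_on h => // x /set_mem Ux.
have df := smooth_on_differentiable fU Ux.
by rewrite derive_rVE// jacobianE.
Qed.

End Jacobian.

(** * Mean value theorem, mixed derivatives, primitives *)

Section MeanValue.
Context {R : realType} {V : normedModType R}.

Lemma is_derive_line (W : normedModType R) (f : V -> W) (p u : V) (t : R) :
  differentiable f (p + t *: u) ->
  is_derive t 1 (fun s : R => f (p + s *: u)) ('D_u f (p + t *: u)).
Proof.
move=> df; pose g (s : R) := p + s *: u.
pose l (s : R) := s *: u.
have [dl Dl] : is_diff t l l by exact: is_diff_scalel.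
have dg : differentiable g t by apply: (@differentiableD _ _ _ (cst p)).
have Dg : 'D_1 g t = u.
  have -> : 'D_1 g t = 'D_1 (cst p) t + 'D_1 l t.
    apply: (@deriveD _ _ _ (cst p)) => //; exact: diff_derivable.
  by rewrite derive_cst add0r (deriveE _ dl) Dl /l scale1r.
have dfg : differentiable (f \o g) t by exact: differentiable_comp.
apply: DeriveDef; first exact: diff_derivable.
by rewrite -[LHS]/('D_1 (f \o g) t) derive_comp_normed// Dg.
Qed.

Lemma line_MVT (f : V -> R) (p u : V) (h : R) : 0 < h ->
  (forall t, 0 <= t <= h -> differentiable f (p + t *: u)) ->
  exists2 c, 0 < c < h & f (p + h *: u) - f p = 'D_u f (p + c *: u) * h.
Proof.
move=> h0 df; pose g (t : R) := f (p + t *: u).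
have [||c] := @MVT R g (fun t => 'D_u f (p + t *: u)) 0 h h0.
- move=> t; rewrite in_itv/= => /andP[t0 th].
  by apply: is_derive_line; apply: df; rewrite !ltW.
- apply: derivable_within_continuous => t; rewrite in_itv/= => tI.
  by have [] := is_derive_line (df _ tI).
rewrite in_itv/= /g scale0r addr0 subr0 => cI ->.
by exists c.
Qed.

(* The second difference of f over the parallelogram spanned by hu and hv is
   symmetric in u and v and is h^2 times a value of either mixed derivative. *)
Lemma second_difference (U : set V) (f : V -> R) (x u v : V) (r h : R) :
  ball x r `<=` U -> Ck_on 2 U f -> 0 < h -> h * (`|u| + `|v|) < r ->
  exists2 y, ball x r y &
    f (x + h *: u + h *: v) - f (x + h *: u) - (f (x + h *: v) - f x) =
    'D_v ('D_u f) y * h * h.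
Proof.
move=> rU [df Df] h0 hr.
have xb s t : 0 <= s <= h -> 0 <= t <= h -> ball x r (x + s *: u + t *: v).
  move=> /andP[s0 sh] /andP[t0 th]; rewrite -ball_normE/= -addrA opprD addNKr normrN.
  apply: le_lt_trans hr; apply: le_trans (ler_normD _ _) _.
  by rewrite !normrZ !ger0_norm// mulrDr lerD// ler_wpM2r.
have h0h : 0 <= h <= h by rewrite lexx ltW.
have z0h : 0 <= (0:R) <= h by rewrite lexx ltW.
(* The second difference is the increment of [g] along h u. The mean value theorem is applied to [g]
   in the direction u, then to D_u f in the direction v. *)
pose g y := f (y + h *: v) - f y.
have dg s : 0 <= s <= h -> is_derive (x + s *: u) u g
    ('D_u f (x + s *: u + h *: v) - 'D_u f (x + s *: u)).
  move=> sh; pose sh1 (y : V) := y + h *: v.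
  have d1 : differentiable f (x + s *: u).
    by apply: df; apply: rU; have := xb s 0 sh z0h; rewrite scale0r addr0.
  have d2 : differentiable f (sh1 (x + s *: u)) by apply: df; apply: rU; exact: xb.
  have d3 : differentiable sh1 (x + s *: u).
    by apply: (@differentiableD _ _ _ id (cst (h *: v))).
  have d4 : 'D_u sh1 (x + s *: u) = u.
    rewrite -[LHS]/('D_u (id + cst (h *: v)) _) deriveD//.
    by rewrite derive_id derive_cst addr0.
  have d5 : derivable (f \o sh1) (x + s *: u) u.
    by apply: diff_derivable; exact: differentiable_comp.
  have d6 : derivable f (x + s *: u) u by exact: diff_derivable d1.
  have -> : g = (f \o sh1) - f by [].
  apply: DeriveDef; first exact: (derivableB d5 d6).
  apply: etrans (deriveB d5 d6) _; congr (_ - _).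
  by rewrite (derive_comp_normed _ d3 d2) d4.
have dg' s : 0 <= s <= h -> differentiable g (x + s *: u).
  move=> sh; apply: differentiableB.
    apply: (@differentiable_comp _ _ _ _ (fun y => y + h *: v) f).
      by apply: (@differentiableD _ _ _ id (cst (h *: v))).
    by apply: df; apply: rU; exact: xb.
  by apply: df; apply: rU; have := xb s 0 sh z0h; rewrite scale0r addr0.
have [c /andP[c0 ch] gE] := line_MVT h0 dg'.
have chh : 0 <= c <= h by rewrite !ltW.
have [|c' /andP[c'0 c'h] DE] := @line_MVT ('D_u f) (x + c *: u) v h h0.
  by move=> t th; apply: (Df u).1; apply: rU; exact: xb.
exists (x + c *: u + c' *: v); first by apply: xb => //; rewrite !ltW.
by rewrite -DE -[LHS]/(g (x + h *: u) - g x) gE; have [_ ->] := dg c chh.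
Qed.

(** Schwarz's theorem. Each mixed derivative, taken at some point of a small ball around [x], is the
    same second difference divided by h^2, and both are continuous at [x]. *)
Lemma derive_swap (U : set V) (f : V -> R) (x u v : V) :
  open U -> U x -> Ck_on 2 U f -> 'D_u ('D_v f) x = 'D_v ('D_u f) x.
Proof.
move=> Uo Ux cf; apply/eqP; rewrite -subr_eq0 -normr_le0; apply/ler_addgt0Pr => e e0.
rewrite add0r.
have cvu : {for x, continuous ('D_u ('D_v f))} by apply: (cf.2 v).2.
have cuv : {for x, continuous ('D_v ('D_u f))} by apply: (cf.2 u).2.
have e2 : 0 < e / 2 by rewrite divr_gt0.
have /nbhs_ballP[r /= r0 rP] : \forall y \near x, [/\ U y,
    `|'D_u ('D_v f) x - 'D_u ('D_v f) y| < e / 2 &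
    `|'D_v ('D_u f) x - 'D_v ('D_u f) y| < e / 2].
  have n1 : nbhs x U by exact: open_nbhs_nbhs.
  have n2 := (cvgrPdist_lt _ _).1 cvu _ e2.
  have n3 := (cvgrPdist_lt _ _).1 cuv _ e2.
  have Fx := nbhs_filter x.
  by apply: (filterS3 Fx _ n1 (n2 Fx) (n3 Fx)) => y; exact: And3.
(* The summand 1 keeps [k] positive when u and v vanish. *)
pose k := `|u| + `|v| + 1.
have k0 : 0 < k by rewrite ltr_wpDl// addr_ge0.
pose h := r / k / 2.
have h0 : 0 < h by rewrite !divr_gt0.
have hr : h * (`|u| + `|v|) < r.
  have : h * k < r.
    rewrite /h mulrAC divfK ?gt_eqF// ltr_pdivrMr// ltr_pMr// ltr1n//.
  by apply: le_lt_trans; rewrite ler_pM2l// lerDl.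
have rU : ball x r `<=` U by move=> y /rP[].
have [y1 /rP[_ _ y1P] E1] := second_difference rU cf h0 hr.
rewrite addrC in hr.
have [y2 /rP[_ y2P _] E2] := second_difference rU cf h0 hr.
move: y1P y2P E1 E2.
 generalize ('D_u ('D_v f) x) ('D_v ('D_u f) x) ('D_u ('D_v f) y2)
  ('D_v ('D_u f) y1) => a0 b0 a b b0b a0a.
rewrite [x + h *: v + h *: u]addrAC => E1 E2.
have ab : a * h * h = b * h * h by rewrite -E1 -E2; ring.
have hn : h != 0 by rewrite gt_eqF.
move: ab => /(mulIf hn) /(mulIf hn) ab.
rewrite -(subrKA a) [X in _ + (X - _)]ab.
apply: le_trans (ler_normD _ _) _.
by rewrite (splitr e) lerD// ltW// distrC.
Qed.

(** The mean value theorem is used on the unit interval in the direction h u, so that [h] may have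
    either sign or be 0. *)
Lemma derive_eq0_line (f : V -> R) (p u : V) (h : R) :
  (forall t, 0 <= t <= 1 -> differentiable f (p + t *: (h *: u)) /\
     'D_u f (p + t *: (h *: u)) = 0) ->
  f (p + h *: u) = f p.
Proof.
move=> fP; have [t /fP[]//|c /andP[c0 c1]] := @line_MVT f p (h *: u) 1 ltr01.
rewrite scale1r mulr1; have [|df Df] := fP c; first by rewrite !ltW.
rewrite deriveE// linearZ -deriveE// Df /= scaler0 => /eqP.
by rewrite subr_eq0 => /eqP.
Qed.

End MeanValue.

(** * Primitives of smooth functions on the line *)

Section Primitive.
Context {R : realType}.

(** On the line every directional derivative of [F] is a multiple of [f], so [F] gains one order
    over [f]. *)
Lemma smooth_on_primitive (U : set R) (F f : R -> R) : open U ->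
  (forall x, U x -> is_derive x 1 F (f x)) -> smooth_on U f -> smooth_on U F.
Proof.
move=> Uo dF fU k.
have dF' x : U x -> differentiable F x.
  by move=> /dF[? _]; exact/derivable1_diffP.
suff h : Ck_on k.+1 U F by exact: Ck_onW.
split=> // v; apply: eq_Ck_on (Ck_onZ v Uo (fU k)) => // x /set_mem Ux.
rewrite deriveE; last exact: dF'.
rewrite -[X in 'd F x X]mulr1 -[v * 1]/(v *: 1) linearZ/= -deriveE; last exact: dF'.
by have [_ ->] := dF _ Ux.
Qed.

Lemma primitive_ex (f : R -> R) (p r : R) : 0 < r ->
  (forall x, ball p r x -> {for x, continuous f}) ->
  exists F, forall x, ball p (r / 2) x -> is_derive x 1 F (f x).
Proof.
move=> r0 cf.
(* A radius strictly between r/2 and r: [f] is continuous on the closed interval, and the points of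
   the smaller ball are interior to it. *)
pose a := p - r * (3 / 4); pose b := p + r * (3 / 4).
have fi : (@lebesgue_measure R).-integrable `[a, b] (EFin \o f).
  apply: continuous_compact_integrable; first exact: segment_compact.
  apply: continuous_in_subspaceT => x; rewrite inE/= in_itv/= => /andP[ax xb].
  apply: cf; rewrite /ball/=; rewrite ltr_distlC; apply/andP; split.
    by apply: lt_le_trans ax; rewrite /a; lra.
  by apply: le_lt_trans xb _; rewrite /b; lra.
exists (fun x => \int[@lebesgue_measure R]_(t in `[a, x]) f t)%R.
move=> x; rewrite /ball/= ltr_distlC => /andP[xl xu].
have xb : x < b by rewrite /b; lra.
have ax : a < x by rewrite /a; lra.
have xc : {for x, continuous f}.
  by apply: cf; rewrite /ball/= ltr_distlC; apply/andP; split; lra.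
have [dF DF] := continuous_FTC1_closed xb fi ax xc.
by apply: DeriveDef; [exact: dF|exact: etrans (esym (derive1E _ _)) DF].
Qed.

End Primitive.

(** * Inverse function theorem *)

(** Completeness of spaces of matrices, for Banach's fixed point theorem in the space of row
    vectors. *)
HB.instance Definition _ (R : realType) (m n : nat) :=
  Uniform_isComplete.Build 'M[R]_(m, n) (@cauchy_cvg _).

Section InverseFunction.
Context {R : realType}.

Lemma mx_norm_leP m n (A : 'M[R]_(m, n)) (e : R) : 0 <= e ->
  (forall i j, `|A i j| <= e) -> `|A| <= e.
Proof.
by move=> e0 Ae; rewrite /Num.Def.normr/= mx_normrE (bigmax_le _ e0).
Qed.

Lemma mx_norm_ge m n (A : 'M[R]_(m, n)) i j : `|A i j| <= `|A|.
Proof.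
by rewrite [leRHS]/Num.Def.normr/= mx_normrE; exact: (le_bigmax _ _ (i, j)).
Qed.

Lemma continuous_mulmxr m n (B : 'M[R]_(m, n)) :
  continuous (fun v : 'rV[R]_m => v *m B).
Proof.
move=> x; apply: (@smooth_on_continuous _ _ _ setT) => //.
apply: smooth_on_mulmx; [exact: openT| |exact: smooth_on_cst].
by apply: (@smooth_on_linear _ _ _ _ idfun) => y.
Qed.

Lemma mulmx_norm_le m n (B : 'M[R]_(m, n)) :
  exists2 c : R, 0 < c & forall v : 'rV[R]_m, `|v *m B| <= c * `|v|.
Proof.
pose c := \sum_i `|row i B| + 1.
exists c; first by rewrite ltr_wpDl// sumr_ge0.
move=> v; rewrite {1}(row_sum_delta v) mulmx_suml mulrDl mul1r.
apply: le_trans (ler_norm_sum _ _ _) _.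
rewrite -[leLHS]addr0 lerD// mulr_suml ler_sum// => i _.
by rewrite -scalemxAl -rowE normrZ mulrC ler_wpM2l// mx_norm_ge.
Qed.

(** The mean value theorem is applied to each component along the segment from y to x, which stays
    in the ball by convexity. The norm is the maximum of the entries, and a column of the Jacobian
    has m entries, whence the factor m. *)
Lemma lipschitz_ball m n (h : 'rV[R]_m -> 'rV[R]_n) (p : 'rV[R]_m) (r e : R) :
  0 <= e ->
  (forall x, ball p r x -> differentiable h x) ->
  (forall x, ball p r x -> forall i j, `|'J h x i j| <= e) ->
  forall x y, ball p r x -> ball p r y -> `|h x - h y| <= m%:R * e * `|x - y|.
Proof.
move=> e0 dh Jh x y xb yb.
have [xy|xy] := eqVneq x y; first by rewrite xy !subrr !normr0 mulr0.
have lineb t : 0 <= t <= 1 -> ball p r (y + t *: (x - y)).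
  move=> /andP[t0 t1]; rewrite -ball_normE/= in xb yb *.
  have -> : p - (y + t *: (x - y)) = t *: (p - x) + (1 - t) *: (p - y).
    by rewrite !scalerBr !scalerBl !scale1r; apply/rowP => i; rewrite !mxE; ring.
  apply: le_lt_trans (ler_normD _ _) _; rewrite !normrZ.
  rewrite (ger0_norm t0) ger0_norm ?subr_ge0//.
  have [->|t1'] := eqVneq t 1; first by rewrite subrr mul0r addr0 mul1r.
  have t2 : 0 < 1 - t by rewrite subr_gt0 lt_neqAle t1' t1.
  have -> : r = t * r + (1 - t) * r by ring.
  by rewrite ler_ltD// ?ltr_pM2l// ler_wpM2l// ltW.
apply: mx_norm_leP => [|i j]; first by rewrite !mulr_ge0.
rewrite ord1 !mxE.
have [t tI|c /andP[c0 c1]] := @line_MVT R _ (fun z => h z 0 j) y (x - y) 1 ltr01.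
  have /differentiable_rVP := dh _ (lineb t tI); exact.
rewrite scale1r [y + _]addrC subrK mulr1 => ->.
have cb : ball p r (y + c *: (x - y)) by apply: lineb; rewrite !ltW.
have dhc := dh _ cb.
have dhj := (differentiable_rVP h _).1 dhc j.
rewrite derive_sum_delta// (le_trans (ler_norm_sum _ _ _))//.
have -> : m%:R * e * `|x - y| = \sum_(i < m) e * `|x - y|.
  by rewrite sumr_const card_ord -mulrA mulr_natl.
apply: ler_sum => i' _; rewrite normrM mulrC; apply: ler_pM => //; last exact: mx_norm_ge.
by have := Jh _ cb i' j; rewrite jacobianE.
Qed.

Lemma derive_mulmxr (V : normedModType R) m n p (f : V -> 'M[R]_(m, n))
    (B : 'M[R]_(n, p)) x v : differentiable f x ->
  differentiable (fun y => f y *m B) x /\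
  'D_v (fun y => f y *m B) x = 'D_v f x *m B.
Proof.
move=> df; have dfB : differentiable (fun y => f y *m B) x.
  apply/differentiable_mxP => i j.
  rewrite (_ : (fun _ => _) = \sum_k (B k j \*: (fun y => f y i k))).
    apply: differentiable_sum => k; apply: differentiableZ.
    exact: (differentiable_mxP _ _).1.
  by apply/funext => y; rewrite mxE fct_sumE; apply: eq_bigr => k _; rewrite mulrC.
split=> //; apply/matrixP => i j; rewrite derive_mxE// mxE.
have dk k : derivable (fun y => f y i k) x v.
  exact/diff_derivable/(differentiable_mxP _ _).1.
rewrite (_ : (fun _ => _) = \sum_k (B k j \*: (fun y => f y i k))); last first.
  by apply/funext => y; rewrite mxE fct_sumE; apply: eq_bigr => k _; rewrite mulrC.
rewrite derive_sum => [|k]; last exact: derivableZ.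
by apply: eq_bigr => k _; rewrite deriveZ// derive_mxE// mulrC.
Qed.

Lemma near_ball (V : normedModType R) (x : V) (P : V -> Prop) :
  (\forall y \near x, P y) -> exists2 r : R, 0 < r & forall y, ball x r y -> P y.
Proof. by move=> /nbhs_ballP[r /= r0 rP]; exists r. Qed.

Lemma near_dist_lt (V W : normedModType R) (f : V -> W) x (e : R) :
  {for x, continuous f} -> 0 < e -> \forall y \near x, `|f x - f y| < e.
Proof. by move=> fx e0; have /cvgrPdist_lt := fx; apply. Qed.

Lemma near_neq0 (V : normedModType R) (f : V -> R) x :
  {for x, continuous f} -> f x != 0 -> \forall y \near x, f y != 0.
Proof.
move=> fx f0; have fx0 : 0 < `|f x| by rewrite normr_gt0.
apply: filterS (near_dist_lt fx fx0) => y; apply: contraTneq => ->.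
by rewrite subr0 ltxx.
Qed.

(** The map h = id - f B has zero Jacobian at [u0] and so contracts by one half nearby; f u = w
    becomes the fixed point equation u = h u + w B. *)
Lemma inverse_function_setup n (U : set 'rV[R]_n) (f : 'rV[R]_n -> 'rV[R]_n)
    (u0 : 'rV[R]_n) (B := invmx ('J f u0)) (h := fun u => u - f u *m B) :
  open U -> U u0 -> smooth_on U f -> 'J f u0 \in unitmx ->
  exists2 r : R, 0 < r & [/\ ball u0 r `<=` U,
    forall u, ball u0 r u -> 'J f u \in unitmx &
    forall u v, ball u0 r u -> ball u0 r v -> `|h u - h v| <= 2^-1 * `|u - v| ].
Proof.
move=> Uo Uu0 sf Ju0.
have dh u : U u -> differentiable h u /\ 'J h u = 1%:M - 'J f u *m B.
  move=> Uu; have df := smooth_on_differentiable sf Uu.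
  have [dfB _] := derive_mulmxr B 0 df.
  have dhu : differentiable h u by exact: (@differentiableB _ _ _ id).
  split=> //; apply/row_matrixP => i.
  apply: etrans (row_jacobian i dhu) _.
  have -> : pd i h u = 'D_(delta_mx 0 i) id u -
      'D_(delta_mx 0 i) (fun y => f y *m B) u.
    apply: (@deriveB _ _ _ id (fun y => f y *m B)); first exact: derivable_id.
    exact: diff_derivable.
  rewrite derive_id (derive_mulmxr B (delta_mx 0 i) df).2.
  by rewrite linearB/= row1 row_mul (row_jacobian i df).
have sJ := smooth_on_jacobian Uo sf.
have sJh : smooth_on U (fun u => 1%:M - 'J f u *m B).
  have sJB := smooth_on_mulmx Uo sJ (smooth_on_cst U B).
  apply/smooth_on_mxP => // i j.
  have := smooth_onB Uo (smooth_on_cst U (1%:M i j : R))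
    ((smooth_on_mxP _ Uo).1 sJB i j).
  apply: eq_smooth_on => // u _.
  by rewrite [RHS]mxE; congr (_ + _); rewrite [RHS]mxE.
(* With this bound on the entries of the Jacobian of [h], n e is at most 1/2; n + 1 keeps [e]
   positive when n = 0. *)
pose e : R := (2 * n.+1%:R)^-1.
have e0 : 0 < e by rewrite invr_gt0 mulr_gt0.
have [G GE] : exists G : 'rV[R]_n -> 'M[R]_n,
  G = (fun u => 1%:M - 'J f u *m B) by eexists.
have G0 : G u0 = 0 by rewrite GE (mulmxV Ju0) subrr.
rewrite -GE in sJh.
have near1 : \forall u \near u0, forall ij : 'I_n * 'I_n, `|G u ij.1 ij.2| <= e.
  apply: (filter_forall (nbhs_filter u0)) => -[i j] /=.
  have cij := smooth_on_continuous ((smooth_on_mxP _ Uo).1 sJh i j) Uu0.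
  apply: filterS (near_dist_lt cij e0) => u.
  by rewrite G0 mxE sub0r normrN => /ltW.
have near2 : \forall u \near u0, \det ('J f u) != 0.
  have cd := smooth_on_continuous (smooth_on_det Uo sJ) Uu0.
  have d0 : \det ('J f u0) != 0 by move: Ju0; rewrite unitmxE unitfE.
  exact: near_neq0 cd d0.
have near3 : nbhs u0 U by exact: open_nbhs_nbhs.
have [r r0 rP] := near_ball (filterI near3 (filterI near1 near2)).
have rU : ball u0 r `<=` U by move=> u /rP[].
exists r; first exact: r0.
split; [exact: rU|by move=> u /rP[_ [_]]; rewrite unitmxE unitfE|].
move=> u v ub vb.
have e1 : n%:R * e <= 2^-1.
  rewrite /e invfM mulrCA -[leRHS]mulr1 ler_wpM2l// ler_pdivrMr// mul1r.
  by rewrite ler_nat.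
apply: le_trans (_ : _ <= n%:R * e * `|u - v|) _; last exact: ler_wpM2r.
apply: (lipschitz_ball (ltW e0) _ _ ub vb) => x xb.
  by have [] := dh _ (rU _ xb).
move=> i j; have [_ [+ _]] := rP _ xb => /(_ (i, j)) /=.
by rewrite GE (dh _ (rU _ xb)).2.
Qed.

End InverseFunction.

Section InverseFunctionTheorem.
Context {R : realType}.

(** Banach's theorem on a closed ball, whence the non-strict inequalities. *)
Lemma half_contraction_fixed_point n (T : 'rV[R]_n -> 'rV[R]_n) u0 (r : R) :
  0 < r -> (forall u, `|u0 - u| <= r -> `|u0 - T u| <= r) ->
  (forall u v, `|u0 - u| <= r -> `|u0 - v| <= r -> `|T u - T v| <= 2^-1 * `|u - v|) ->
  exists2 u, `|u0 - u| <= r & u = T u.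
Proof.
move=> r0 TK TL; pose K := closed_ball u0 r.
have KE u : K u <-> `|u0 - u| <= r.
  by rewrite /K closed_ballE.
have TKK : {homo T : x / K x >-> K x} by move=> x /KE /TK /KE.
pose Tf : {fun K >-> K} := mkfun TKK.
have cT : is_contraction Tf.
  exists (2^-1)%:nng; split; first by rewrite /= invf_lt1// ltr1n.
  by move=> [x y] [/= /KE xK /KE yK]; exact: TL.
have [||p pK pT] := banach_fixed_point cT; first exact: closed_ball_closed.
  by exists u0; apply/KE; rewrite subrr normr0 ltW.
by exists p => //; exact/KE.
Qed.

(** If k is the increment of [chi] for an increment h of w, the remainder of [f] at chi w is o(|k|),
    and the Lipschitz bound makes it o(|h|). So [chi] is differentiable with D_v chi = v (J f)^-1
    taken at [chi], and this equation raises the order of smoothness step by step. *)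
Lemma inverse_local n (f : 'rV[R]_n -> 'rV[R]_n) (chi : 'rV[R]_n -> 'rV[R]_n)
    (U W : set 'rV[R]_n) (c : R) :
  open U -> open W -> 0 < c -> smooth_on U f ->
  (forall u, U u -> 'J f u \in unitmx) ->
  (forall w, W w -> U (chi w) /\ f (chi w) = w) ->
  (forall w w', W w -> W w' -> `|chi w - chi w'| <= c * `|w - w'|) ->
  smooth_on W chi.
Proof.
move=> Uo Wo c0 sf Jf chiP chiL.
pose N u := invmx ('J f u).
have dchi w : W w -> differentiable chi w /\
    forall v, 'D_v chi w = v *m N (chi w).
  move=> Ww; have [Uu fu] := chiP _ Ww; set u := chi w in Uu fu *.
  have df := smooth_on_differentiable sf Uu.
  have Lc : continuous (mulmxr (N u) : 'rV[R]_n -> 'rV[R]_n) by exact: continuous_mulmxr.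
  have [cN cN0 cNP] := mulmx_norm_le (N u).
  have H : forall e : R, 0 < e -> \forall h \near (0 : 'rV[R]_n),
      `|chi (h + w) - chi w - mulmxr (N u) h| <= e * `|h|.
    (* The factor [cN] is lost when the remainder is multiplied by the inverse Jacobian, the factor
       [c] when the increment of [chi] is bounded by that of w. *)
    move=> e e0; pose e' := e / (cN * c).
    have e'0 : 0 < e' by rewrite divr_gt0// mulr_gt0.
    have [d d0 dP] := near_ball (diff_remainder df e'0).
    have [d1 d10 d1P] := near_ball (open_nbhs_nbhs (conj Wo Ww)).
    (* The first radius keeps h + w in [W]; the second makes the increment of [chi] smaller than
       [d]. *)
    apply/nbhs_ballP; exists (Num.min d1 (d / c)); first by rewrite /= lt_min d10 divr_gt0.
    move=> h; rewrite /= -ball_normE/= sub0r normrN lt_min => /andP[hd1 hd].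
    have Whw : W (h + w).
      by apply: d1P; rewrite -ball_normE/= opprD addrCA subrr addr0 normrN.
    have [Uhw fhw] := chiP _ Whw; pose k := chi (h + w) - u.
    have kh : `|k| <= c * `|h|.
      by apply: le_trans (chiL _ _ Whw Ww) _; rewrite addrK.
    have kd : ball 0 d k.
      rewrite -ball_normE/= sub0r normrN; apply: le_lt_trans kh _.
      by rewrite mulrC -ltr_pdivlMr.
    have := dP _ kd; rewrite subrK fhw fu addrK -deriveE// deriveEjacobian// => hk.
    have -> : chi (h + w) - chi w - mulmxr (N u) h = - ((h - k *m 'J f u) *m N u).
      rewrite /mulmxr/= mulmxBl mulmxK ?Jf// opprB//.
    rewrite normrN; apply: le_trans (cNP _) _.
    have := le_trans hk (ler_wpM2l (ltW e'0) kh) => hk'.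
    apply: le_trans (ler_wpM2l (ltW cN0) hk') _.
    have cN1 : cN != 0 by rewrite gt_eqF.
    have c1 : c != 0 by rewrite gt_eqF.
    suff -> : cN * (e' * (c * `|h|)) = e * `|h| by [].
    by rewrite /e'; field; rewrite c1 cN1.
  have [dc Dc] := differentiable_remainder Lc H.
  by split=> // v; rewrite deriveE// Dc.
have sN : smooth_on U N.
  by apply: smooth_on_invmx => //; exact: smooth_on_jacobian.
move=> k; elim: k => [|k IH].
  by move=> w /dchi[dw _]; exact: differentiable_continuous.
split=> [w /dchi[]//|v].
have sv : smooth_on U (fun u => v *m N u).
  by apply: smooth_on_mulmx => //; exact: smooth_on_cst.
have h := Ck_on_comp Wo Uo (fun w Ww => (chiP w Ww).1) (sv k) IH.
by apply: eq_Ck_on h => // w /set_mem /dchi[_ ->].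
Qed.

(** The image of [chi] is the domain on which [f] serves as a coordinate system, which is why its
    openness is recorded. *)
Theorem inverse_function n (U : set 'rV[R]_n) (f : 'rV[R]_n -> 'rV[R]_n) u0 :
  open U -> U u0 -> smooth_on U f -> 'J f u0 \in unitmx ->
  exists (r : R) (chi : 'rV[R]_n -> 'rV[R]_n),
    [/\ 0 < r, chi (f u0) = u0, smooth_on (ball (f u0) r) chi,
      open (chi @` ball (f u0) r) &
      forall w, ball (f u0) r w ->
        [/\ U (chi w), f (chi w) = w & 'J f (chi w) \in unitmx]].
Proof.
move=> Uo Uu0 sf Ju0.
have [r r0 [rU Jr]] := inverse_function_setup Uo Uu0 sf Ju0.
set B := invmx ('J f u0) => hL.
have [c c0 cP] := mulmx_norm_le B.
pose r1 := r / 2; have r10 : 0 < r1 by rewrite divr_gt0.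
have r1r : r1 < r by rewrite ltr_pdivrMr// ltr_pMr// ltr1n.
(* With this [d] the term (f u0 - w) B stays below r1/2, and the contraction adds at most another
   r1/2: the iteration does not leave the ball of radius [r1]. *)
pose d := r1 / (4 * c); have d0 : 0 < d by rewrite divr_gt0// mulr_gt0.
have inb u : `|u0 - u| <= r1 -> ball u0 r u.
  by move=> h; rewrite -ball_normE/=; exact: le_lt_trans r1r.
(* Here u - v = (h u - h v) + (f u - f v) B, and the first term is at most half of |u - v|. This is
   injectivity of [f] and the Lipschitz bound for its inverse at once. *)
have lip u v : ball u0 r u -> ball u0 r v -> `|u - v| <= 2 * c * `|f u - f v|.
  move=> ub vb; have := hL _ _ ub vb.
  have E : u - v = (u - f u *m B - (v - f v *m B)) + (f u - f v) *m B.
    by rewrite mulmxBl; apply/rowP => i; rewrite !mxE; ring.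
  have := ler_normD (u - f u *m B - (v - f v *m B)) ((f u - f v) *m B).
  rewrite -E; have := cP (f u - f v).
  move: `|u - v| `|_ *m B| `|f u - f v| `|_ - _| => a b e g; lra.
have ex w : exists u, ball (f u0) d w -> `|u0 - u| < r1 /\ f u = w.
  (* Outside the ball [u0] is a dummy witness, so that [choice] applies to all w. *)
  have [wb|wb] := pselect (ball (f u0) d w); last by exists u0.
  pose T u := u - f u *m B + w *m B.
  have wd : `|(f u0 - w) *m B| < r1 / 2.
    apply: le_lt_trans (cP _) _; move: wb; rewrite -ball_normE/= => wb.
    apply: lt_trans (_ : c * d < _); first by rewrite ltr_pM2l.
    have -> : c * d = r1 / 4 by rewrite /d; field; rewrite gt_eqF.
    by move: r10; lra.
  have TE u : u0 - T u = (u0 - f u0 *m B - (u - f u *m B)) + (f u0 - w) *m B.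
    by rewrite /T mulmxBl; apply/rowP => i; rewrite !mxE; ring.
  have Tr1 u : `|u0 - u| <= r1 -> `|u0 - T u| < r1.
    move=> ur; rewrite TE; apply: le_lt_trans (ler_normD _ _) _.
    have := hL _ _ (ballxx u0 r0) (inb _ ur).
    move: wd ur; move: `|_ *m B| `|u0 - u| `|_ - _| => a b g; lra.
  have [|u v ur vr|u ur uT] := @half_contraction_fixed_point _ T u0 r1 r10.
    by move=> u /Tr1 /ltW.
  - have -> : T u - T v = u - f u *m B - (v - f v *m B).
      by rewrite /T opprD addrACA subrr addr0.
    by apply: hL; exact: inb.
  exists u => _; split; first by rewrite [X in _ - X]uT; exact: Tr1.
  have : (w - f u) *m B = 0.
    rewrite mulmxBl; apply/eqP; rewrite subr_eq0; apply/eqP.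
    by move: uT; rewrite /T -addrA -[LHS]addr0 => /addrI /esym /eqP;
      rewrite addrC subr_eq0 => /eqP.
  move=> /(congr1 (mulmx^~ ('J f u0))); rewrite mulmxKV// mul0mx => /eqP.
  by rewrite subr_eq0 => /eqP.
have [chi chiP] := choice ex.
have chib w : ball (f u0) d w -> ball u0 r (chi w).
  by move=> /chiP[h _]; apply: inb; exact: ltW.
have chi0 : chi (f u0) = u0.
  have [h e] := chiP _ (ballxx (f u0) d0).
  apply/eqP; rewrite -subr_eq0 -normr_le0.
  apply: le_trans (lip _ _ (chib _ (ballxx _ d0)) (ballxx _ r0)) _.
  by rewrite e subrr normr0 mulr0.
exists d, chi; split; [exact: d0|exact: chi0| | |].
- apply: (@inverse_local n f chi (ball u0 r) (ball (f u0) d) (2 * c)).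
  + exact: ball_open.
  + exact: ball_open.
  + by rewrite mulr_gt0.
  + exact: sub_smooth_on sf.
  + exact: Jr.
  + by move=> w wb; split; [exact: chib|have [] := chiP _ wb].
  + move=> w w' wb wb'; apply: le_trans (lip _ _ (chib _ wb) (chib _ wb')) _.
    by have [_ ->] := chiP _ wb; have [_ ->] := chiP _ wb'.
(* For u close to chi w, both u and f u lie in the balls where [lip] applies, and [lip] forces chi
   (f u) = u; so u is in the image. *)
- rewrite openE => _ [w wb <-]; rewrite /interior.
  have [wr fw] := chiP _ wb.
  have cf : {for chi w, continuous f}.
    by apply: smooth_on_continuous sf _; exact/rU/chib.
  have n1 : \forall u \near chi w, ball u0 r1 u.
    apply: open_nbhs_nbhs; split; first exact: ball_open.
    by rewrite -ball_normE.
  have n2 : \forall u \near chi w, ball (f u0) d (f u).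
    apply: cf; apply: open_nbhs_nbhs; split; first exact: ball_open.
    by rewrite fw.
  apply: filterS (filterI n1 n2) => u [ur fud].
  exists (f u); first exact: fud.
  have [h e] := chiP _ fud.
  apply/eqP; rewrite -subr_eq0 -normr_le0.
  have ub : ball u0 r u by apply: le_ball ur; exact: ltW.
  apply: le_trans (lip _ _ (chib _ fud) ub) _.
  by rewrite e subrr normr0 mulr0.
- move=> w wb; have [h e] := chiP _ wb.
  by split; [exact/rU/chib|exact: e|exact/Jr/chib].
Qed.

End InverseFunctionTheorem.

(** * Oriented inner products on the plane *)

Section Plane.
Context {R : realType}.
Implicit Types (A : 'M[R]_2) (u v a b : 'rV[R]_2) (k : R).

Lemma sum2 (V : nmodType) (F : 'I_2 -> V) : \sum_i F i = F 0 + F 1.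
Proof. by rewrite big_ord_recl big_ord1; congr (_ + F _); exact/val_inj. Qed.

Lemma ord2P (P : 'I_2 -> Prop) : P 0 -> P 1 -> forall i, P i.
Proof.
move=> P0 P1 [[|[|//]] i].
  by rewrite (_ : Ordinal i = 0)//; exact/val_inj.
by rewrite (_ : Ordinal i = 1)//; exact/val_inj.
Qed.

Lemma rowP2 u v : u 0 0 = v 0 0 -> u 0 1 = v 0 1 -> u = v.
Proof. by move=> h0 h1; apply/rowP; exact: ord2P. Qed.

Lemma det2 A : \det A = A 0 0 * A 1 1 - A 0 1 * A 1 0.
Proof.
rewrite (expand_det_row _ 0) sum2 /cofactor !det_mx11 !mxE /= expr0 expr1 mul1r.
have -> : lift (0 : 'I_2) 0 = 1 by exact/val_inj.
have -> : lift (1 : 'I_2) 0 = 0 by exact/val_inj.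
by rewrite mulN1r mulrN.
Qed.

Lemma sym10 A : A^T = A -> A 1 0 = A 0 1.
Proof. by move=> As; rewrite -[in LHS]As mxE. Qed.

Definition wedge a b : R := a 0 0 * b 0 1 - a 0 1 * b 0 0.

(** The area form of the inner product [A]. By [inner_jrot] it is A(ja, b); unlike [jrot] it
    involves no division. *)
Definition area A a b : R := Num.sqrt (\det A) * wedge a b.

Lemma areaC A a b : area A b a = - area A a b.
Proof. by rewrite /area /wedge; ring. Qed.

Lemma areaD A a a' b : area A (a + a') b = area A a b + area A a' b.
Proof. by rewrite /area /wedge !mxE; ring. Qed.

Lemma areaZ A k a b : area A (k *: a) b = k * area A a b.
Proof. by rewrite /area /wedge !mxE; ring. Qed.

Lemma areaDr A a b b' : area A a (b + b') = area A a b + area A a b'.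
Proof. by rewrite /area /wedge !mxE; ring. Qed.

Lemma areaZr A k a b : area A a (k *: b) = k * area A a b.
Proof. by rewrite /area /wedge !mxE; ring. Qed.

Lemma area0 A b : area A 0 b = 0.
Proof. by rewrite /area /wedge !mxE; ring. Qed.

Lemma area0r A b : area A b 0 = 0.
Proof. by rewrite /area /wedge !mxE; ring. Qed.

Lemma inner2 A a b : inner A a b = (a 0 0 * A 0 0 + a 0 1 * A 1 0) * b 0 0 +
  (a 0 0 * A 0 1 + a 0 1 * A 1 1) * b 0 1.
Proof. by rewrite /inner !(mxE, sum2). Qed.

Lemma innerC A a b : A^T = A -> inner A a b = inner A b a.
Proof. by move=> /sym10 A10; rewrite !inner2 A10; ring. Qed.

Lemma innerD A a a' b : inner A (a + a') b = inner A a b + inner A a' b.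
Proof. by rewrite !inner2 !mxE; ring. Qed.

Lemma innerZ A k a b : inner A (k *: a) b = k * inner A a b.
Proof. by rewrite !inner2 !mxE; ring. Qed.

Lemma innerN A a b : inner A (- a) b = - inner A a b.
Proof. by rewrite !inner2 !mxE; ring. Qed.

Lemma innerDr A a b b' : inner A a (b + b') = inner A a b + inner A a b'.
Proof. by rewrite !inner2 !mxE; ring. Qed.

Lemma innerZr A k a b : inner A a (k *: b) = k * inner A a b.
Proof. by rewrite !inner2 !mxE; ring. Qed.

Lemma jrotZ A k a : jrot A (k *: a) = k *: jrot A a.
Proof. by apply: rowP2; rewrite /jrot !(mxE, sum2)/=; ring. Qed.

Lemma jrot0 A : jrot A 0 = 0.
Proof. by rewrite -[0 in LHS](scale0r 0) jrotZ scale0r. Qed.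

Lemma posdef_det A : A^T = A -> (forall v, v != 0 -> 0 < inner A v v) ->
  0 < \det A.
Proof.
move=> /sym10 A10 Ap; rewrite det2 A10.
have rv (x y : R) : (\row_k (if k == 0 then x else y) : 'rV[R]_2) 0 0 = x /\
    (\row_k (if k == 0 then x else y) : 'rV[R]_2) 0 1 = y by rewrite !mxE.
have A00 : 0 < A 0 0.
  have [r0 r1] := rv 1 0.
  have := Ap (\row_k (if k == 0 then 1 else 0)).
  rewrite inner2 r0 r1 A10 => h;
    have {h} : 0 < (1 * A 0 0 + 0 * A 0 1) * 1 +
      (1 * A 0 1 + 0 * A 1 1) * 0.
    by apply: h; apply: contra_eqN r0 => /eqP ->; rewrite mxE eq_sym oner_eq0.
  by move: (A 0 0) (A 0 1) => p q; lra.
(* This vector is A-orthogonal to e_0, and its square norm is A_00 det A. *)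
have [r0 r1] := rv (- A 0 1) (A 0 0).
have := Ap (\row_k (if k == 0 then - A 0 1 else A 0 0)).
rewrite inner2 r0 r1 A10 => h.
have {h} : 0 < (- A 0 1 * A 0 0 + A 0 0 * A 0 1) * - A 0 1 +
    (- A 0 1 * A 0 1 + A 0 0 * A 1 1) * A 0 0.
  by apply: h; apply: contra_eqN r1 => /eqP ->; rewrite mxE lt_eqF.
suff <- : A 0 0 * (A 0 0 * A 1 1 - A 0 1 * A 0 1) =
    (- A 0 1 * A 0 0 + A 0 0 * A 0 1) * - A 0 1 +
    (- A 0 1 * A 0 1 + A 0 0 * A 1 1) * A 0 0 by rewrite pmulr_rgt0.
by ring.
Qed.

Section Frame.
Variable A : 'M[R]_2.
Hypotheses (As : A^T = A) (A0 : 0 < \det A).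

Let A10 : A 1 0 = A 0 1. Proof. exact: sym10. Qed.

Let r := Num.sqrt (\det A).

Let r0 : r != 0. Proof. by rewrite gt_eqF// sqrtr_gt0. Qed.

Let rr : r * r = A 0 0 * A 1 1 - A 0 1 * A 0 1.
Proof. by rewrite -expr2 sqr_sqrtr ?ltW// det2 A10. Qed.

Lemma inner_jrot a b : inner A (jrot A a) b = area A a b.
Proof.
rewrite inner2 /jrot /area /wedge !(mxE, sum2)/= -/r A10.
apply: (mulfI r0); rewrite [RHS]mulrA rr.
transitivity (r * r^-1 * ((A 0 0 * A 1 1 - A 0 1 * A 0 1) *
  (a 0 0 * b 0 1 - a 0 1 * b 0 0))); first by ring.
by rewrite mulfV// mul1r.
Qed.

Lemma jrotK v : jrot A (jrot A v) = - v.
Proof.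
have E k : k = r^-1 * (r^-1 * ((A 0 0 * A 1 1 - A 0 1 * A 0 1) * k)).
  by rewrite -rr -!mulrA !mulKf.
by apply: rowP2; rewrite /jrot !(mxE, sum2)/= -/r A10 [RHS]E; ring.
Qed.

Lemma inner_jrotr a b : inner A a (jrot A b) = - area A a b.
Proof. by rewrite innerC// inner_jrot areaC. Qed.

Lemma area_jrot a : area A (jrot A a) a = - inner A a a.
Proof. by rewrite -inner_jrot jrotK innerN. Qed.

Lemma frame_decomp T v : inner A T T = 1 ->
  v = inner A v T *: T + inner A v (jrot A T) *: jrot A T.
Proof.
move=> T1.
(* Multiplication by |T|^2 = 1 makes the claim homogeneous; once the root of the determinant is
   cancelled, it is a polynomial identity. *)
have E k : k = inner A T T * k by rewrite T1 mul1r.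
rewrite inner_jrotr; apply: rowP2; rewrite /jrot !(mxE, sum2)/= -/r ?A10 /area -/r.
  rewrite [LHS]E !inner2 A10.
  rewrite (_ : - (r * _) * _ =
    r * r^-1 * (wedge v T * (T 0 0 * A 0 1 + T 0 1 * A 1 1))); last by ring.
  by rewrite mulfV// mul1r /wedge; ring.
rewrite [LHS]E !inner2 A10.
rewrite (_ : - (r * _) * _ =
  r * r^-1 * (- wedge v T * (T 0 0 * A 0 0 + T 0 1 * A 0 1))); last by ring.
by rewrite mulfV// mul1r /wedge; ring.
Qed.

Lemma area_nondeg a b : (forall c, area A a c = area A b c) -> a = b.
Proof.
move=> ab.
pose e (i : 'I_2) : 'rV[R]_2 := delta_mx 0 i.
have := ab (e 0); have := ab (e 1); rewrite /area /wedge !mxE/= => /(mulfI r0) h1 /(mulfI r0) h0.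
move: h1 h0; rewrite !mulr1 !mulr0 !sub0r !subr0 => h1 /oppr_inj h0.
exact: rowP2.
Qed.

Lemma inner_nondeg a b : (forall c, inner A a c = inner A b c) -> a = b.
Proof.
move=> ab; have h : jrot A a = jrot A b.
  by apply: area_nondeg => c; rewrite -!inner_jrot !jrotK !innerN ab.
by have := congr1 (jrot A) h; rewrite !jrotK => /oppr_inj.
Qed.

End Frame.

(** Positivity of det M gives sqrt(det A) = det M sqrt(det B) without an absolute value; an
    orientation reversing M would change the sign of the rotation. *)
Lemma jrot_change (A B M : 'M[R]_2) v : 0 < \det M -> 0 < \det B ->
  B^T = B -> A = M *m B *m M^T -> jrot A v *m M = jrot B (v *m M).
Proof.
move=> M0 B0 Bs AE; have B10 := sym10 Bs.
have dA : Num.sqrt (\det A) = \det M * Num.sqrt (\det B).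
  rewrite AE !det_mulmx det_tr mulrAC -expr2 sqrtrM ?sqr_ge0//.
  by rewrite sqrtr_sqr gtr0_norm.
have m0 : \det M != 0 by rewrite gt_eqF.
have b0 : Num.sqrt (\det B) != 0 by rewrite gt_eqF// sqrtr_gt0.
have wE : v *m A = (v *m M *m B) *m M^T by rewrite AE !mulmxA.
rewrite /jrot dA wE; set q := v *m M *m B.
have E (x : R) : x = (\det M)^-1 * (\det M * x) by rewrite mulKf.
apply: rowP2; rewrite !(mxE, sum2)/= invfM [RHS]E.
  by rewrite [in X in _ = _ * (X * _)]det2; ring.
by rewrite [in X in _ = _ * (X * _)]det2; ring.
Qed.

End Plane.

(** * Levi-Civita calculus *)

Section Koszul.
Context {R : realType} {n : nat}.
Variable G : 'rV[R]_n -> 'M[R]_n.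

Lemma innerE (A : 'M[R]_n) (u v : 'rV[R]_n) :
  inner A u v = \sum_j \sum_l u 0 j * v 0 l * A j l.
Proof.
rewrite /inner mxE exchange_big/=; apply: eq_bigr => l _.
by rewrite !mxE mulr_suml; apply: eq_bigr => j _; rewrite mulrAC.
Qed.

Lemma differentiable_inner (x b c : 'rV[R]_n) : differentiable G x ->
  differentiable (fun y => inner (G y) b c) x.
Proof.
move=> dG; rewrite (_ : (fun _ => _) =
    \sum_j \sum_l ((b 0 j * c 0 l) \*: (fun y => G y j l))).
  do 2![apply: differentiable_sum => ?]; apply: differentiableZ.
  exact: (differentiable_mxP _ _).1.
apply/funext => y; rewrite innerE fct_sumE; apply: eq_bigr => j _.
by rewrite fct_sumE.
Qed.

Lemma derive_inner (x v b c : 'rV[R]_n) : differentiable G x ->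
  'D_v (fun y => inner (G y) b c) x =
  \sum_i \sum_j \sum_l v 0 i * b 0 j * c 0 l * pd i (fun y => G y j l) x.
Proof.
move=> dG; have dGe j l := (differentiable_mxP _ _).1 dG j l.
rewrite derive_sum_delta; last exact: differentiable_inner.
apply: eq_bigr => i _; rewrite /GRing.scale/=.
transitivity (v 0 i * \sum_j \sum_l b 0 j * c 0 l * pd i (fun y => G y j l) x).
  congr (_ * _); rewrite (_ : (fun _ => _) =
    \sum_j \sum_l ((b 0 j * c 0 l) \*: (fun y => G y j l))); last first.
    apply/funext => y; rewrite innerE fct_sumE; apply: eq_bigr => j _.
    by rewrite fct_sumE.
  rewrite derive_sum => [|j]; last first.
    by apply: derivable_sum => l; apply: derivableZ; exact: diff_derivable.
  apply: eq_bigr => j _; rewrite derive_sum => [|l]; last first.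
    by apply: derivableZ; exact: diff_derivable.
  by apply: eq_bigr => l _; rewrite deriveZ//; exact: diff_derivable.
rewrite mulr_sumr; apply: eq_bigr => j _; rewrite mulr_sumr.
by apply: eq_bigr => l _; rewrite !mulrA.
Qed.

Lemma inner_inj (A : 'M[R]_n) (u v : 'rV[R]_n) : A \in unitmx ->
  (forall w, inner A u w = inner A v w) -> u = v.
Proof.
move=> Au uv; apply: (can_inj (mulmxK Au)); apply/rowP => i.
have := uv (delta_mx 0 i); rewrite /inner !trmx_delta.
by rewrite -!colE ![col _ _ _ _]mxE.
Qed.

(** The Koszul formula for constant fields, whose brackets vanish. *)
Lemma koszul (x u v w : 'rV[R]_n) : differentiable G x ->
  (G x)^T = G x -> G x \in unitmx ->
  2 * inner (G x) (christoffel_form G x u v) w =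
  'D_u (fun y => inner (G y) v w) x + 'D_v (fun y => inner (G y) u w) x
  - 'D_w (fun y => inner (G y) u v) x.
Proof.
move=> dG Gs Gu.
pose T i j l := pd i (fun y => G y j l) x.
(* Twice the Christoffel form with its upper index lowered. *)
pose S : 'rV[R]_n := \row_l \sum_i \sum_j u 0 i * v 0 j * (T i j l + T j i l - T l i j).
have -> : christoffel_form G x u v = 2^-1 *: (S *m invmx (G x)).
  apply/rowP => k; rewrite !mxE.
  have sI l : invmx (G x) l k = invmx (G x) k l by rewrite -{1}Gs -trmx_inv mxE.
  under [in RHS]eq_bigr do rewrite mxE sI mulr_suml.
  rewrite [in RHS]exchange_big/= mulr_sumr; apply: eq_bigr => i _.
  under [in RHS]eq_bigr do rewrite mulr_suml.
  rewrite [in RHS]exchange_big/= mulr_sumr; apply: eq_bigr => j _.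
  rewrite /christoffel -!mulrA; congr (_ * _); rewrite mulr_suml.
  apply: eq_bigr => l _; rewrite /T; ring.
rewrite /inner -scalemxAl mulmxKV// -scalemxAl mxE mulrA divff ?mul1r ?pnatr_eq0//.
rewrite !derive_inner// mxE.
rewrite [X in _ + X - _]exchange_big/= -big_split/=.
rewrite [X in _ - X]exchange_big/=.
under [X in _ - X]eq_bigr do rewrite exchange_big/=.
rewrite -sumrB; under eq_bigr do rewrite !mxE mulr_suml.
rewrite exchange_big/=; apply: eq_bigr => i _.
under eq_bigr do rewrite mulr_suml.
rewrite exchange_big/= -big_split/= -sumrB; apply: eq_bigr => j _.
rewrite -big_split/= -sumrB; apply: eq_bigr => l _.
by rewrite /T; ring.
Qed.

(** The means of finding the Christoffel forms of [GG] and of flat metrics without inverting the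
    metric. *)
Lemma koszul_unique (x u v C : 'rV[R]_n) : differentiable G x ->
  (G x)^T = G x -> G x \in unitmx ->
  (forall w, 2 * inner (G x) C w =
    'D_u (fun y => inner (G y) v w) x + 'D_v (fun y => inner (G y) u w) x
    - 'D_w (fun y => inner (G y) u v) x) ->
  christoffel_form G x u v = C.
Proof.
move=> dG Gs Gu CP; apply: (inner_inj Gu) => w.
have two : (2 : R) != 0 by rewrite pnatr_eq0.
by apply: (mulfI two); rewrite koszul// CP.
Qed.

Variable D : set 'rV[R]_n.
Hypotheses (Do : open D) (dG : forall x, D x -> differentiable G x)
  (Gs : forall x, D x -> (G x)^T = G x) (Gu : forall x, D x -> G x \in unitmx).

Lemma inner_sym (A : 'M[R]_n) u v : A^T = A -> inner A u v = inner A v u.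
Proof.
move=> As; rewrite /inner.
have -> : u *m A *m v^T = (v *m A *m u^T)^T by rewrite !trmx_mul trmxK As mulmxA.
by rewrite [LHS]mxE.
Qed.

Lemma derive_inner_sym x u b c : D x ->
  'D_u (fun y => inner (G y) b c) x = 'D_u (fun y => inner (G y) c b) x.
Proof.
move=> Dx; apply: near_eq_derive; near=> y; apply: inner_sym; apply: Gs.
by near: y; exact: open_nbhs_nbhs.
Unshelve. all: by end_near. Qed.

Lemma christoffel_form_sym x u v : D x ->
  christoffel_form G x u v = christoffel_form G x v u.
Proof.
move=> Dx; apply: koszul_unique; [exact: dG|exact: Gs|exact: Gu|move=> w].
rewrite koszul; [|exact: dG|exact: Gs|exact: Gu].
by rewrite (derive_inner_sym _ v u)// [X in X - _]addrC.
Qed.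

(** The Koszul formulas for Gamma(v, b) against c and for Gamma(v, c) against b are added; all terms
    cancel except twice D_v G(b, c). *)
Lemma metric_compatible x v b c : D x ->
  'D_v (fun y => inner (G y) b c) x =
  inner (G x) (christoffel_form G x v b) c + inner (G x) b (christoffel_form G x v c).
Proof.
move=> Dx; have two : (2 : R) != 0 by rewrite pnatr_eq0.
apply: (mulfI two); rewrite (inner_sym b)//; last exact: Gs.
rewrite [RHS]mulrDr !koszul; try solve [exact: dG|exact: Gs|exact: Gu].
rewrite (derive_inner_sym v c b)//.
move: ('D_v _ x) ('D_b _ x) ('D_c _ x) => p q r; ring.
Qed.

End Koszul.

(** * Product rules for sums, multiples and inner products *)

Section DeriveFun.
Context {R : realType} {V : normedModType R}.
Implicit Types (f g : V -> R) (x v : V).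

Lemma derive_addE (W : normedModType R) (f g : V -> W) x v :
  differentiable f x -> differentiable g x ->
  'D_v (fun y => f y + g y) x = 'D_v f x + 'D_v g x.
Proof. by move=> df dg; apply: (@deriveD _ _ _ f g); exact: diff_derivable. Qed.

Lemma derive_subE (W : normedModType R) (f g : V -> W) x v :
  differentiable f x -> differentiable g x ->
  'D_v (fun y => f y - g y) x = 'D_v f x - 'D_v g x.
Proof. by move=> df dg; apply: (@deriveB _ _ _ f g); exact: diff_derivable. Qed.

Lemma derive_mulE f g x v :
  differentiable f x -> differentiable g x ->
  'D_v (fun y => f y * g y) x = f x * 'D_v g x + g x * 'D_v f x.
Proof. by move=> df dg; apply: (@deriveM _ _ f g); exact: diff_derivable. Qed.

Lemma differentiable_mulE f g x : differentiable f x -> differentiable g x ->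
  differentiable (fun y => f y * g y) x.
Proof. by move=> df dg; exact: (differentiableM df dg). Qed.

Lemma differentiable_addE (W : normedModType R) (f g : V -> W) x :
  differentiable f x -> differentiable g x ->
  differentiable (fun y => f y + g y) x.
Proof. by move=> df dg; exact: (differentiableD df dg). Qed.

Lemma differentiable_subE (W : normedModType R) (f g : V -> W) x :
  differentiable f x -> differentiable g x ->
  differentiable (fun y => f y - g y) x.
Proof. by move=> df dg; exact: (differentiableB df dg). Qed.

Lemma derive_sumE (W : normedModType R) n (F : 'I_n -> V -> W) x v :
  (forall i, differentiable (F i) x) ->
  'D_v (fun y => \sum_i F i y) x = \sum_i 'D_v (F i) x.
Proof.
move=> dF; rewrite (_ : (fun _ => _) = \sum_i F i).
  by rewrite derive_sum// => i; exact: diff_derivable.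
by apply/funext => y; rewrite fct_sumE.
Qed.

Lemma differentiable_sumE (W : normedModType R) n (F : 'I_n -> V -> W) x :
  (forall i, differentiable (F i) x) ->
  differentiable (fun y => \sum_i F i y) x.
Proof.
move=> dF; rewrite (_ : (fun _ => _) = \sum_i F i); first exact: differentiable_sum.
by apply/funext => y; rewrite fct_sumE.
Qed.

Lemma derive_scaleE n (k : V -> R) (F : V -> 'rV[R]_n) x v :
  differentiable k x -> differentiable F x ->
  differentiable (fun y => k y *: F y) x /\
  'D_v (fun y => k y *: F y) x = 'D_v k x *: F x + k x *: 'D_v F x.
Proof.
move=> dk dF; have dFi i := (differentiable_rVP F x).1 dF i.
have dkF : differentiable (fun y => k y *: F y) x.
  apply/differentiable_rVP => i.
  rewrite (_ : (fun _ => _) = fun y => k y * F y 0 i).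
    exact: differentiable_mulE.
  by apply/funext => y; rewrite mxE.
split=> //; apply/rowP => i; rewrite (derive_rVE _ _ dkF).
rewrite (_ : (fun _ => _) = fun y => k y * F y 0 i); last first.
  by apply/funext => y; rewrite mxE.
rewrite (derive_mulE v dk (dFi i)) !mxE (derive_rVE _ _ dF).
by move: ('D_v _ x) ('D_v _ x) => a b; ring.
Qed.

(** The first term of the derivative freezes both vectors, which is the form that [metric_parallel]
    and [area_parallel] can evaluate. *)
Lemma derive_innerE n (M : V -> 'M[R]_n) (X Y : V -> 'rV[R]_n) x v :
  differentiable M x -> differentiable X x -> differentiable Y x ->
  differentiable (fun y => inner (M y) (X y) (Y y)) x /\
  'D_v (fun y => inner (M y) (X y) (Y y)) x =
  'D_v (fun y => inner (M y) (X x) (Y x)) x + inner (M x) ('D_v X x) (Y x) +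
  inner (M x) (X x) ('D_v Y x).
Proof.
move=> dM dX dY.
have dm j l := (differentiable_mxP _ _).1 dM j l.
have dXi j := (differentiable_rVP _ _).1 dX j.
have dYi j := (differentiable_rVP _ _).1 dY j.
have E (Z T : V -> 'rV[R]_n) : (fun y => inner (M y) (Z y) (T y)) =
    fun y => \sum_j \sum_l (Z y 0 j * T y 0 l) * M y j l.
  by apply/funext => y; rewrite innerE.
have dZT (Z T : V -> 'rV[R]_n) j l : differentiable Z x -> differentiable T x ->
    differentiable (fun y => Z y 0 j * T y 0 l) x.
  by move=> dZ dT; apply: differentiable_mulE; exact: (differentiable_rVP _ _).1.
have dE (Z T : V -> 'rV[R]_n) j l : differentiable Z x -> differentiable T x ->
    differentiable (fun y => (Z y 0 j * T y 0 l) * M y j l) x.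
  by move=> dZ dT; apply: differentiable_mulE; [exact: dZT|exact: dm].
have DE (Z T : V -> 'rV[R]_n) : differentiable Z x -> differentiable T x ->
  'D_v (fun y => inner (M y) (Z y) (T y)) x =
  \sum_j \sum_l 'D_v (fun y => (Z y 0 j * T y 0 l) * M y j l) x.
  move=> dZ dT; rewrite E derive_sumE; last first.
    by move=> j; apply: differentiable_sumE => l; exact: dE.
  by apply: eq_bigr => j _; rewrite derive_sumE// => l; exact: dE.
split.
  rewrite E; apply: differentiable_sumE => j; apply: differentiable_sumE => l.
  exact: dE.
rewrite (DE _ _ dX dY).
rewrite (DE (fun=> X x) (fun=> Y x)); [|exact: differentiable_cst..].
rewrite !innerE -!big_split/=; apply: eq_bigr => j _.
rewrite -!big_split/=; apply: eq_bigr => l _.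
have dc (c : R) : differentiable (fun=> c : R) x by exact: differentiable_cst.
have Dc (c : R) : 'D_v (fun=> c : R) x = 0 by exact: derive_cst.
rewrite derive_mulE; [|exact: dZT|exact: dm].
rewrite (derive_mulE v (dXi j) (dYi l)).
rewrite (derive_mulE v (dc (X x 0 j * Y x 0 l)) (dm j l)) Dc.
rewrite (derive_rVE _ _ dX) (derive_rVE _ _ dY).
by move: ('D_v _ x) ('D_v _ x) ('D_v _ x) => a b c; ring.
Qed.

End DeriveFun.

(** * Bilinearity and smoothness of the Christoffel form *)

Section ChristoffelForm.
Context {R : realType} {n : nat} (g : 'rV[R]_n -> 'M[R]_n).
Implicit Types x u v : 'rV[R]_n.

Lemma christoffel_formD x u u' v : christoffel_form g x (u + u') v =
  christoffel_form g x u v + christoffel_form g x u' v.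
Proof.
apply/rowP => k; rewrite !mxE -big_split/=; apply: eq_bigr => i _.
by rewrite -big_split/=; apply: eq_bigr => j _; rewrite mxE; ring.
Qed.

Lemma christoffel_formZ x k u v :
  christoffel_form g x (k *: u) v = k *: christoffel_form g x u v.
Proof.
apply/rowP => l; rewrite !mxE mulr_sumr; apply: eq_bigr => i _.
by rewrite mulr_sumr; apply: eq_bigr => j _; rewrite mxE; ring.
Qed.

Lemma christoffel_formDr x u v v' : christoffel_form g x u (v + v') =
  christoffel_form g x u v + christoffel_form g x u v'.
Proof.
apply/rowP => k; rewrite !mxE -big_split/=; apply: eq_bigr => i _.
by rewrite -big_split/=; apply: eq_bigr => j _; rewrite mxE; ring.
Qed.

Lemma christoffel_formZr x k u v :
  christoffel_form g x u (k *: v) = k *: christoffel_form g x u v.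
Proof.
apply/rowP => l; rewrite !mxE mulr_sumr; apply: eq_bigr => i _.
by rewrite mulr_sumr; apply: eq_bigr => j _; rewrite mxE; ring.
Qed.

Lemma christoffel_form0 x v : christoffel_form g x 0 v = 0.
Proof. by rewrite -[0 in LHS](scale0r 0) christoffel_formZ scale0r. Qed.

Lemma christoffel_form0r x v : christoffel_form g x v 0 = 0.
Proof. by rewrite -[0 in LHS](scale0r 0) christoffel_formZr scale0r. Qed.

Lemma smooth_on_christoffel (D : set 'rV[R]_n) k i j : open D ->
  smooth_on D g -> (forall x, D x -> g x \in unitmx) ->
  smooth_on D (fun x => christoffel g x k i j).
Proof.
move=> Do sg gu; apply: smooth_onZ => //; apply: smooth_on_sum => // l.
have sgi := (smooth_on_mxP _ Do).1 sg.
apply: smooth_onM => //.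
  exact: ((smooth_on_mxP _ Do).1 (smooth_on_invmx Do gu sg)).
apply: smooth_onB => //; first apply: smooth_onD => //; exact: smooth_on_derive.
Qed.

Lemma smooth_on_christoffel_form (V : normedModType R) (U : set V)
    (D : set 'rV[R]_n) (x u v : V -> 'rV[R]_n) : open U -> open D ->
  (forall e, U e -> D (x e)) ->
  smooth_on D g -> (forall x, D x -> g x \in unitmx) ->
  smooth_on U x -> smooth_on U u -> smooth_on U v ->
  smooth_on U (fun e => christoffel_form g (x e) (u e) (v e)).
Proof.
move=> Uo Do UD sg gu sx su sv; apply/smooth_on_rVP => // k.
apply: (@eq_smooth_on _ _ _ _ (fun e => \sum_i \sum_j
    christoffel g (x e) k i j * u e 0 i * v e 0 j)) => //.
  by move=> e _; rewrite mxE.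
apply: smooth_on_sum => // i; apply: smooth_on_sum => // j.
apply: smooth_onM => //; last exact: (smooth_on_rVP _ Uo).1.
apply: smooth_onM => //; last exact: (smooth_on_rVP _ Uo).1.
apply: (smooth_on_comp_scalar (f := fun y => christoffel g y k i j) Uo UD _ sx).
exact: smooth_on_christoffel.
Qed.

Lemma smooth_on_inner (V : normedModType R) (U : set V)
    (M : V -> 'M[R]_n) (u v : V -> 'rV[R]_n) : open U ->
  smooth_on U M -> smooth_on U u -> smooth_on U v ->
  smooth_on U (fun e => inner (M e) (u e) (v e)).
Proof.
move=> Uo sM su sv.
apply: (@eq_smooth_on _ _ _ _ (fun e => \sum_j \sum_l
    u e 0 j * v e 0 l * M e j l)) => //.
  by move=> e _; rewrite innerE.
do 2![apply: smooth_on_sum => // ?].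
apply: smooth_onM => //; last exact: (smooth_on_mxP _ Uo).1.
by apply: smooth_onM => //; exact: (smooth_on_rVP _ Uo).1.
Qed.

End ChristoffelForm.

(** * Smoothness of the area form and of the rotation *)

Section AreaSmooth.
Context {R : realType}.

(* The area form as a bilinear form with a matrix, so that the calculus of
   [inner] applies to it. *)
Definition area_mx (A : 'M[R]_2) : 'M[R]_2 :=
  \matrix_(i, j) (Num.sqrt (\det A) * wedge (delta_mx 0 i) (delta_mx 0 j)).

Lemma inner_area_mx (A : 'M[R]_2) a b : inner (area_mx A) a b = area A a b.
Proof. by rewrite inner2 /area_mx /area /wedge !mxE/=; ring. Qed.

Lemma smooth_on_sqrt_det (V : normedModType R) (U : set V) (M : V -> 'M[R]_2) :
  open U -> (forall e, U e -> 0 < \det (M e)) -> smooth_on U M ->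
  smooth_on U (fun e => Num.sqrt (\det (M e))).
Proof. by move=> Uo M0 sM; apply: smooth_on_sqrt => //; exact: smooth_on_det. Qed.

Lemma smooth_on_area_mx (V : normedModType R) (U : set V) (M : V -> 'M[R]_2) :
  open U -> (forall e, U e -> 0 < \det (M e)) -> smooth_on U M ->
  smooth_on U (fun e => area_mx (M e)).
Proof.
move=> Uo M0 sM; apply/smooth_on_mxP => // i j.
apply: (@eq_smooth_on _ _ _ _ (fun e => Num.sqrt (\det (M e)) *
  wedge (delta_mx 0 i) (delta_mx 0 j))) => //; first by move=> e _; rewrite mxE.
by apply: smooth_onM => //; [exact: smooth_on_sqrt_det|exact: smooth_on_cst].
Qed.

Lemma smooth_on_jrot (V : normedModType R) (U : set V) (M : V -> 'M[R]_2)
    (u : V -> 'rV[R]_2) :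
  open U -> (forall e, U e -> 0 < \det (M e)) -> smooth_on U M ->
  smooth_on U u -> smooth_on U (fun e => jrot (M e) (u e)).
Proof.
move=> Uo M0 sM su.
have sw := (smooth_on_rVP _ Uo).1 (smooth_on_mulmx Uo su sM).
have si : smooth_on U (fun e => (Num.sqrt (\det (M e)))^-1).
  apply: smooth_onV => //; last exact: smooth_on_sqrt_det.
  by move=> e Ue; rewrite gt_eqF// sqrtr_gt0 M0.
apply/smooth_on_rVP => //; apply: ord2P.
  apply: eq_smooth_on (smooth_onM Uo si (smooth_onN Uo (sw 1))) => // e _.
  by rewrite /jrot !mxE.
apply: eq_smooth_on (smooth_onM Uo si (sw 0)) => // e _.
by rewrite /jrot !mxE.
Qed.

End AreaSmooth.

(** * Parallelism of metric, area form and rotation; covariant derivative along a curve *)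

Definition covariant_derivative (R : realType) (n : nat)
    (g : 'rV[R]_n -> 'M[R]_n) (gamma V : R -> 'rV[R]_n) (s : R) : 'rV[R]_n :=
  'D_1 V s + christoffel_form g (gamma s) ('D_1 gamma s) (V s).

Section RiemannianPlane.
Context {R : realType}.
Variables (g : 'rV[R]_2 -> 'M[R]_2) (D : set 'rV[R]_2).
Hypotheses (Do : open D) (sg : smooth_on D g)
  (gs : forall x, D x -> (g x)^T = g x)
  (gp : forall x v, D x -> v != 0 -> 0 < inner (g x) v v).

Lemma metric_det x : D x -> 0 < \det (g x).
Proof. by move=> Dx; apply: posdef_det; [exact: gs|move=> v; exact: gp]. Qed.

Lemma metric_unit x : D x -> g x \in unitmx.
Proof. by move=> Dx; rewrite unitmxE unitfE gt_eqF// metric_det. Qed.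

Let dg x : D x -> differentiable g x.
Proof. by move=> Dx; exact: smooth_on_differentiable sg Dx. Qed.

Lemma christoffelC x u v : D x ->
  christoffel_form g x u v = christoffel_form g x v u.
Proof. exact: (christoffel_form_sym Do dg gs metric_unit). Qed.

Lemma metric_parallel x v b c : D x ->
  'D_v (fun y => inner (g y) b c) x =
  inner (g x) (christoffel_form g x v b) c + inner (g x) b (christoffel_form g x v c).
Proof. exact: (metric_compatible Do dg gs metric_unit). Qed.

(** Let G be the endomorphism Gamma(v, .). Metric compatibility gives D_v det g = 2 tr(G) det g, so
    D_v sqrt(det g) = tr(G) sqrt(det g); and wedge(Gb, c) + wedge(b, Gc) = tr(G) wedge(b, c) for
    every endomorphism of the plane. *)
Lemma area_parallel x v b c : D x ->
  'D_v (fun y => area (g y) b c) x =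
  area (g x) (christoffel_form g x v b) c + area (g x) b (christoffel_form g x v c).
Proof.
move=> Dx; have g0 := metric_det Dx; have g10 := sym10 (gs Dx).
pose e (i : 'I_2) : 'rV[R]_2 := delta_mx 0 i.
have Ie y i j : inner (g y) (e i) (e j) = g y i j.
  rewrite /inner /e trmx_delta -colE -rowE !mxE.
  by [].
have dgij i j : differentiable (fun y => g y i j) x.
  exact: (differentiable_mxP _ _).1 (dg Dx) i j.
have [G GE] : exists G, forall i, christoffel_form g x v (e i) = G i by eexists.
have Dg i j : 'D_v (fun y => g y i j) x = inner (g x) (G i) (e j) + inner (g x) (e i) (G j).
  rewrite -!GE -metric_parallel//; congr ('D_v _ x); apply/funext => y.
  by rewrite Ie.
pose q y := g y 0 0 * g y 1 1 - g y 0 1 * g y 1 0.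
have dq : differentiable q x.
  by apply: differentiable_subE; exact: differentiable_mulE.
have qE y : \det (g y) = q y by exact: det2.
have Dq : 'D_v q x = 2 * (G 0 0 0 + G 1 0 1) * q x.
  rewrite derive_subE; [|exact: differentiable_mulE..].
  rewrite !derive_mulE// !Dg /q !inner2 /e !mxE/= g10.
  by move: (G 0) (G 1) => G0 G1; ring.
have q0 : 0 < q x by rewrite -qE.
have [ds Ds] := is_derive_sqrt_comp v q0 dq.
have -> : (fun y => area (g y) b c) = (fun y => (Num.sqrt \o q) y * wedge b c).
  by apply/funext => y; rewrite /area qE.
have dc : differentiable (fun=> wedge b c : R) x by exact: differentiable_cst.
have Dc : 'D_v (fun=> wedge b c : R) x = 0 by exact: derive_cst.
rewrite (derive_mulE v ds dc) Dc Ds Dq mulr0 add0r.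
have E a : christoffel_form g x v a = a 0 0 *: G 0 + a 0 1 *: G 1.
  have {1}-> : a = a 0 0 *: e 0 + a 0 1 *: e 1.
    by apply: rowP2; rewrite !mxE/=; ring.
  by rewrite christoffel_formDr !christoffel_formZr !GE.
rewrite !E /area qE /wedge !mxE.
set r := Num.sqrt (q x).
have r0 : r != 0 by rewrite gt_eqF// sqrtr_gt0.
have -> : q x = r * r by rewrite -expr2 sqr_sqrtr// ltW.
have -> : (2 * r)^-1 * (2 * (G 0 0 0 + G 1 0 1) * (r * r)) = (G 0 0 0 + G 1 0 1) * r.
  by field.
move: (G 0) (G 1) => G0 G1; ring.
Qed.

Variables (I : set R) (gamma : R -> 'rV[R]_2).
Hypotheses (Io : open I) (sgam : smooth_on I gamma) (ID : forall s, I s -> D (gamma s)).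

Let cov := covariant_derivative g gamma.

Lemma smooth_on_metric_curve : smooth_on I (fun s => g (gamma s)).
Proof. exact: (smooth_on_comp Io Do ID sg sgam). Qed.

Lemma smooth_on_cov (V : R -> 'rV[R]_2) : smooth_on I V -> smooth_on I (cov V).
Proof.
move=> sV; apply: smooth_onD => //; first exact: smooth_on_derive.
apply: (smooth_on_christoffel_form Io Do ID sg metric_unit) => //.
exact: smooth_on_derive.
Qed.

Let dgam s : I s -> differentiable gamma s.
Proof. by move=> Is; exact: smooth_on_differentiable sgam Is. Qed.

Lemma derive_inner_curve (V W : R -> 'rV[R]_2) s : I s ->
  differentiable V s -> differentiable W s ->
  'D_1 (fun s => inner (g (gamma s)) (V s) (W s)) s =
  inner (g (gamma s)) (cov V s) (W s) + inner (g (gamma s)) (V s) (cov W s).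
Proof.
move=> Is dV dW; have Ds := ID Is.
have dgg : differentiable (fun s => g (gamma s)) s.
  exact: smooth_on_differentiable smooth_on_metric_curve Is.
have [_ ->] := @derive_innerE _ _ _ (fun s => g (gamma s)) V W s 1 dgg dV dW.
rewrite -[X in X + _ + _](_ : 'D_1 ((fun y => inner (g y) (V s) (W s)) \o gamma) s = _)//.
rewrite (@derive_comp _ _ _ _ _ gamma); [|exact: dgam|exact/differentiable_inner/dg].
rewrite metric_parallel// /cov /covariant_derivative innerD innerDr.
by move: (inner _ _ _) (inner _ _ _) (inner _ _ _) (inner _ _ _) => a b c d; ring.
Qed.

Lemma derive_area_curve (V W : R -> 'rV[R]_2) s : I s ->
  differentiable V s -> differentiable W s ->
  'D_1 (fun s => area (g (gamma s)) (V s) (W s)) s =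
  area (g (gamma s)) (cov V s) (W s) + area (g (gamma s)) (V s) (cov W s).
Proof.
move=> Is dV dW; have Ds := ID Is.
have sa := smooth_on_area_mx Do metric_det sg.
have da : differentiable (fun y => area_mx (g y)) (gamma s).
  exact: smooth_on_differentiable sa Ds.
have dag : differentiable (fun s => area_mx (g (gamma s))) s.
  exact: (differentiable_comp (dgam Is) da).
have [_] := @derive_innerE _ _ _ (fun s => area_mx (g (gamma s))) V W s 1 dag dV dW.
have -> : (fun s => inner (area_mx (g (gamma s))) (V s) (W s)) =
    (fun s => area (g (gamma s)) (V s) (W s)).
  by apply/funext => t; rewrite inner_area_mx.
move=> ->.
rewrite -[X in X + _ + _](_ : 'D_1 ((fun y => inner (area_mx (g y)) (V s) (W s)) \o gamma) s = _)//.
rewrite (@derive_comp _ _ _ _ _ gamma); [|exact: dgam|].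
  have -> : (fun y => inner (area_mx (g y)) (V s) (W s)) =
      (fun y => area (g y) (V s) (W s)).
    by apply/funext => t; rewrite inner_area_mx.
  rewrite area_parallel// /cov /covariant_derivative !inner_area_mx areaD areaDr.
  by move: (area _ _ _) (area _ _ _) (area _ _ _) (area _ _ _) => a b c d; ring.
exact: (@differentiable_inner _ _ (fun y => area_mx (g y))).
Qed.

(** The function g(jV, c) = area(V, c), with c constant, is differentiated by both product rules.
    The terms with the covariant derivative of c agree, and nondegeneracy of g concludes. *)
Lemma cov_jrot (V : R -> 'rV[R]_2) s : I s -> smooth_on I V ->
  cov (fun s => jrot (g (gamma s)) (V s)) s = jrot (g (gamma s)) (cov V s).
Proof.
move=> Is sV; have Ds := ID Is; have gss := gs Ds; have g0 := metric_det Ds.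
apply: (inner_nondeg gss g0) => c; rewrite inner_jrot//.
have dV : differentiable V s by exact: smooth_on_differentiable sV Is.
have sj : smooth_on I (fun s => jrot (g (gamma s)) (V s)).
  apply: smooth_on_jrot => //; last exact: smooth_on_metric_curve.
  by move=> t /ID /metric_det.
have dj := smooth_on_differentiable sj Is.
have dc : differentiable (fun=> c : 'rV[R]_2) s by exact: differentiable_cst.
have h1 := derive_inner_curve Is dj dc.
have h2 := derive_area_curve Is dV dc.
have E : 'D_1 (fun s => inner (g (gamma s)) (jrot (g (gamma s)) (V s)) c) s =
    'D_1 (fun s => area (g (gamma s)) (V s) c) s.
  apply: near_eq_derive; near=> t.
  have It : I t by near: t; exact: open_nbhs_nbhs.
  by apply: inner_jrot; [exact/gs/ID|exact/metric_det/ID].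
move: h1; rewrite E h2 inner_jrot// => /esym /addIr; exact.
Unshelve. all: by end_near. Qed.

End RiemannianPlane.

(** * The metric of the tangent bundle *)

Section Coordinates.
Context {R : realType}.

Lemma smooth_on_id (V : normedModType R) (U : set V) : smooth_on U (fun x : V => x).
Proof. by apply: (@smooth_on_linear _ _ _ _ idfun) => x. Qed.

Lemma smooth_on_coord m n (U : set 'M[R]_(m, n)) i j :
  smooth_on U (fun A : 'M[R]_(m, n) => A i j).
Proof.
apply: (@sub_smooth_on _ _ _ _ setT) => //.
exact: ((smooth_on_mxP _ openT).1 (smooth_on_id setT)).
Qed.

Lemma derive_coord m n (A B : 'M[R]_(m, n)) i j :
  'D_B (fun A : 'M[R]_(m, n) => A i j) A = B i j.
Proof.
rewrite -[LHS](@derive_mxE _ _ _ _ (fun A : 'M[R]_(m, n) => A)).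
  by rewrite derive_id.
exact: (smooth_on_differentiable (smooth_on_id setT) I).
Qed.

Lemma additive_rV_expand n (f : 'rV[R]_n -> R) :
  (forall u v, f (u + v) = f u + f v) -> (forall k u, f (k *: u) = k * f u) ->
  forall v, f v = \sum_i v 0 i * f (delta_mx 0 i).
Proof.
move=> fD fZ v; have f0 : f 0 = 0 by rewrite -[0 in LHS](scale0r 0) fZ mul0r.
by rewrite {1}(row_sum_delta v) (big_morph f fD f0); apply: eq_bigr => i _.
Qed.

Lemma unitmx_ker n (A : 'M[R]_n) : (forall v : 'rV[R]_n, v *m A = 0 -> v = 0) ->
  A \in unitmx.
Proof.
move=> kA; rewrite -row_free_unit -kermx_eq0; apply/eqP/row_matrixP => i.
by rewrite row0; apply: kA; rewrite -row_mul mulmx_ker row0.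
Qed.

Lemma derive_affine (V : normedModType R) (f : V -> R) (z v : V) (c : R) :
  differentiable f z -> (forall t, f (z + t *: v) = f z + t * c) ->
  'D_v f z = c.
Proof.
move=> df fE.
have [|_ h] := @is_derive_line R V _ f z v 0; first by rewrite scale0r addr0.
move: h; rewrite scale0r addr0 => <-.
have -> : (fun s : R => f (z + s *: v)) = (fun s : R => f z + s * c).
  exact/funext.
have d1 : differentiable (fun s : R => s : R) 0.
  exact: (@smooth_on_differentiable _ _ _ setT _ _ (smooth_on_id _) I).
have dc (k : R) : differentiable (fun _ : R => k : R) 0 by exact: differentiable_cst.
have Dc (k : R) : 'D_1 (fun _ : R => k : R) (0 : R) = 0 by exact: derive_cst.
have D1 : 'D_1 (fun s : R => s : R) (0 : R) = 1 by exact: derive_id.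
rewrite (@derive_addE _ _ _ (fun=> f z) (fun s : R => s * c)); last exact: differentiable_mulE.
  rewrite (@derive_mulE _ _ (fun s => s) (fun=> c))//.
  by rewrite !Dc D1 mulr0 !add0r mulr1.
exact: dc.
Qed.

End Coordinates.

Section TangentMetric.
Context {R : realType}.
Variables (g : 'rV[R]_2 -> 'M[R]_2) (D : set 'rV[R]_2).
Hypotheses (Do : open D) (sg : smooth_on D g)
  (gs : forall x, D x -> (g x)^T = g x)
  (gp : forall x v, D x -> v != 0 -> 0 < inner (g x) v v).

Let gu := metric_unit gs gp.
Let g0 := metric_det gs gp.

Definition tangent_domain : set 'rV[R]_4 := [set z | D (fst4 z)].

Lemma fst4E (z : 'rV[R]_4) i : fst4 z 0 i = z 0 (@lshift 2 2 i).
Proof. by rewrite mxE. Qed.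

Lemma snd4E (z : 'rV[R]_4) i : snd4 z 0 i = z 0 (@rshift 2 2 i).
Proof. by rewrite mxE. Qed.

Lemma fst4K (x y : 'rV[R]_2) : fst4 (pair4 x y) = x.
Proof. exact: row_mxKl. Qed.

Lemma snd4K (x y : 'rV[R]_2) : snd4 (pair4 x y) = y.
Proof. exact: row_mxKr. Qed.

Lemma pair4K (z : 'rV[R]_4) : pair4 (fst4 z) (snd4 z) = z.
Proof. exact: (@hsubmxK R 1 2 2). Qed.

Lemma fst4D (z z' : 'rV[R]_4) : fst4 (z + z') = fst4 z + fst4 z'.
Proof. exact: linearD. Qed.

Lemma snd4D (z z' : 'rV[R]_4) : snd4 (z + z') = snd4 z + snd4 z'.
Proof. exact: linearD. Qed.

Lemma fst4Z k (z : 'rV[R]_4) : fst4 (k *: z) = k *: fst4 z.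
Proof. exact: linearZ. Qed.

Lemma snd4Z k (z : 'rV[R]_4) : snd4 (k *: z) = k *: snd4 z.
Proof. exact: linearZ. Qed.

Lemma smooth_on_fst4 (U : set 'rV[R]_4) : smooth_on U fst4.
Proof.
apply: (@sub_smooth_on _ _ _ _ setT) => //; apply/(smooth_on_rVP _ openT) => i.
apply: eq_smooth_on (@smooth_on_coord R 1 4 setT 0 (@lshift 2 2 i)) => //.
  exact: openT.
by move=> z _; rewrite fst4E.
Qed.

Lemma smooth_on_snd4 (U : set 'rV[R]_4) : smooth_on U snd4.
Proof.
apply: (@sub_smooth_on _ _ _ _ setT) => //; apply/(smooth_on_rVP _ openT) => i.
apply: eq_smooth_on (@smooth_on_coord R 1 4 setT 0 (@rshift 2 2 i)) => //.
  exact: openT.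
by move=> z _; rewrite snd4E.
Qed.

Lemma differentiable_fst4 z : differentiable (@fst4 R) z.
Proof. exact: (smooth_on_differentiable (@smooth_on_fst4 setT) I). Qed.

Lemma derive_fst4 z v : 'D_v (@fst4 R) z = fst4 v.
Proof.
apply/rowP => i; rewrite (derive_rVE _ _ (differentiable_fst4 z)).
have -> : (fun y => @fst4 R y 0 i) = (fun y => y 0 (@lshift 2 2 i)).
  by apply/funext => y; rewrite fst4E.
by rewrite fst4E; exact: derive_coord.
Qed.

Lemma tangent_domain_open : open tangent_domain.
Proof.
move/continuousP : (fun z => differentiable_continuous (differentiable_fst4 z)).
exact.
Qed.

Lemma KmapD z xi eta : Kmap g z (xi + eta) = Kmap g z xi + Kmap g z eta.
Proof. by rewrite /Kmap snd4D fst4D christoffel_formD addrACA. Qed.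

Lemma KmapZ z k xi : Kmap g z (k *: xi) = k *: Kmap g z xi.
Proof. by rewrite /Kmap snd4Z fst4Z christoffel_formZ scalerDr. Qed.

Lemma Kmap_vert z b : Kmap g z (pair4 0 b) = b.
Proof. by rewrite /Kmap snd4K fst4K christoffel_form0 addr0. Qed.

(** Inserting J in Omega gives g(jK xi, P eta) - g(jP xi, K eta), where both terms are values of the
    area form. [GG] is defined by its entries, so bilinearity carries the formula to all vectors. *)
Lemma inner_GG z xi eta : tangent_domain z -> inner (GG g z) xi eta =
  area (g (fst4 z)) (Kmap g z xi) (fst4 eta) +
  area (g (fst4 z)) (Kmap g z eta) (fst4 xi).
Proof.
move=> Dz; have As := gs Dz; have A0 := g0 Dz.
pose B xi eta := area (g (fst4 z)) (Kmap g z xi) (fst4 eta) +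
  area (g (fst4 z)) (Kmap g z eta) (fst4 xi).
have BD1 u v w : B (u + v) w = B u w + B v w.
  by rewrite /B KmapD fst4D areaD areaDr addrACA.
have BZ1 k u w : B (k *: u) w = k * B u w.
  by rewrite /B KmapZ fst4Z areaZ areaZr mulrDr.
have BD2 u v w : B w (u + v) = B w u + B w v.
  by rewrite /B KmapD fst4D areaD areaDr addrACA.
have BZ2 k u w : B w (k *: u) = k * B w u.
  by rewrite /B KmapZ fst4Z areaZ areaZr mulrDr.
have GE i j : GG g z i j = B (delta_mx 0 i) (delta_mx 0 j).
  rewrite mxE /Omega; have [-> ->] := JJ_spec g z (delta_mx 0 i).
  by rewrite /Pmap !inner_jrot// /B [area _ (fst4 _) _]areaC opprK.
rewrite -[RHS]/(B xi eta) innerE.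
rewrite (additive_rV_expand (f := B^~ eta))//; apply: eq_bigr => i _.
rewrite (additive_rV_expand (f := B (delta_mx 0 i)))// mulr_sumr.
by apply: eq_bigr => j _; rewrite GE mulrA.
Qed.

Lemma inner_GG_vert z b eta : tangent_domain z ->
  inner (GG g z) (pair4 0 b) eta = area (g (fst4 z)) b (fst4 eta).
Proof.
by move=> Dz; rewrite inner_GG// Kmap_vert fst4K area0r addr0.
Qed.

Lemma inner_delta n (A : 'M[R]_n) i j : inner A (delta_mx 0 i) (delta_mx 0 j) = A i j.
Proof. by rewrite /inner trmx_delta -colE -rowE !mxE. Qed.

Lemma inner_GGC z xi eta : tangent_domain z ->
  inner (GG g z) xi eta = inner (GG g z) eta xi.
Proof. by move=> Dz; rewrite !inner_GG// addrC. Qed.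

Lemma GG_sym z : tangent_domain z -> (GG g z)^T = GG g z.
Proof.
move=> Dz; apply/matrixP => i j.
by rewrite -(inner_delta (GG g z)) inner_GGC// inner_delta [LHS]mxE.
Qed.

(** For a vector in the kernel, pairing with vertical vectors shows P xi = 0; pairing with vectors
    of arbitrary base part then shows K xi = 0. *)
Lemma GG_unit z : tangent_domain z -> GG g z \in unitmx.
Proof.
move=> Dz; have As := gs Dz; have A0 := g0 Dz.
apply: unitmx_ker => xi xi0.
have h eta : inner (GG g z) xi eta = 0 by rewrite /inner xi0 mul0mx mxE.
have f0 : fst4 xi = 0.
  apply: (area_nondeg A0) => c; rewrite areaC area0.
  have := h (pair4 0 c); rewrite inner_GG// Kmap_vert fst4K area0r add0r => ->.
  by rewrite oppr0.
have K0 : Kmap g z xi = 0.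
  apply: (area_nondeg A0) => c; rewrite area0.
  by have := h (pair4 c 0); rewrite inner_GG// f0 area0r fst4K addr0.
by rewrite -(pair4K xi) f0; move: K0; rewrite /Kmap f0 christoffel_form0 addr0 => ->;
  rewrite -(row_mx0 _ 1 2 2).
Qed.

Lemma smooth_on_Kmap xi : smooth_on tangent_domain (fun z => Kmap g z xi).
Proof.
apply: smooth_onD; [exact: tangent_domain_open|exact: smooth_on_cst|].
apply: (smooth_on_christoffel_form tangent_domain_open Do _ sg gu) => //.
- exact: smooth_on_fst4.
- exact: smooth_on_cst.
- exact: smooth_on_snd4.
Qed.

Lemma smooth_on_GG : smooth_on tangent_domain (GG g).
Proof.
have To := tangent_domain_open.
have sa : smooth_on tangent_domain (fun z => area_mx (g (fst4 z))).
  apply: smooth_on_area_mx => //; first by move=> z; exact: g0.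
  apply: (smooth_on_comp To Do _ sg) => //; exact: smooth_on_fst4.
apply/smooth_on_mxP => // i j.
have := smooth_onD To
  (smooth_on_inner To sa (smooth_on_Kmap (delta_mx 0 i)) (smooth_on_cst _ (fst4 (delta_mx 0 j))))
  (smooth_on_inner To sa (smooth_on_Kmap (delta_mx 0 j)) (smooth_on_cst _ (fst4 (delta_mx 0 i)))).
apply: eq_smooth_on => // z /set_mem Dz.
by rewrite !inner_area_mx -inner_GG// inner_delta.
Qed.

Lemma GG_differentiable z : tangent_domain z -> differentiable (GG g) z.
Proof. by move=> Dz; exact: smooth_on_differentiable smooth_on_GG Dz. Qed.

Lemma derive_area_fst4 z xi b c : tangent_domain z ->
  'D_xi (fun y => area (g (fst4 y)) b c) z =
  area (g (fst4 z)) (christoffel_form g (fst4 z) (fst4 xi) b) c +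
  area (g (fst4 z)) b (christoffel_form g (fst4 z) (fst4 xi) c).
Proof.
move=> Dz; rewrite -[LHS]/('D_xi ((fun x => area (g x) b c) \o fst4) z).
rewrite (@derive_comp _ _ _ _ (fun x => area (g x) b c) fst4).
- by rewrite derive_fst4 (area_parallel Do sg gs gp).
- exact: differentiable_fst4.
- rewrite (_ : (fun x => _) = (fun x => inner (area_mx (g x)) b c)); last first.
    by apply/funext => x; rewrite inner_area_mx.
  apply: (@differentiable_inner _ _ (fun x => area_mx (g x))).
  exact: (smooth_on_differentiable (smooth_on_area_mx Do g0 sg) Dz).
Qed.

(* Vertical vectors are isotropic for GG, so the Koszul formula with one vertical
   argument involves only derivatives of the area form, which is parallel. *)
Lemma christoffel_GG_vert z xi b : tangent_domain z ->
  christoffel_form (GG g) z xi (pair4 0 b) =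
  pair4 0 (christoffel_form g (fst4 z) (fst4 xi) b).
Proof.
move=> Dz; have dG := GG_differentiable Dz.
apply: koszul_unique; [exact: dG|exact: GG_sym|exact: GG_unit|move=> w].
have nT : {near z, forall y, tangent_domain y}.
  exact: (open_nbhs_nbhs (conj tangent_domain_open Dz)).
have -> : 'D_xi (fun y => inner (GG g y) (pair4 0 b) w) z =
    'D_xi (fun y => area (g (fst4 y)) b (fst4 w)) z.
  by apply: near_eq_derive; apply: filterS nT => y; exact: inner_GG_vert.
have -> : 'D_w (fun y => inner (GG g y) xi (pair4 0 b)) z =
    'D_w (fun y => area (g (fst4 y)) b (fst4 xi)) z.
  apply: near_eq_derive; apply: filterS nT => y Dy.
  by rewrite inner_GGC//; exact: inner_GG_vert.
rewrite !derive_area_fst4// inner_GG_vert//.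
(* In the vertical direction the base point is fixed and [Kmap] is affine in the fibre coordinate,
   so the metric coefficients are affine and their derivative is the slope. *)
rewrite (@derive_affine _ _ _ _ _
  (area (g (fst4 z)) (christoffel_form g (fst4 z) (fst4 xi) b) (fst4 w) +
   area (g (fst4 z)) (christoffel_form g (fst4 z) (fst4 w) b) (fst4 xi))).
- rewrite (christoffelC Do sg gs gp (fst4 w) (fst4 xi) Dz).
  by move: (area _ _ _) (area _ _ _) (area _ _ _) => p q r; ring.
- exact: differentiable_inner.
- move=> t; have Ef : fst4 (z + t *: pair4 0 b) = fst4 z.
    by rewrite fst4D fst4Z fst4K scaler0 addr0.
  have Dt : tangent_domain (z + t *: pair4 0 b) by rewrite /tangent_domain/= Ef.
  have EK v : Kmap g (z + t *: pair4 0 b) v =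
      Kmap g z v + t *: christoffel_form g (fst4 z) (fst4 v) b.
    rewrite /Kmap Ef snd4D snd4Z snd4K christoffel_formDr christoffel_formZr.
    by rewrite addrA.
  rewrite !inner_GG// Ef !EK !areaD !areaZ.
  by rewrite mulrDr addrACA.
Qed.

Lemma christoffel_GG_sym z xi eta : tangent_domain z ->
  christoffel_form (GG g) z xi eta = christoffel_form (GG g) z eta xi.
Proof.
exact: (christoffel_form_sym tangent_domain_open GG_differentiable GG_sym GG_unit).
Qed.

End TangentMetric.

(** * Invariance of the mean curvature under reparametrization *)

Section Reparametrization.
Context {R : realType} {m n : nat}.
Variables (G : 'rV[R]_n -> 'M[R]_n) (X : 'rV[R]_m -> 'rV[R]_n).

Lemma normal_partD u xi eta :
  normal_part G X u (xi + eta) = normal_part G X u xi + normal_part G X u eta.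
Proof. by rewrite /normal_part !mulmxDl opprD addrACA. Qed.

Lemma normal_partZ u k xi : normal_part G X u (k *: xi) = k *: normal_part G X u xi.
Proof. by rewrite /normal_part -!scalemxAl scalerBr. Qed.

Lemma normal_part_sum u k (F : 'I_k -> 'rV[R]_n) :
  normal_part G X u (\sum_i F i) = \sum_i normal_part G X u (F i).
Proof.
have N0 : normal_part G X u 0 = 0 by rewrite -[0 in LHS](scale0r 0) normal_partZ scale0r.
exact: (big_morph _ (normal_partD u) N0).
Qed.

Lemma normal_part_tangent u v : induced_metric G X u \in unitmx ->
  normal_part G X u (v *m 'J X u) = 0.
Proof.
move=> hu; rewrite /normal_part.
have -> : v *m 'J X u *m G (X u) *m ('J X u)^T = v *m induced_metric G X u.
  by rewrite /induced_metric !mulmxA.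
by rewrite mulmxK// subrr.
Qed.

Lemma normal_part_normal u xi :
  (forall i, inner (G (X u)) xi (row i ('J X u)) = 0) -> normal_part G X u xi = xi.
Proof.
move=> xi0; rewrite /normal_part.
suff -> : xi *m G (X u) *m ('J X u)^T = 0 by rewrite !mul0mx subr0.
apply/rowP => i; rewrite [RHS]mxE -(xi0 i) /inner tr_row.
by rewrite !mxE; apply: eq_bigr => k _; rewrite !mxE.
Qed.

Variables (U W : set 'rV[R]_m) (chi : 'rV[R]_m -> 'rV[R]_m).
Hypotheses (Uo : open U) (Wo : open W) (sX : smooth_on U X)
  (sc : smooth_on W chi) (WU : forall w, W w -> U (chi w)).

Let dchi w : W w -> differentiable chi w.
Proof. by move=> Ww; exact: smooth_on_differentiable sc Ww. Qed.

Let dX u : U u -> differentiable X u.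
Proof. by move=> Uu; exact: smooth_on_differentiable sX Uu. Qed.

Lemma jacobian_reparam w : W w -> 'J (X \o chi) w = 'J chi w *m 'J X (chi w).
Proof. by move=> Ww; apply: jacobian_comp; [exact: dchi|exact/dX/WU]. Qed.

Lemma induced_metric_reparam w : W w -> induced_metric G (X \o chi) w =
  'J chi w *m induced_metric G X (chi w) *m ('J chi w)^T.
Proof. by move=> Ww; rewrite /induced_metric jacobian_reparam// trmx_mul !mulmxA. Qed.

Lemma invmx_congr k (A h : 'M[R]_k) : A \in unitmx -> h \in unitmx ->
  invmx (A *m h *m A^T) = (invmx A)^T *m invmx h *m invmx A.
Proof.
move=> Au hu; have Atu : A^T \in unitmx by rewrite unitmx_tr.
have hA : A *m h *m A^T \in unitmx by rewrite !unitmx_mul Au hu Atu.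
apply: (can_inj (mulKmx hA)); rewrite mulmxV// !mulmxA.
rewrite trmx_inv -(mulmxA (A *m h)) mulmxV// mulmx1.
by rewrite -(mulmxA A) mulmxV// mulmx1 mulmxV.
Qed.

(** The projection depends only on the span of the rows of the Jacobian, which an invertible factor
    preserves. *)
Lemma normal_part_reparam w xi : W w -> 'J chi w \in unitmx ->
  induced_metric G X (chi w) \in unitmx ->
  normal_part G (X \o chi) w xi = normal_part G X (chi w) xi.
Proof.
move=> Ww Au hu; rewrite /normal_part (induced_metric_reparam Ww) (invmx_congr Au hu).
rewrite (jacobian_reparam Ww) trmx_mul !mulmxA; congr (_ - _).
move: ('J chi w) Au => A Au; rewrite -/(comp X chi w).
set B := xi *m _ *m _.
have -> : B *m A^T *m (invmx A)^T = B.
  by rewrite -mulmxA trmx_inv mulmxV ?mulmx1// unitmx_tr.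
by congr (_ *m _); rewrite -mulmxA mulVmx// mulmx1.
Qed.

Lemma pd_reparam b w : W w ->
  pd b (X \o chi) w = \sum_j (pd b chi w) 0 j *: pd j X (chi w).
Proof.
move=> Ww; rewrite /pd derive_comp; [|exact: dchi|exact/dX/WU].
by rewrite derive_sum_delta//; exact/dX/WU.
Qed.

Lemma pd2_reparam a b w : W w -> pd a (pd b (X \o chi)) w =
  \sum_j (pd a (fun u => pd b chi u 0 j) w *: pd j X (chi w) +
    pd b chi w 0 j *: \sum_i pd a chi w 0 i *: pd i (pd j X) (chi w)).
Proof.
move=> Ww; pose k j u := pd b chi u 0 j.
have E : {near w, pd b (X \o chi) =1 (fun u => \sum_j k j u *: (pd j X \o chi) u)}.
  apply: filterS (open_nbhs_nbhs (conj Wo Ww)) => u Wu; exact: pd_reparam.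
rewrite {1}/pd (near_eq_derive _ E).
have sk j : smooth_on W (k j).
  by have /(smooth_on_rVP _ Wo) := smooth_on_derive (delta_mx 0 b) sc; apply.
have dk j : differentiable (k j) w := smooth_on_differentiable (sk j) Ww.
have dpX j : differentiable (pd j X) (chi w).
  exact: (smooth_on_differentiable (smooth_on_derive (delta_mx 0 j) sX) (WU Ww)).
have dpXc j : differentiable (pd j X \o chi) w.
  exact: (differentiable_comp (dchi Ww) (dpX j)).
have dscale j := derive_scaleE (delta_mx 0 a) (dk j) (dpXc j).
rewrite derive_sumE => [|j]; last exact: (dscale j).1.
apply: eq_bigr => j _; rewrite (dscale j).2; congr (_ + _ *: _).
rewrite derive_comp; [|exact: dchi|exact: dpX].
by rewrite derive_sum_delta//; exact: dpX.
Qed.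

Lemma christoffel_form_sum x k (F : 'I_k -> 'rV[R]_n) v :
  christoffel_form G x (\sum_i F i) v = \sum_i christoffel_form G x (F i) v.
Proof.
exact: (big_morph (fun u => christoffel_form G x u v)
  (fun u u' => christoffel_formD G x u u' v) (christoffel_form0 G x v)).
Qed.

Lemma christoffel_form_sumr x k (F : 'I_k -> 'rV[R]_n) u :
  christoffel_form G x u (\sum_i F i) = \sum_i christoffel_form G x u (F i).
Proof.
exact: (big_morph (christoffel_form G x u)
  (christoffel_formDr G x u) (christoffel_form0r G x u)).
Qed.

(** The second derivatives of [chi] enter only through a combination of the d_j X, which is tangent
    and killed by the normal projection; what remains is bilinear in the first derivatives of
    [chi]. *)
Lemma second_fundamental_form_reparam a b w : W w -> 'J chi w \in unitmx ->
  induced_metric G X (chi w) \in unitmx ->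
  second_fundamental_form G (X \o chi) w a b =
  \sum_i \sum_j ('J chi w a i * 'J chi w b j) *:
    second_fundamental_form G X (chi w) i j.
Proof.
move=> Ww Au hu; rewrite /second_fundamental_form (normal_part_reparam _ Ww Au hu).
have JE c i : 'J chi w c i = pd c chi w 0 i.
  by rewrite -(row_jacobian c (dchi Ww)) [RHS]mxE.
rewrite (pd2_reparam a b Ww) (pd_reparam a Ww) (pd_reparam b Ww) big_split/= -addrA.
rewrite -/(comp X chi w) normal_partD.
have -> : \sum_j pd a (fun u => pd b chi u 0 j) w *: pd j X (chi w) =
    (\row_j pd a (fun u => pd b chi u 0 j) w) *m 'J X (chi w).
  rewrite mulmx_sum_row; apply: eq_bigr => j _.
  by rewrite mxE row_jacobian//; exact/dX/WU.
rewrite (normal_part_tangent _ hu) add0r christoffel_form_sum.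
under [X in _ + X]eq_bigr do rewrite christoffel_formZ christoffel_form_sumr scaler_sumr.
under eq_bigr do rewrite scaler_sumr.
rewrite exchange_big/= -big_split/= normal_part_sum; apply: eq_bigr => i _.
rewrite -big_split/= normal_part_sum; apply: eq_bigr => j _.
rewrite christoffel_formZr !scalerA !JE -normal_partZ scalerDr.
by rewrite [pd b chi w 0 j * _]mulrC.
Qed.

End Reparametrization.

(** The contravariant law of the inverse metric, with the two Jacobian factors placed as in the law
    of the second fundamental form, so that the trace of the latter is invariant. *)
Lemma invmx_congr_coef (R : realType) k (A h : 'M[R]_k) i j :
  A \in unitmx -> h \in unitmx ->
  invmx h i j = \sum_a \sum_b invmx (A *m h *m A^T) a b * (A a i * A b j).
Proof.
move=> Au hu; have {1}-> : invmx h = A^T *m invmx (A *m h *m A^T) *m A.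
  rewrite (invmx_congr Au hu) !mulmxA trmx_inv mulmxV ?mul1mx ?unitmx_tr//.
  by rewrite -mulmxA mulVmx// mulmx1.
rewrite mxE exchange_big/=; apply: eq_bigr => b _.
rewrite !mxE mulr_suml; apply: eq_bigr => a _; rewrite mxE.
by ring.
Qed.

Lemma mean_curvature_reparam (R : realType) (n : nat) (G : 'rV[R]_n -> 'M[R]_n)
    (X : 'rV[R]_2 -> 'rV[R]_n) (U W : set 'rV[R]_2) (chi : 'rV[R]_2 -> 'rV[R]_2) w :
  open U -> open W -> smooth_on U X -> smooth_on W chi ->
  (forall w, W w -> U (chi w)) -> W w -> 'J chi w \in unitmx ->
  induced_metric G X (chi w) \in unitmx ->
  mean_curvature G (X \o chi) w = mean_curvature G X (chi w).
Proof.
move=> Uo Wo sX sc WU Ww Au hu; rewrite /mean_curvature.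
rewrite (induced_metric_reparam G sX sc WU Ww); apply: (congr1 ( *:%R 2^-1)).
set A := 'J chi w; set h := induced_metric G X (chi w).
have E i j := invmx_congr_coef i j Au hu.
rewrite [RHS](eq_bigr (fun i => \sum_j \sum_a \sum_b
  (invmx (A *m h *m A^T) a b * (A a i * A b j)) *:
    second_fundamental_form G X (chi w) i j)); last first.
  move=> i _; apply: eq_bigr => j _; rewrite E scaler_suml.
  by apply: eq_bigr => a _; rewrite scaler_suml.
under [RHS]eq_bigr do rewrite exchange_big/=.
rewrite [RHS]exchange_big/=; apply: eq_bigr => a _.
under [RHS]eq_bigr do rewrite exchange_big/=.
rewrite [RHS]exchange_big/=; apply: eq_bigr => b _.
rewrite (second_fundamental_form_reparam Wo sX sc WU a b Ww Au hu) scaler_sumr.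
apply: eq_bigr => i _; rewrite scaler_sumr; apply: eq_bigr => j _.
by rewrite scalerA.
Qed.

(** * Affine normal bundles *)

Section Pair4.
Context {R : realType} {V : normedModType R}.

Lemma pair4E (x y : 'rV[R]_2) : pair4 x y =
  x *m (row_mx 1%:M 0 : 'M[R]_(2, 2 + 2)) + y *m (row_mx 0 1%:M : 'M[R]_(2, 2 + 2)).
Proof. by rewrite !mul_mx_row !mulmx1 !mulmx0 add_row_mx addr0 add0r. Qed.

Lemma pair4D (x y x' y' : 'rV[R]_2) :
  pair4 x y + pair4 x' y' = pair4 (x + x') (y + y').
Proof. by rewrite -[LHS]pair4K fst4D snd4D !fst4K !snd4K. Qed.

Lemma pair4Z k (x y : 'rV[R]_2) : k *: pair4 x y = pair4 (k *: x) (k *: y).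
Proof. by rewrite -[LHS]pair4K fst4Z snd4Z !fst4K !snd4K. Qed.

Lemma pair4N (x y : 'rV[R]_2) : - pair4 x y = pair4 (- x) (- y).
Proof. by rewrite -scaleN1r pair4Z !scaleN1r. Qed.

Lemma pair40 : pair4 0 0 = 0 :> 'rV[R]_4.
Proof. by have := pair4Z 0 0 0; rewrite !scale0r => <-. Qed.

Lemma derive_pair4 (f h : V -> 'rV[R]_2) x v :
  differentiable f x -> differentiable h x ->
  differentiable (fun y => pair4 (f y) (h y)) x /\
  'D_v (fun y => pair4 (f y) (h y)) x = pair4 ('D_v f x) ('D_v h x).
Proof.
move=> df dh.
have [df1 Df1] := derive_mulmxr (row_mx 1%:M 0 : 'M[R]_(2, 2 + 2)) v df.
have [dh1 Dh1] := derive_mulmxr (row_mx 0 1%:M : 'M[R]_(2, 2 + 2)) v dh.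
have -> : (fun y => pair4 (f y) (h y)) = (fun y =>
    f y *m (row_mx 1%:M 0 : 'M[R]_(2, 2 + 2)) + h y *m (row_mx 0 1%:M : 'M[R]_(2, 2 + 2))).
  by apply/funext => y; rewrite pair4E.
split; first exact: differentiable_addE.
by rewrite (derive_addE v df1 dh1) Df1 Dh1 -pair4E.
Qed.

Lemma smooth_on_pair4 (U : set V) (f h : V -> 'rV[R]_2) : open U ->
  smooth_on U f -> smooth_on U h -> smooth_on U (fun y => pair4 (f y) (h y)).
Proof.
move=> Uo sf sh.
have -> : (fun y => pair4 (f y) (h y)) = (fun y =>
    f y *m (row_mx 1%:M 0 : 'M[R]_(2, 2 + 2)) + h y *m (row_mx 0 1%:M : 'M[R]_(2, 2 + 2))).
  by apply/funext => y; rewrite pair4E.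
by apply: smooth_onD => //; apply: smooth_on_mulmx => //; exact: smooth_on_cst.
Qed.

Lemma smooth_on_scale (U : set V) n (k : V -> R) (f : V -> 'rV[R]_n) : open U ->
  smooth_on U k -> smooth_on U f -> smooth_on U (fun y => k y *: f y).
Proof.
move=> Uo sk sf; apply/smooth_on_rVP => // i.
apply: eq_smooth_on (smooth_onM Uo sk ((smooth_on_rVP _ Uo).1 sf i)) => // y _.
by rewrite mxE.
Qed.

End Pair4.

(** * Maps affine in the second variable *)

Section RuledMap.
Context {R : realType}.
Variables (I : set R).
Hypotheses (Io : open I).

Definition strip : set 'rV[R]_2 := [set w | I (w 0 0)].

Lemma strip_open : open strip.
Proof.
have : continuous (fun w : 'rV[R]_2 => w 0 0) by exact: coord_continuous.
by move/continuousP; exact.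
Qed.

(* The derivatives of such a map are again of this form. *)
Definition ruled (P Q N : R -> 'rV[R]_2) (w : 'rV[R]_2) : 'rV[R]_4 :=
  pair4 (P (w 0 0)) (Q (w 0 0) + w 0 1 *: N (w 0 0)).

Lemma differentiable_coord_rV n (w : 'rV[R]_n) i :
  differentiable (fun w : 'rV[R]_n => w 0 i) w.
Proof. exact: differentiable_coord. Qed.

Lemma derive_coord_comp (f : R -> 'rV[R]_2) (w v : 'rV[R]_2) :
  differentiable f (w 0 0) ->
  differentiable (fun w : 'rV[R]_2 => f (w 0 0)) w /\
  'D_v (fun w : 'rV[R]_2 => f (w 0 0)) w = v 0 0 *: 'D_1 f (w 0 0).
Proof.
move=> df; have dc := differentiable_coord_rV w 0; split.
  exact: (differentiable_comp dc df).
rewrite -[LHS]/('D_v (f \o (fun w : 'rV[R]_2 => w 0 0)) w) derive_comp_R//.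
by rewrite derive_coord.
Qed.

Lemma derive_ruled P Q N (w v : 'rV[R]_2) : differentiable P (w 0 0) ->
  differentiable Q (w 0 0) -> differentiable N (w 0 0) ->
  differentiable (ruled P Q N) w /\
  'D_v (ruled P Q N) w = pair4 (v 0 0 *: 'D_1 P (w 0 0))
    (v 0 0 *: ('D_1 Q (w 0 0) + w 0 1 *: 'D_1 N (w 0 0)) + v 0 1 *: N (w 0 0)).
Proof.
move=> dP dQ dN.
have [dP' DP'] := derive_coord_comp v dP.
have [dQ' DQ'] := derive_coord_comp v dQ.
have [dN' DN'] := derive_coord_comp v dN.
have [dS DS] := derive_scaleE v (differentiable_coord_rV w 1) dN'.
have dQS := differentiable_addE dQ' dS.
have [dR DR] := derive_pair4 v dP' dQS.
split; first exact: dR.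
rewrite [LHS]DR (derive_addE v dQ' dS) DP' DQ' DS DN' derive_coord.
move: ('D_1 P _) ('D_1 Q _) ('D_1 N _) (N _) => p q n n'.
by congr pair4; rewrite scalerDr !scalerA -addrA [w 0 1 * _]mulrC [X in _ + X]addrC.
Qed.

Lemma smooth_on_strip (f : R -> 'rV[R]_2) :
  smooth_on I f -> smooth_on strip (fun w => f (w 0 0)).
Proof.
move=> sf; apply: (@smooth_on_comp_R _ _ _ _ _ _ f (fun w : 'rV[R]_2 => w 0 0)
  strip_open Io _ sf) => //.
exact: smooth_on_coord.
Qed.

Lemma smooth_on_ruled P Q N : smooth_on I P -> smooth_on I Q -> smooth_on I N ->
  smooth_on strip (ruled P Q N).
Proof.
move=> sP sQ sN; apply: smooth_on_pair4; [exact: strip_open|exact: smooth_on_strip|].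
apply: smooth_onD; [exact: strip_open|exact: smooth_on_strip|].
apply: smooth_on_scale; [exact: strip_open|exact: smooth_on_coord|].
exact: smooth_on_strip.
Qed.

End RuledMap.

Lemma induced_metricE (R : realType) m n (G : 'rV[R]_n -> 'M[R]_n)
    (X : 'rV[R]_m -> 'rV[R]_n) u i j : differentiable X u ->
  induced_metric G X u i j = inner (G (X u)) (pd i X u) (pd j X u).
Proof.
move=> dX; rewrite -!(row_jacobian _ dX) /inner tr_row -!row_mul.
by rewrite -[RHS](mxE _ _) || rewrite /induced_metric !mxE; apply: eq_bigr => k _; rewrite !mxE.
Qed.

Lemma mean_curvature2E (R : realType) n (G : 'rV[R]_n -> 'M[R]_n)
    (X : 'rV[R]_2 -> 'rV[R]_n) u : mean_curvature G X u =
  2^-1 *: ((invmx (induced_metric G X u) 0 0 *: second_fundamental_form G X u 0 0 +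
            invmx (induced_metric G X u) 0 1 *: second_fundamental_form G X u 0 1) +
           (invmx (induced_metric G X u) 1 0 *: second_fundamental_form G X u 1 0 +
            invmx (induced_metric G X u) 1 1 *: second_fundamental_form G X u 1 1)).
Proof.
rewrite /mean_curvature.
generalize (second_fundamental_form G X u) (invmx (induced_metric G X u)) => sf hi.
by rewrite !sum2.
Qed.

(** * Geometry of an affine normal bundle in coordinates *)

Section AffineNormalBundle.
Context {R : realType}.
Variables (g : 'rV[R]_2 -> 'M[R]_2) (D : set 'rV[R]_2).
Hypotheses (Do : open D) (sg : smooth_on D g)
  (gs : forall x, D x -> (g x)^T = g x)
  (gp : forall x v, D x -> v != 0 -> 0 < inner (g x) v v).
Variables (I : set R) (gamma : R -> 'rV[R]_2) (a : R -> R).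
Hypotheses (Io : open I) (sgam : smooth_on I gamma) (ID : forall s, I s -> D (gamma s)).
Hypotheses (sa : smooth_on I a).

Let T := 'D_1 gamma.
Let N s := jrot (g (gamma s)) (T s).
Let Y s := a s *: T s.
Let cov := covariant_derivative g gamma.

Hypothesis unit_speed : forall s, I s -> inner (g (gamma s)) (T s) (T s) = 1.

Definition affine_normal_map : 'rV[R]_2 -> 'rV[R]_4 := ruled gamma Y N.

Let g0 s : I s -> 0 < \det (g (gamma s)).
Proof. by move=> Is; exact: (metric_det gs gp (ID Is)). Qed.

Let gss s : I s -> (g (gamma s))^T = g (gamma s).
Proof. by move=> Is; exact: (gs (ID Is)). Qed.

Let sT : smooth_on I T. Proof. exact: smooth_on_derive. Qed.

Let sN : smooth_on I N.
Proof.
apply: smooth_on_jrot => //; exact: (smooth_on_metric_curve Do sg Io sgam ID).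
Qed.

Let sY : smooth_on I Y. Proof. exact: smooth_on_scale. Qed.

Let sN1 : smooth_on I ('D_1 N). Proof. exact: smooth_on_derive. Qed.

Let sY1 : smooth_on I ('D_1 Y). Proof. exact: smooth_on_derive. Qed.

Lemma smooth_on_affine_normal_map : smooth_on (strip I) affine_normal_map.
Proof. exact: smooth_on_ruled. Qed.

Lemma cov_normal s : I s -> cov N s = jrot (g (gamma s)) (cov T s).
Proof. by move=> Is; exact: (cov_jrot Do sg gs gp Io sgam ID Is sT). Qed.

(** Derivative of the constant |T|^2 = 1. *)
Lemma inner_cov_tangent s : I s -> inner (g (gamma s)) (cov T s) (T s) = 0.
Proof.
move=> Is; have dT := smooth_on_differentiable sT Is.
have := derive_inner_curve Do sg gs gp Io sgam ID Is dT dT.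
have -> : 'D_1 (fun s => inner (g (gamma s)) (T s) (T s)) s = 0.
  have E : {near s, (fun s => inner (g (gamma s)) (T s) (T s)) =1 (fun=> 1 : R)}.
    by apply: filterS (open_nbhs_nbhs (conj Io Is)) => t; exact: unit_speed.
  by rewrite (near_eq_derive _ E); exact: derive_cst.
rewrite [X in _ + X]innerC; last exact: gss.
by rewrite -/cov => /esym/eqP; rewrite -mulr2n mulrn_eq0/= => /eqP.
Qed.

(** The geodesic curvature kappa of [gamma]. *)
Definition normal_curvature s := inner (g (gamma s)) (cov T s) (N s).

Lemma cov_tangent s : I s -> cov T s = normal_curvature s *: N s.
Proof.
move=> Is; rewrite [LHS](frame_decomp (gss Is) (g0 Is) _ (unit_speed Is)).
by rewrite inner_cov_tangent// scale0r add0r.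
Qed.

Lemma smooth_on_normal_curvature : smooth_on I normal_curvature.
Proof.
apply: smooth_on_inner => //; first exact: (smooth_on_metric_curve Do sg Io sgam ID).
exact: (smooth_on_cov Do sg gs gp Io sgam ID).
Qed.

(* The induced metric is E ds^2 - 2 ds dt with this function E of s alone. *)
Definition normal_bundle_coef s := 2 * area (g (gamma s)) (cov Y s) (T s).

Lemma smooth_on_normal_bundle_coef : smooth_on I normal_bundle_coef.
Proof.
apply: smooth_onZ => //.
have sm : smooth_on I (fun s => area_mx (g (gamma s))).
  by apply: smooth_on_area_mx => //; exact: (smooth_on_metric_curve Do sg Io sgam ID).
have := smooth_on_inner Io sm (smooth_on_cov Do sg gs gp Io sgam ID sY) sT.
by apply: eq_smooth_on => // s _; rewrite inner_area_mx.
Qed.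

Section AtPoint.
Variable w : 'rV[R]_2.
Hypothesis Iw : strip I w.
Let s := w 0 0.
Let z := affine_normal_map w.

Let dgam : differentiable gamma s := smooth_on_differentiable sgam Iw.
Let dT : differentiable T s := smooth_on_differentiable sT Iw.
Let dN : differentiable N s := smooth_on_differentiable sN Iw.
Let dY : differentiable Y s := smooth_on_differentiable sY Iw.

Lemma affine_normal_map_domain : tangent_domain D z.
Proof. by rewrite /tangent_domain/= /z /affine_normal_map /ruled fst4K; exact: ID. Qed.

Let Dz := affine_normal_map_domain.

Lemma fst4_affine_normal_map : fst4 z = gamma s.
Proof. by rewrite /z /affine_normal_map /ruled fst4K. Qed.

Lemma affine_normal_map_differentiable : differentiable affine_normal_map w.
Proof. exact: smooth_on_differentiable smooth_on_affine_normal_map Iw. Qed.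

Lemma pd0_affine_normal_map :
  pd 0 affine_normal_map w = ruled T ('D_1 Y) ('D_1 N) w.
Proof.
rewrite /pd (derive_ruled _ dgam dY dN).2 !mxE/= !scale1r.
by rewrite [X in _ + X](_ : _ = 0) ?addr0// scale0r.
Qed.

Lemma pd1_affine_normal_map : pd 1 affine_normal_map w = pair4 0 (N s).
Proof.
rewrite /pd (derive_ruled _ dgam dY dN).2 !mxE/= !scale0r scale1r.
by rewrite add0r.
Qed.

End AtPoint.

Lemma pd1_pd0_affine_normal_map w : strip I w ->
  pd 1 (pd 0 affine_normal_map) w = pair4 0 ('D_1 N (w 0 0)).
Proof.
move=> Iw; have E : {near w, pd 0 affine_normal_map =1 ruled T ('D_1 Y) ('D_1 N)}.
  apply: filterS (open_nbhs_nbhs (conj (strip_open Io) Iw)) => u Iu.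
  exact: pd0_affine_normal_map.
rewrite {1}/pd (near_eq_derive _ E).
have dT : differentiable T (w 0 0) := smooth_on_differentiable sT Iw.
have dN : differentiable ('D_1 N) (w 0 0).
  exact: (smooth_on_differentiable sN1 Iw).
have dY : differentiable ('D_1 Y) (w 0 0).
  exact: (smooth_on_differentiable sY1 Iw).
by rewrite (derive_ruled _ dT dY dN).2 !mxE/= !scale0r scale1r add0r.
Qed.

Lemma pd_pd1_affine_normal_map i w : strip I w ->
  pd i (pd 1 affine_normal_map) w =
  pair4 0 ((delta_mx 0 i : 'rV[R]_2) 0 0 *: 'D_1 N (w 0 0)).
Proof.
move=> Iw; have E : {near w, pd 1 affine_normal_map =1 ruled (fun=> 0) N (fun=> 0)}.
  apply: filterS (open_nbhs_nbhs (conj (strip_open Io) Iw)) => u Iu.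
  by rewrite (pd1_affine_normal_map Iu) /ruled scaler0 addr0.
rewrite {1}/pd (near_eq_derive _ E).
have d0 : differentiable (fun=> 0 : 'rV[R]_2) (w 0 0) by exact: differentiable_cst.
have D0 : 'D_1 (fun=> 0 : 'rV[R]_2) (w 0 0) = 0 by exact: derive_cst.
have dN : differentiable N (w 0 0) := smooth_on_differentiable sN Iw.
by rewrite (derive_ruled _ d0 dN d0).2 D0 !scaler0 !addr0.
Qed.

Lemma Kmap_pd0 w : strip I w ->
  Kmap g (affine_normal_map w) (pd 0 affine_normal_map w) =
  cov Y (w 0 0) + w 0 1 *: cov N (w 0 0).
Proof.
move=> Iw; rewrite pd0_affine_normal_map// /Kmap /ruled !fst4K !snd4K.
rewrite christoffel_formDr christoffel_formZr /cov /covariant_derivative scalerDr.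
by rewrite -/T addrACA.
Qed.

Lemma area_normal_tangent s : I s -> area (g (gamma s)) (N s) (T s) = -1.
Proof. by move=> Is; rewrite area_jrot ?unit_speed//; [exact: gss|exact: g0]. Qed.

(** The ss-entry is 2 area(K X_s, T) with K X_s = cov Y + t cov N. Its t-part vanishes: cov N = j
    cov T, so area(cov N, T) = - g(cov T, T) = 0. This is why E depends on s alone. *)
Lemma affine_normal_metric w : strip I w ->
  [/\ induced_metric (GG g) affine_normal_map w 0 0 = normal_bundle_coef (w 0 0),
      induced_metric (GG g) affine_normal_map w 0 1 = -1,
      induced_metric (GG g) affine_normal_map w 1 0 = -1 &
      induced_metric (GG g) affine_normal_map w 1 1 = 0].
Proof.
move=> Iw; have dF := affine_normal_map_differentiable Iw.
have Dz := affine_normal_map_domain Iw.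
have fz := fst4_affine_normal_map w.
have f0 : fst4 (pd 0 affine_normal_map w) = T (w 0 0).
  by rewrite pd0_affine_normal_map// fst4K.
have [G01 G10] : inner (GG g (affine_normal_map w)) (pd 0 affine_normal_map w)
    (pd 1 affine_normal_map w) = -1 /\
    inner (GG g (affine_normal_map w)) (pd 1 affine_normal_map w)
    (pd 0 affine_normal_map w) = -1.
  rewrite [X in X = _ /\ _](inner_GGC gs gp)// pd1_affine_normal_map//.
  by rewrite (inner_GG_vert gs gp)// fz f0 area_normal_tangent.
split; rewrite (induced_metricE _ _ _ dF).
- rewrite (inner_GG gs gp _ _ Dz) (Kmap_pd0 Iw) fz f0 areaD areaZ (cov_normal Iw).
  rewrite -(inner_jrot (gss Iw) (g0 Iw) (jrot _ _)) (jrotK (gss Iw) (g0 Iw)).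
  rewrite innerN (inner_cov_tangent Iw) oppr0 mulr0 addr0.
  by rewrite /normal_bundle_coef -mulr2n mulr_natl.
- exact: G01.
- exact: G10.
- rewrite (pd1_affine_normal_map Iw) (inner_GG_vert gs gp _ _ Dz) fst4K.
  exact: area0r.
Qed.

Lemma affine_normal_metric_inv w : strip I w ->
  induced_metric (GG g) affine_normal_map w \in unitmx /\
  [/\ invmx (induced_metric (GG g) affine_normal_map w) 0 0 = 0,
      invmx (induced_metric (GG g) affine_normal_map w) 0 1 = -1,
      invmx (induced_metric (GG g) affine_normal_map w) 1 0 = -1 &
      invmx (induced_metric (GG g) affine_normal_map w) 1 1 =
        - normal_bundle_coef (w 0 0)].
Proof.
move=> Iw; have [h00 h01 h10 h11] := affine_normal_metric Iw.
move: (induced_metric _ _ _) h00 h01 h10 h11 => h h00 h01 h10 h11.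
pose k : 'M[R]_2 := \matrix_(i, j) (if (i == 0) && (j == 0) then 0
  else if (i == 1) && (j == 1) then - normal_bundle_coef (w 0 0) else -1).
have hk : h *m k = 1%:M.
  apply/matrixP; apply: ord2P; apply: ord2P; rewrite !(mxE, sum2)/= ?h00 ?h01 ?h10 ?h11.
  - by ring.
  - by ring.
  - by ring.
  - by ring.
have [hu _] := mulmx1_unit hk; split=> //.
have -> : invmx h = k by apply: (can_inj (mulKmx hu)); rewrite mulmxV// hk.
by rewrite !mxE.
Qed.

Lemma affine_normal_mean_curvature w : strip I w ->
  mean_curvature (GG g) affine_normal_map w =
  pair4 0 (- jrot (g (gamma (w 0 0))) (cov T (w 0 0))).
Proof.
move=> Iw; have dF := affine_normal_map_differentiable Iw.
have Dz := affine_normal_map_domain Iw.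
have fz := fst4_affine_normal_map w.
have f0 : fst4 (pd 0 affine_normal_map w) = T (w 0 0).
  by rewrite (pd0_affine_normal_map Iw) fst4K.
have p1 := pd1_affine_normal_map Iw.
have [hu [k00 k01 k10 k11]] := affine_normal_metric_inv Iw.
set A := jrot _ _.
(* The vector (0, A) is already normal: it pairs with X_s to area(A, T) = - g(cov T, T) = 0, and
   with the vertical X_t to 0. *)
have nA : normal_part (GG g) affine_normal_map w (pair4 0 A) = pair4 0 A.
  apply: normal_part_normal; apply: ord2P; rewrite (row_jacobian _ dF).
    rewrite (inner_GG_vert gs gp _ _ Dz) f0 fz /A.
    rewrite -(inner_jrot (gss Iw) (g0 Iw)) (jrotK (gss Iw) (g0 Iw)) innerN.
    by rewrite (inner_cov_tangent Iw) oppr0.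
  by rewrite p1 (inner_GG_vert gs gp _ _ Dz) fst4K area0r.
have c01 : christoffel_form (GG g) (affine_normal_map w)
    (pd 0 affine_normal_map w) (pd 1 affine_normal_map w) =
    pair4 0 (christoffel_form g (gamma (w 0 0)) (T (w 0 0)) (N (w 0 0))).
  by rewrite p1 (christoffel_GG_vert Do sg gs gp _ _ Dz) fz f0.
have AE : pair4 0 ('D_1 N (w 0 0)) +
    pair4 0 (christoffel_form g (gamma (w 0 0)) (T (w 0 0)) (N (w 0 0))) = pair4 0 A.
  rewrite /A -(cov_normal Iw) /cov /covariant_derivative.
  by rewrite pair4D addr0.
have s01 : second_fundamental_form (GG g) affine_normal_map w 0 1 = pair4 0 A.
  rewrite /second_fundamental_form (pd_pd1_affine_normal_map 0 Iw) c01.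
  by rewrite mxE/= scale1r AE.
have s10 : second_fundamental_form (GG g) affine_normal_map w 1 0 = pair4 0 A.
  rewrite /second_fundamental_form (pd1_pd0_affine_normal_map Iw).
  by rewrite (christoffel_GG_sym Do sg gs gp _ _ Dz) c01 AE.
(* The rulings are straight lines in the fibres, and the Christoffel form of [GG] vanishes on two
   vertical vectors. *)
have s11 : second_fundamental_form (GG g) affine_normal_map w 1 1 = 0.
  rewrite /second_fundamental_form (pd_pd1_affine_normal_map 1 Iw) p1.
  rewrite (christoffel_GG_vert Do sg gs gp _ _ Dz) fst4K christoffel_form0.
  rewrite mxE/= scale0r pair4D addr0 pair40.
  by rewrite -[X in normal_part _ _ _ X](scale0r 0) normal_partZ scale0r.
rewrite mean_curvature2E; move: k00 k01 k10 k11 s01 s10 s11.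
generalize (second_fundamental_form (GG g) affine_normal_map w)
  (invmx (induced_metric (GG g) affine_normal_map w)).
move=> sf hi -> -> -> -> -> -> ->.
rewrite scale0r add0r scaler0 addr0 !scaleN1r -opprD scalerN.
have -> : pair4 0 A + pair4 0 A = 2 *: pair4 0 A by rewrite scaler_nat mulr2n.
rewrite scalerA mulVf ?pnatr_eq0// scale1r.
by rewrite pair4N oppr0.
Qed.

Lemma affine_normal_JJ w : strip I w ->
  JJ g (affine_normal_map w) (mean_curvature (GG g) affine_normal_map w) =
  normal_curvature (w 0 0) *: pd 1 affine_normal_map w.
Proof.
move=> Iw; rewrite (affine_normal_mean_curvature Iw) /JJ Kmap_vert /Pmap.
rewrite fst4_affine_normal_map fst4K jrot0 christoffel_form0 subr0.
rewrite -scaleN1r jrotZ (jrotK (gss Iw) (g0 Iw)) scaleN1r opprK.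
rewrite (cov_tangent Iw) (pd1_affine_normal_map Iw).
by rewrite pair4Z scaler0.
Qed.

End AffineNormalBundle.

(** * Flat metrics *)

(* In the coordinates phi the metric h is the constant matrix C. *)
Section FlatMetric.
Context {R : realType} {n : nat}.
Variables (h : 'rV[R]_n -> 'M[R]_n) (U : set 'rV[R]_n) (phi : 'rV[R]_n -> 'rV[R]_n)
  (C : 'M[R]_n).
Hypotheses (Uo : open U) (sphi : smooth_on U phi) (Cs : C^T = C) (Cu : C \in unitmx)
  (Ju : forall u, U u -> 'J phi u \in unitmx)
  (hE : forall u, U u -> h u = 'J phi u *m C *m ('J phi u)^T).

Let dphi u : U u -> differentiable phi u.
Proof. by move=> Uu; exact: smooth_on_differentiable sphi Uu. Qed.

Let sd v : smooth_on U ('D_v phi).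
Proof. exact: smooth_on_derive. Qed.

Lemma derive_swap_rV p (f : 'rV[R]_n -> 'rV[R]_p) u v w : U u -> smooth_on U f ->
  'D_v ('D_w f) u = 'D_w ('D_v f) u.
Proof.
move=> Uu sf; apply/rowP => i.
have sfi : smooth_on U (fun y => f y 0 i) by exact: (smooth_on_rVP _ Uo).1 sf i.
have E x : {in U, (fun y => 'D_x f y 0 i) =1 'D_x (fun y => f y 0 i)}.
  move=> y /set_mem Uy; apply: derive_rVE.
  exact: (smooth_on_differentiable sf Uy).
have F x x' : 'D_x ('D_x' f) u 0 i = 'D_x ('D_x' (fun y => f y 0 i)) u.
  rewrite (derive_rVE _ _ (smooth_on_differentiable (smooth_on_derive x' sf) Uu)).
  exact: (near_eq_derive_on x Uo (E x') (mem_set Uu)).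
apply: etrans (F v w) _; apply: etrans _ (esym (F w v)).
exact: (derive_swap v w Uo Uu (sfi 2%N)).
Qed.

Lemma flat_inner u v w : U u -> inner (h u) v w = inner C ('D_v phi u) ('D_w phi u).
Proof.
move=> Uu; rewrite (hE Uu) /inner !(deriveEjacobian _ (dphi Uu)) trmx_mul.
by rewrite !mulmxA.
Qed.

Lemma flat_smooth : smooth_on U h.
Proof.
have sJ := smooth_on_jacobian Uo sphi.
have sJt : smooth_on U (fun u => ('J phi u)^T).
  apply/smooth_on_mxP => // i j.
  by apply: eq_smooth_on ((smooth_on_mxP _ Uo).1 sJ j i) => // u _; rewrite [RHS]mxE.
have := smooth_on_mulmx Uo (smooth_on_mulmx Uo sJ (smooth_on_cst U C)) sJt.
by apply: eq_smooth_on => // u /set_mem Uu; rewrite hE.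
Qed.

Lemma flat_unit u : U u -> h u \in unitmx.
Proof. by move=> Uu; rewrite hE// !unitmx_mul unitmx_tr Cu Ju. Qed.

Lemma flat_derive_inner u x v w : U u ->
  'D_x (fun y => inner (h y) v w) u =
  inner C ('D_x ('D_v phi) u) ('D_w phi u) + inner C ('D_v phi u) ('D_x ('D_w phi) u).
Proof.
move=> Uu; have dv y : differentiable ('D_y phi) u.
  exact: smooth_on_differentiable (sd y) Uu.
have E : {near u, (fun y => inner (h y) v w) =1
    (fun y => inner C ('D_v phi y) ('D_w phi y))}.
  by apply: filterS (open_nbhs_nbhs (conj Uo Uu)) => y; exact: flat_inner.
rewrite (near_eq_derive _ E).
have dC : differentiable (fun=> C) u by exact: differentiable_cst.
have [_ ->] := derive_innerE x dC (dv v) (dv w).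
by rewrite [X in X + _ + _](_ : _ = 0) ?add0r//; exact: derive_cst.
Qed.

(** By [flat_derive_inner] the Koszul expression has six terms in the second derivatives of [phi];
    symmetry of these cancels four and leaves 2 C(D_v D_w phi, D_x phi). *)
Lemma flat_christoffel_form u v w : U u ->
  christoffel_form h u v w = 'D_v ('D_w phi) u *m invmx ('J phi u).
Proof.
move=> Uu.
have [d1 d1E] : exists d1, forall x, 'D_x phi u = d1 x by eexists.
have [d2 d2E] : exists d2, forall x y, 'D_x ('D_y phi) u = d2 x y by eexists.
have d2C x y : d2 x y = d2 y x.
  by apply: etrans (esym (d2E x y)) _; apply: etrans _ (d2E y x); exact: derive_swap_rV.
have K x y z : 'D_x (fun y' => inner (h y') y z) u =
    inner C (d2 x y) (d1 z) + inner C (d1 y) (d2 x z).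
  by apply: etrans (flat_derive_inner x y z Uu) _; rewrite !d1E (d2E x y) (d2E x z).
have L x : inner (h u) ('D_v ('D_w phi) u *m invmx ('J phi u)) x =
    inner C (d2 v w) (d1 x).
  apply: etrans (flat_inner _ _ Uu) _.
  rewrite (deriveEjacobian _ (dphi Uu)) (mulmxKV (Ju Uu)) d1E.
  by rewrite (d2E v w).
have dh := smooth_on_differentiable flat_smooth Uu.
have hs : (h u)^T = h u by rewrite (hE Uu) !trmx_mul trmxK Cs mulmxA.
apply: koszul_unique; [exact: dh|exact: hs|exact: flat_unit|move=> x].
apply: etrans (congr1 ( *%R 2) (L x)) _.
rewrite (K v w x) (K w v x) (K x v w) (d2C w v) (d2C x v) (d2C x w).
rewrite (inner_sym (d2 v x) _ Cs).
by move: (inner C _ _) (inner C _ _) (inner C _ _) => p q r; ring.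
Qed.

Lemma christoffel_formE u k i j :
  christoffel_form h u (delta_mx 0 i) (delta_mx 0 j) 0 k = christoffel h u k i j.
Proof.
rewrite mxE (bigD1 i)//= (bigD1 j)//= !mxE !eqxx !mulr1.
rewrite big1 ?addr0; last by move=> j' /negbTE jj; rewrite !mxE eqxx/= jj mulr0.
rewrite big1 ?addr0// => i' /negbTE ii; rewrite big1// => j' _.
by rewrite !mxE eqxx/= ii mulr0 mul0r.
Qed.

(** The components of [phi] are affine functions for the connection, so their Hessians vanish. *)
Lemma flat_pd2 u i j : U u ->
  pd i (pd j phi) u = \sum_k christoffel h u k i j *: pd k phi u.
Proof.
move=> Uu; transitivity (christoffel_form h u (delta_mx 0 i) (delta_mx 0 j) *m 'J phi u).
  by apply/esym; rewrite (flat_christoffel_form _ _ Uu) (mulmxKV (Ju Uu)).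
rewrite mulmx_sum_row; apply: eq_bigr => k _.
by rewrite christoffel_formE (row_jacobian k (dphi Uu)).
Qed.

Lemma frame_inj u (r : 'I_n -> R) : U u -> \sum_k r k *: pd k phi u = 0 ->
  forall k, r k = 0.
Proof.
move=> Uu; have -> : \sum_k r k *: pd k phi u = (\row_k r k) *m 'J phi u.
  rewrite mulmx_sum_row; apply: eq_bigr => k _.
  by rewrite mxE (row_jacobian k (dphi Uu)).
move=> /(congr1 (mulmx^~ (invmx ('J phi u)))); rewrite mulmxK ?Ju// mul0mx.
by move=> /rowP r0 k; have := r0 k; rewrite !mxE.
Qed.

Let schr k i j : smooth_on U (fun y => christoffel h y k i j).
Proof. exact: (smooth_on_christoffel k i j Uo flat_smooth flat_unit). Qed.

(** In the frame d_k phi, ordinary differentiation of a combination becomes covariant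
    differentiation of its coefficients. *)
Lemma derive_frame_sum u (f : 'I_n -> 'rV[R]_n -> R) (F : 'rV[R]_n -> 'rV[R]_n) i :
  U u -> (forall k, differentiable (f k) u) ->
  {near u, F =1 (fun y => \sum_k f k y *: pd k phi y)} ->
  pd i F u = \sum_k (pd i (f k) u + \sum_m f m u * christoffel h u k i m) *: pd k phi u.
Proof.
move=> Uu df FE; rewrite {1}/pd (near_eq_derive _ FE).
have dp k : differentiable ('D_(delta_mx 0 k) phi) u.
  exact: smooth_on_differentiable (sd _) Uu.
have ds k := derive_scaleE (delta_mx 0 i) (df k) (dp k).
rewrite derive_sumE => [|k]; last exact: (ds k).1.
transitivity (\sum_k (pd i (f k) u *: pd k phi u + f k u *: pd i (pd k phi) u)).
  by apply: eq_bigr => k _; rewrite (ds k).2.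
rewrite big_split/=; under [X in _ + X]eq_bigr do rewrite flat_pd2// scaler_sumr.
rewrite exchange_big/= -big_split/=; apply: eq_bigr => k _.
by rewrite scalerDl scaler_suml; congr (_ + _); apply: eq_bigr => m _; rewrite scalerA.
Qed.

(** The components of the curvature are the coefficients, in the frame d_l phi, of d_i d_j d_k phi -
    d_j d_i d_k phi, which is 0. *)
Lemma flat_curvature u l k i j : U u -> curvature h u l k i j = 0.
Proof.
move=> Uu.
have D3 a b : pd a (pd b (pd k phi)) u = \sum_l
    (pd a (fun y => christoffel h y l b k) u +
     \sum_m christoffel h u m b k * christoffel h u l a m) *: pd l phi u.
  apply: (@derive_frame_sum u (fun l y => christoffel h y l b k)) => //.
    by move=> m; exact: smooth_on_differentiable (schr _ _ _) Uu.
  by apply: filterS (open_nbhs_nbhs (conj Uo Uu)) => y; exact: flat_pd2.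
have E : pd i (pd j (pd k phi)) u = pd j (pd i (pd k phi)) u.
  exact: (derive_swap_rV _ _ Uu (sd _)).
have S0 : \sum_l curvature h u l k i j *: pd l phi u = 0.
  apply/eqP; move/eqP: E; rewrite -subr_eq0 !D3 -sumrB; apply: contraTT => /negP nz.
  apply/negP => /eqP z; apply: nz; apply/eqP; rewrite -[RHS]z.
  apply: eq_bigr => m _; rewrite -scalerBl; congr (_ *: _).
  rewrite /curvature opprD addrACA -sumrB; congr (_ + _).
  by apply: eq_bigr => p _; rewrite mulrC [X in _ - X]mulrC.
exact: (frame_inj Uu S0).
Qed.

(* In the coordinates phi, the field Z is k e_b and k depends only on the a-th
   coordinate. *)
Lemma flat_divergence u (Z : 'rV[R]_n -> 'rV[R]_n) (k : 'rV[R]_n -> R) (a b : 'I_n)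
    (c : R) : U u -> a != b -> differentiable k u ->
  (forall i, pd i k u = c * 'J phi u i a) ->
  {near u, forall y, Z y *m 'J phi y = k y *: delta_mx 0 b} ->
  divergence h Z u = 0.
Proof.
move=> Uu ab dk kE ZE.
(* [Z] is known only through its product with the Jacobian and only near u; [Z'] is its closed form,
   visibly differentiable at u. *)
pose Z' y := k y *: (delta_mx 0 b : 'rV[R]_n) *m invmx ('J phi y).
have nU : {near u, forall y, U y} by exact: (open_nbhs_nbhs (conj Uo Uu)).
have ZZ : {near u, Z =1 Z'}.
  apply: filterS (filterI nU ZE) => y [Uy Zy]; rewrite /Z' -Zy mulmxK//.
  exact: Ju.
have sJi := smooth_on_invmx Uo Ju (smooth_on_jacobian Uo sphi).
have dZ'i i : differentiable (fun y => Z' y 0 i) u.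
  have -> : (fun y => Z' y 0 i) = (fun y => k y * invmx ('J phi y) b i).
    by apply/funext => y; rewrite /Z' -scalemxAl -rowE !mxE.
  apply: differentiable_mulE => //.
  exact: (smooth_on_differentiable ((smooth_on_mxP _ Uo).1 sJi b i) Uu).
have DZ i j : pd j (fun y => Z y 0 i) u = pd j (fun y => Z' y 0 i) u.
  by apply: near_eq_derive; apply: filterS ZZ => y ->.
have FE : {near u, (fun y => k y *: (delta_mx 0 b : 'rV[R]_n)) =1
    (fun y => \sum_m Z' y 0 m *: pd m phi y)}.
  apply: filterS nU => y Uy.
  have -> : k y *: (delta_mx 0 b : 'rV[R]_n) = Z' y *m 'J phi y.
    by rewrite /Z' mulmxKV// Ju.
  rewrite mulmx_sum_row; apply: eq_bigr => m _.
  by rewrite (row_jacobian m (dphi Uy)).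
have D i : (pd i k u *: (delta_mx 0 b : 'rV[R]_n)) = \sum_m (pd i (fun y => Z' y 0 m) u +
    \sum_p Z' u 0 p * christoffel h u m i p) *: pd m phi u.
  rewrite -(derive_frame_sum i Uu dZ'i FE) /pd.
  have dc : differentiable (fun=> (delta_mx 0 b : 'rV[R]_n)) u by exact: differentiable_cst.
  have [_ ->] := derive_scaleE (delta_mx 0 i) dk dc.
  by rewrite [X in _ + _ *: X](_ : _ = 0) ?scaler0 ?addr0//; exact: derive_cst.
(* The covariant derivative of the field in the direction i; the divergence is the trace of these
   rows. *)
pose r i := \row_m (pd i (fun y => Z' y 0 m) u + \sum_p Z' u 0 p * christoffel h u m i p).
have rE i : r i = pd i k u *: (delta_mx 0 b : 'rV[R]_n) *m invmx ('J phi u).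
  rewrite D -[LHS](mulmxK (Ju Uu)); congr (_ *m _); rewrite mulmx_sum_row.
  by apply: eq_bigr => m _; rewrite mxE (row_jacobian m (dphi Uu)).
transitivity (\sum_i r i 0 i).
  rewrite /divergence; apply: eq_bigr => i _; rewrite mxE DZ; congr (_ + _).
  by apply: eq_bigr => p _; rewrite (nbhs_singleton ZZ) mulrC.
(* As dk = c d(phi_a), the trace is c times an off-diagonal entry of the identity. *)
transitivity (c * (invmx ('J phi u) *m 'J phi u) b a).
  rewrite mxE mulr_sumr; apply: eq_bigr => i _.
  have Erow (A : 'M[R]_n) x : (x *: row b A) 0 i = x * A b i by rewrite !mxE.
  rewrite rE kE -scalemxAl -rowE Erow.
  by move: (invmx _ _ _) ('J phi u i a) => p q; ring.
by rewrite mulVmx ?Ju// mxE eq_sym (negbTE ab) mulr0.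
Qed.

End FlatMetric.

(** * Local form of rank one Lagrangian surfaces *)

Section Points.
Context {R : realType}.

(** The point (p, q), written so that for fixed [q] it is literally the line of [is_derive_line]
    with parameter [p]. *)
Definition pt (p q : R) : 'rV[R]_2 := q *: delta_mx 0 1 + p *: delta_mx 0 0.

Lemma pt0 p q : pt p q 0 0 = p. Proof. by rewrite !mxE/=; ring. Qed.

Lemma pt1 p q : pt p q 0 1 = q. Proof. by rewrite !mxE/=; ring. Qed.

Lemma ball_rV2P (c w : 'rV[R]_2) (r : R) : 0 < r ->
  ball c r w <-> ball (c 0 0) r (w 0 0) /\ ball (c 0 1) r (w 0 1).
Proof.
move=> r0; split=> [[_ cw]|[h0 h1]]; first by split; exact: cw.
by split=> // i; rewrite ord1; exact: ord2P.
Qed.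

Lemma smooth_on_pt (I : set R) q : open I -> smooth_on I (pt^~ q).
Proof.
move=> Io; apply: smooth_onD => //; first exact: smooth_on_cst.
apply: smooth_on_scale => //; first exact: smooth_on_id.
exact: smooth_on_cst.
Qed.

(** Balls of the maximum norm are squares, so the segment from w to the horizontal line through the
    centre stays inside. *)
Lemma const_in_second_scalar (f : 'rV[R]_2 -> R) (c : 'rV[R]_2) (r : R) : 0 < r ->
  (forall w, ball c r w -> differentiable f w /\ 'D_(delta_mx 0 1) f w = 0) ->
  forall w, ball c r w -> f w = f (pt (w 0 0) (c 0 1)).
Proof.
move=> r0 fP w wb; have [w0 w1] := (ball_rV2P _ _ r0).1 wb.
pose p := pt (w 0 0) (c 0 1).
have wE : w = p + (w 0 1 - c 0 1) *: delta_mx 0 1.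
  by apply: rowP2; rewrite /p !mxE/=; ring.
apply: etrans (congr1 f wE) _.
apply: derive_eq0_line => t /andP[t0 t1].
have tb : ball c r (p + t *: ((w 0 1 - c 0 1) *: delta_mx 0 1)).
  apply/ball_rV2P => //; split.
    by rewrite (_ : (p + _) 0 0 = w 0 0)// /p !mxE/=; ring.
  rewrite (_ : (p + _) 0 1 = c 0 1 + t * (w 0 1 - c 0 1)); last first.
    by rewrite /p !mxE/=; ring.
  move: w1; rewrite -!ball_normE/= opprD addrA subrr sub0r normrN normrM => w1.
  rewrite ger0_norm//; apply: le_lt_trans w1.
  by rewrite distrC ler_piMl.
exact: fP.
Qed.

Lemma const_in_second n (f : 'rV[R]_2 -> 'rV[R]_n) (c : 'rV[R]_2) (r : R) : 0 < r ->
  (forall w, ball c r w -> differentiable f w /\ 'D_(delta_mx 0 1) f w = 0) ->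
  forall w, ball c r w -> f w = f (pt (w 0 0) (c 0 1)).
Proof.
move=> r0 fP w wb; apply/rowP => i.
apply: (@const_in_second_scalar (fun y => f y 0 i) c r r0 _ w wb) => {}w {}wb.
have [df Df] := fP _ wb; split; first exact: (differentiable_rVP f _).1.
by rewrite -(derive_rVE _ _ df) Df mxE.
Qed.

(** If v A were nonzero it would span the row space, and every row of [A] would vanish at k. *)
Lemma rank1_kernel m n (A : 'M[R]_(m, n)) (v : 'rV[R]_m) i k :
  \rank A = 1%N -> A i k != 0 -> (v *m A) 0 k = 0 -> v *m A = 0.
Proof.
move=> rA Aik vk; apply/eqP; apply: contraT => vA.
have sA : (v *m A <= A)%MS by exact: submxMl.
have := mxrank_leqif_sup sA; rewrite rA rank_rV vA => -[_ /esym/eqP].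
rewrite eqxx => /eqP; move=> /row_subP/(_ i)/submxP[B BE].
have := congr1 (fun r : 'rV[R]_n => r 0 k) BE.
rewrite [LHS]mxE => h; move: Aik; rewrite h mxE big_ord1 vk mulr0 eqxx.
by [].
Qed.

End Points.

(** * Images of maps of rank one *)

Section RankOneCurve.
Context {R : realType}.

Lemma open_preimage_on (V W : topologicalType) (U : set V) (B : set W) (f : V -> W) :
  open U -> open B -> (forall x, U x -> {for x, continuous f}) ->
  open (U `&` f @^-1` B).
Proof.
move=> Uo Bo fc; rewrite openE => x [Ux Bx]; rewrite /interior.
apply: filterI; first exact: open_nbhs_nbhs.
by apply: (fc _ Ux); exact: open_nbhs_nbhs.
Qed.

Lemma rank_gt0_entry m n (A : 'M[R]_(m, n)) : \rank A = 1%N ->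
  exists i k, A i k != 0.
Proof.
move=> rA; apply/not_existsP => h; have A0 : A = 0.
  apply/matrixP => i k; rewrite [RHS]mxE; apply/eqP; apply: contraT => Aik.
  by exfalso; apply: (h i); exists k.
by move: rA; rewrite A0 mxrank0.
Qed.

(** A component x_k of nonzero differential is completed by a linear function l to local
    coordinates. Along the second coordinate x_k is constant, and rank one makes all of x constant;
    [f] is x on the line l = l(u0), parametrized by x_k. *)
Lemma rank_one_curve (U : set 'rV[R]_2) (x : 'rV[R]_2 -> 'rV[R]_2) u0 :
  open U -> U u0 -> smooth_on U x -> (forall u, U u -> \rank ('J x u) = 1%N) ->
  exists (k : 'I_2) (r : R) (f : R -> 'rV[R]_2) (U2 : set 'rV[R]_2),
    [/\ 0 < r, smooth_on (ball (x u0 0 k) r) f, open U2, U2 u0 &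
      [/\ forall u, U2 u -> [/\ U u, ball (x u0 0 k) r (x u 0 k) & x u = f (x u 0 k)],
      forall p, ball (x u0 0 k) r p -> f p 0 k = p &
      forall p, ball (x u0 0 k) r p -> exists2 u, U u & f p = x u]].
Proof.
move=> Uo Uu0 sx rx.
have [i [k Aik]] := rank_gt0_entry (rx _ Uu0).
have dx u : U u -> differentiable x u by move=> Uu; exact: smooth_on_differentiable sx Uu.
have dxk u : U u -> differentiable (fun y => x y 0 k) u.
  by move=> Uu; exact: (differentiable_rVP x u).1 (dx _ Uu) k.
pose c j := 'J x u0 j k.
(* With this second coordinate the Jacobian determinant of (x_k, l) at u0 is
   the squared norm of the gradient of x_k. *)
pose l (u : 'rV[R]_2) := c 0 * u 0 1 - c 1 * u 0 0.
pose Phi u := pt (x u 0 k) (l u).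
have sxk : smooth_on U (fun u => x u 0 k) by exact: (smooth_on_rVP _ Uo).1.
have sl : smooth_on U l.
  by apply: smooth_onB => //; apply: smooth_onM => //;
    [exact: smooth_on_cst|exact: smooth_on_coord|exact: smooth_on_cst|exact: smooth_on_coord].
have sPhi : smooth_on U Phi.
  apply/smooth_on_rVP => //; apply: ord2P.
    by apply: eq_smooth_on sxk => // u _; rewrite pt0.
  by apply: eq_smooth_on sl => // u _; rewrite pt1.
have dPhi u : U u -> differentiable Phi u.
  by move=> Uu; exact: smooth_on_differentiable sPhi Uu.
have P0 : (fun y => Phi y 0 0) = (fun y => x y 0 k).
  by apply/funext => y; exact: pt0.
have JPhi0 u j : U u -> 'J Phi u j 0 = 'J x u j k.
  move=> Uu; apply: etrans (jacobianE _ _ (dPhi _ Uu)) _.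
  by apply: etrans _ (esym (jacobianE _ _ (dx _ Uu))); rewrite P0.
have JPhi1 u (j : 'I_2) : U u -> 'J Phi u j 1 =
    c 0 * (delta_mx 0 j : 'rV[R]_2) 0 1 - c 1 * (delta_mx 0 j : 'rV[R]_2) 0 0.
  move=> Uu; rewrite (jacobianE _ _ (dPhi _ Uu)) /pd.
  have -> : (fun y => Phi y 0 1) = l by apply/funext => y; rewrite pt1.
  have dc (b : R) : differentiable (fun=> b : R) u by exact: differentiable_cst.
  have Dc (b : R) v : 'D_v (fun=> b : R) u = 0 by exact: derive_cst.
  have d0 := differentiable_coord_rV u 0; have d1 := differentiable_coord_rV u 1.
  rewrite (derive_subE _ (differentiable_mulE (dc (c 0)) d1)
    (differentiable_mulE (dc (c 1)) d0)).
  rewrite (derive_mulE _ (dc (c 0)) d1) (derive_mulE _ (dc (c 1)) d0) !Dc !mulr0 !addr0.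
  by rewrite !derive_coord.
have Ju0 : 'J Phi u0 \in unitmx.
  have [J0 J1] := (JPhi0 u0 ^~ Uu0, JPhi1 u0 ^~ Uu0).
  have dE : \det ('J Phi u0) = c 0 * c 0 + c 1 * c 1.
    move: J0 J1; generalize ('J Phi u0) => A J0 J1.
    by rewrite det2 !J0 !J1 -/(c 0) -/(c 1) !mxE/=; move: (c 0) (c 1) => p q; ring.
  rewrite unitmxE unitfE dE.
  have h : 0 < c 0 * c 0 + c 1 * c 1.
    rewrite -!expr2 lt_neqAle addr_ge0 ?sqr_ge0// andbT eq_sym paddr_eq0 ?sqr_ge0//.
    rewrite !sqrf_eq0; apply/negP => /andP[/eqP c0 /eqP c1].
    by move: Aik; elim/ord2P: i; rewrite -/(c _) ?c0 ?c1 eqxx.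
  by move: h; rewrite lt0r => /andP[].
have [r [chi [r0 chi0 schi Wo chiP]]] := inverse_function Uo Uu0 sPhi Ju0.
have chiE w : ball (Phi u0) r w -> x (chi w) 0 k = w 0 0.
  by move=> /chiP[_ + _] => /(congr1 (fun v : 'rV[R]_2 => v 0 0)); rewrite pt0.
have cst w : ball (Phi u0) r w -> x (chi w) = x (chi (pt (w 0 0) (Phi u0 0 1))).
  apply: (@const_in_second _ _ (x \o chi) (Phi u0) r r0) => {}w wb.
  have [Uc Pc Jc] := chiP _ wb.
  have dchi : differentiable chi w by exact: smooth_on_differentiable schi wb.
  split; first exact: differentiable_comp (dx _ Uc).
  rewrite derive_comp//; last exact: dx.
  rewrite deriveEjacobian; last exact: dx.
  set v := 'D_ _ chi w.
  have vJ : v *m 'J Phi (chi w) = delta_mx 0 1.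
    rewrite -deriveEjacobian; last exact: dPhi.
    apply: etrans (esym (@derive_comp _ _ _ _ Phi chi w (delta_mx 0 1) dchi (dPhi _ Uc))) _.
    have E : {near w, (Phi \o chi) =1 id}.
      have nb : nbhs w (ball (Phi u0) r).
        by apply: open_nbhs_nbhs; split=> //; exact: ball_open.
      by apply: filterS nb => y /chiP[].
    by apply: etrans (near_eq_derive _ E) _; exact: derive_id.
  (* Column 0 of the invertible Jacobian of [Phi] is column k of that of [x], so it does not vanish
     and [rank1_kernel] applies. *)
  have [i' Ai'] : exists i', 'J x (chi w) i' k != 0.
    apply/not_existsP => h; move: Jc; rewrite unitmxE unitfE.
    have h0 j : 'J Phi (chi w) j 0 = 0.
      by rewrite (JPhi0 _ j Uc); apply/eqP; apply: contraT => /h.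
    by move: h0; generalize ('J Phi (chi w)) => A A0; rewrite det2 !A0 mulr0 mul0r subrr eqxx.
  apply: (rank1_kernel (rx _ Uc) Ai').
  have v0 : (v *m 'J Phi (chi w)) 0 0 = 0 by rewrite vJ mxE.
  apply: etrans _ v0; rewrite [LHS]mxE [RHS]mxE; apply: eq_bigr => j _.
  exact: (congr1 ( *%R (v 0 j)) (esym (JPhi0 _ j Uc))).
have b0 p : ball (x u0 0 k) r p -> ball (Phi u0) r (pt p (Phi u0 0 1)).
  move=> pb; apply/ball_rV2P => //; rewrite pt0 pt1 /Phi pt0; split=> //.
  exact: ballxx.
exists k, r, (fun p => x (chi (pt p (Phi u0 0 1)))), (chi @` ball (Phi u0) r).
split=> //.
- have Ir : open (ball (x u0 0 k) r) by exact: ball_open.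
  have s1 : smooth_on (ball (Phi u0) r) (x \o chi).
    apply: (smooth_on_comp _ Uo _ sx schi); first exact: ball_open.
    by move=> w /chiP[].
  apply: (@smooth_on_comp _ _ _ _ _ _ (ball (Phi u0) r) (x \o chi)
    (pt^~ (Phi u0 0 1)) Ir _ b0 s1); first exact: ball_open.
  exact: smooth_on_pt.
- by exists (Phi u0) => //; exact: ballxx.
- split.
  + move=> _ [w wb <-]; have [Uc _ _] := chiP _ wb; rewrite chiE//; split=> //.
      by have [+ _] := (ball_rV2P _ _ r0).1 wb; rewrite /Phi pt0.
    exact: cst.
  + by move=> p pb; rewrite chiE ?pt0//; exact: b0.
  + by move=> p /b0 /chiP[Uc _ _]; exists (chi (pt p (Phi u0 0 1))).
Qed.

End RankOneCurve.

(** * Lagrangian surfaces in a frame adapted to the base curve *)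

Section RankOneLagrangian.
Context {R : realType}.

Lemma derive_inner_frozen (V : normedModType R) (g : 'rV[R]_2 -> 'M[R]_2)
    (x y : V -> 'rV[R]_2) (p : V -> R) (T : R -> 'rV[R]_2) u v :
  differentiable x u -> differentiable g (x u) -> differentiable y u ->
  differentiable p u -> differentiable T (p u) ->
  'D_v x u = 0 -> 'D_v p u = 0 ->
  'D_v (fun u => inner (g (x u)) (y u) (T (p u))) u =
  inner (g (x u)) ('D_v y u) (T (p u)).
Proof.
move=> dx dg dy dp dT x0 p0.
have dgx : differentiable (fun u => g (x u)) u by exact: (differentiable_comp dx dg).
have dTp : differentiable (fun u => T (p u)) u by exact: (differentiable_comp dp dT).
have [_ ->] := derive_innerE v dgx dy dTp.
have -> : 'D_v (fun u => T (p u)) u = 0.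
  by apply: etrans (derive_comp_R v dp dT) _; rewrite p0 scale0r.
have -> : 'D_v (fun y' => inner (g (x y')) (y u) (T (p u))) u = 0.
  have di := differentiable_inner (y u) (T (p u)) dg.
  apply: etrans (derive_comp (f := fun z => inner (g z) (y u) (T (p u))) v dx di) _.
  by rewrite x0 derive0.
by rewrite add0r [X in _ + X](_ : _ = 0) ?addr0// inner2 !mxE; ring.
Qed.

Variables (g : 'rV[R]_2 -> 'M[R]_2) (D : set 'rV[R]_2).
Hypotheses (Do : open D) (sg : smooth_on D g)
  (gs : forall x, D x -> (g x)^T = g x)
  (gp : forall x v, D x -> v != 0 -> 0 < inner (g x) v v).

Section UnitTangent.
Variables (B : set R) (f : R -> 'rV[R]_2).
Hypotheses (Bo : open B) (sf : smooth_on B f) (fD : forall p, B p -> D (f p))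
  (f1 : forall p, B p -> 'D_1 f p != 0).

Definition speed p := Num.sqrt (inner (g (f p)) ('D_1 f p) ('D_1 f p)).

Lemma speed_gt0 p : B p -> 0 < speed p.
Proof. by move=> Bp; rewrite sqrtr_gt0; apply: gp; [exact: fD|exact: f1]. Qed.

Lemma smooth_on_speed : smooth_on B speed.
Proof.
apply: smooth_on_sqrt => //.
  by move=> p Bp; apply: gp; [exact: fD|exact: f1].
apply: smooth_on_inner => //; last 2 first.
- exact: smooth_on_derive.
- exact: smooth_on_derive.
exact: (smooth_on_metric_curve Do sg Bo sf fD).
Qed.

Definition unit_tangent p := (speed p)^-1 *: 'D_1 f p.

Lemma smooth_on_unit_tangent : smooth_on B unit_tangent.
Proof.
apply: smooth_on_scale => //; last exact: smooth_on_derive.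
apply: smooth_onV => //; last exact: smooth_on_speed.
by move=> p Bp; rewrite gt_eqF// speed_gt0.
Qed.

Lemma unit_tangentK p : B p -> 'D_1 f p = speed p *: unit_tangent p.
Proof.
move=> Bp; rewrite scalerA mulfV ?scale1r// gt_eqF//; exact: speed_gt0.
Qed.

Lemma unit_tangent_unit p : B p -> inner (g (f p)) (unit_tangent p) (unit_tangent p) = 1.
Proof.
move=> Bp; rewrite innerZ innerZr mulrA -expr2 exprVn sqr_sqrtr ?mulVf//.
  by rewrite gt_eqF//; apply: gp; [exact: fD|exact: f1].
by rewrite ltW//; apply: gp; [exact: fD|exact: f1].
Qed.

End UnitTangent.

Section AdaptedCoordinates.
Variables (U : set 'rV[R]_2) (F : 'rV[R]_2 -> 'rV[R]_4).
Hypotheses (Uo : open U) (sF : smooth_on U F) (FD : forall u, U u -> D (fst4 (F u)))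
  (rx : forall u, U u -> \rank ('J (fun u => fst4 (F u)) u) = 1%N)
  (rF : forall u, U u -> \rank ('J F u) = 2%N)
  (lagr : forall u, U u -> forall v w : 'rV[R]_2,
    Omega g (F u) (v *m 'J F u) (w *m 'J F u) = 0).

Let x u := fst4 (F u).
Let y u := snd4 (F u).

Lemma smooth_on_fst4_comp : smooth_on U x.
Proof.
exact: (smooth_on_comp (f := @fst4 R) Uo openT (fun _ _ => I) (@smooth_on_fst4 R setT) sF).
Qed.

Lemma smooth_on_snd4_comp : smooth_on U y.
Proof.
exact: (smooth_on_comp (f := @snd4 R) Uo openT (fun _ _ => I) (@smooth_on_snd4 R setT) sF).
Qed.

Lemma derive_fst4_comp u v : U u -> fst4 ('D_v F u) = 'D_v x u.
Proof.
move=> Uu; rewrite -(derive_fst4 (F u)); apply/esym.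
apply: derive_comp; first exact: (smooth_on_differentiable sF Uu).
exact: differentiable_fst4.
Qed.

Lemma derive_snd4_comp u v : U u -> snd4 ('D_v F u) = 'D_v y u.
Proof.
move=> Uu; have ds z : differentiable (@snd4 R) z.
  exact: (smooth_on_differentiable (@smooth_on_snd4 R setT) I).
have <- : 'D_('D_v F u) (@snd4 R) (F u) = snd4 ('D_v F u).
  apply/rowP => i; rewrite (derive_rVE _ _ (ds _)).
  have -> : (fun z => @snd4 R z 0 i) = (fun z => z 0 (@rshift 2 2 i)).
    by apply/funext => z; rewrite snd4E.
  by rewrite snd4E; exact: derive_coord.
apply/esym/derive_comp; first exact: (smooth_on_differentiable sF Uu).
exact: ds.
Qed.

Variables (B : set R) (f : R -> 'rV[R]_2) (p : 'rV[R]_2 -> R) (V : set 'rV[R]_2).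
Hypotheses (Bo : open B) (sf : smooth_on B f) (fD : forall q, B q -> D (f q))
  (f1 : forall q, B q -> 'D_1 f q != 0)
  (Vo : open V) (VU : V `<=` U) (VB : forall u, V u -> B (p u))
  (sp : smooth_on V p) (xf : forall u, V u -> x u = f (p u)).

Let T := unit_tangent f.
Let N q := jrot (g (f q)) (T q).
Definition tangent_coef u := inner (g (x u)) (y u) (T (p u)).
Definition normal_coef u := inner (g (x u)) (y u) (N (p u)).

Let sT : smooth_on B T := smooth_on_unit_tangent Bo sf fD f1.

Let sN : smooth_on B N.
Proof.
apply: smooth_on_jrot => //; last exact: (smooth_on_metric_curve Do sg Bo sf fD).
by move=> q Bq; exact: (metric_det gs gp (fD Bq)).
Qed.

Let sx : smooth_on V x.
Proof. exact: sub_smooth_on VU smooth_on_fst4_comp. Qed.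

Let sy : smooth_on V y.
Proof. exact: sub_smooth_on VU smooth_on_snd4_comp. Qed.

Let sgx : smooth_on V (fun u => g (x u)).
Proof. by apply: (smooth_on_comp Vo Do _ sg sx) => u /VU; exact: FD. Qed.

Lemma smooth_on_tangent_coef : smooth_on V tangent_coef.
Proof.
apply: (smooth_on_inner Vo sgx sy).
exact: (smooth_on_comp_R (f := T) Vo Bo VB sT sp).
Qed.

Lemma smooth_on_normal_coef : smooth_on V normal_coef.
Proof.
apply: (smooth_on_inner Vo sgx sy).
exact: (smooth_on_comp_R (f := N) Vo Bo VB sN sp).
Qed.

Lemma snd4_adapted u : V u -> y u = tangent_coef u *: T (p u) + normal_coef u *: N (p u).
Proof.
move=> Vu; have Bp := VB Vu; have Dx := fD Bp.
rewrite /tangent_coef /normal_coef (xf Vu).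
exact: (frame_decomp (gs Dx) (metric_det gs gp Dx) (y u) (unit_tangent_unit fD f1 Bp)).
Qed.

Let dp u : V u -> differentiable p u.
Proof. by move=> Vu; exact: smooth_on_differentiable sp Vu. Qed.

Lemma derive_adapted u v : V u -> 'D_v x u = 'D_v p u *: 'D_1 f (p u).
Proof.
move=> Vu; have E : {near u, x =1 (f \o p)}.
  by apply: filterS (open_nbhs_nbhs (conj Vo Vu)) => z; exact: xf.
rewrite (near_eq_derive _ E); apply: derive_comp_R; first exact: dp.
exact: (smooth_on_differentiable sf (VB Vu)).
Qed.

(* Omega vanishes on v and w; as v is vertical, this says that D_v y is orthogonal
   to the curve, hence that the tangential coefficient of y depends on p only. *)
Lemma adapted_direction u v : V u -> 'D_v p u = 0 ->
  [/\ 'D_v x u = 0, 'D_v tangent_coef u = 0 & 'D_v normal_coef u = 0 -> v = 0].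
Proof.
move=> Vu p0; have Uu := VU Vu; have Bp := VB Vu.
have Dx : D (x u) by exact: FD.
have x0 : 'D_v x u = 0 by rewrite derive_adapted// p0 scale0r.
have dF := smooth_on_differentiable sF Uu.
have dx := smooth_on_differentiable sx Vu.
have dy := smooth_on_differentiable sy Vu.
have dg := smooth_on_differentiable sg Dx.
have dT := smooth_on_differentiable sT Bp.
have dN := smooth_on_differentiable sN Bp.
have DT := derive_inner_frozen dx dg dy (dp Vu) dT x0 p0.
have DN := derive_inner_frozen dx dg dy (dp Vu) dN x0 p0.
(* Otherwise x = f(p) would have zero Jacobian, against rank one. *)
have [w w0] : exists w, 'D_w p u != 0.
  apply/not_existsP => h; have J0 : 'J x u = 0.
    apply/row_matrixP => i; rewrite (row_jacobian _ dx) /pd derive_adapted//.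
    rewrite [X in X *: _](_ : _ = 0) ?scale0r ?row0//.
    by apply/eqP; apply: contraT => /h.
  by have := rx Uu; rewrite [X in \rank X]J0 mxrank0.
have yT : inner (g (x u)) ('D_v y u) (T (p u)) = 0.
  have := lagr Uu v w; rewrite -!(deriveEjacobian _ dF) /Omega /Pmap /Kmap.
  rewrite (derive_fst4_comp v Uu) (derive_fst4_comp w Uu) (derive_snd4_comp v Uu).
  rewrite (derive_snd4_comp w Uu) x0 christoffel_form0 addr0.
  rewrite -/(x u) (derive_adapted w Vu) (unit_tangentK fD f1 Bp) scalerA innerZr.
  rewrite [X in _ - X](_ : _ = 0) ?subr0; last by rewrite inner2 !mxE; ring.
  move=> /eqP; rewrite mulf_eq0 mulf_eq0 (negbTE w0)/=.
  by rewrite gt_eqF ?(speed_gt0 fD f1 Bp)//= => /eqP.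
split=> //; first exact: etrans DT yT.
(* Both components of D_v y now vanish along with D_v x, so v is in the kernel of the injective J
   F. *)
move=> n0; have yN : inner (g (x u)) ('D_v y u) (N (p u)) = 0 by rewrite -[LHS]DN.
have y0 : 'D_v y u = 0.
  rewrite (frame_decomp (A := g (x u)) (T := T (p u)) (gs Dx) (metric_det gs gp Dx) ('D_v y u)).
    by rewrite yT scale0r add0r (xf Vu) -/(N (p u)) -(xf Vu) yN scale0r.
  by rewrite (xf Vu); exact: (unit_tangent_unit fD f1 Bp).
have vJ : v *m 'J F u = 0.
  rewrite -(deriveEjacobian _ dF) -[LHS]pair4K derive_fst4_comp// derive_snd4_comp//.
  by rewrite x0 y0 pair40.
have fJ : row_free ('J F u) by rewrite /row_free rF.
by apply: (row_free_inj fJ); rewrite vJ mul0mx.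
Qed.

End AdaptedCoordinates.

End RankOneLagrangian.

(** * Arclength and normal coefficient as coordinates *)

Section LocalForm.
Context {R : realType}.
Variables (g : 'rV[R]_2 -> 'M[R]_2) (D : set 'rV[R]_2).
Hypotheses (Do : open D) (sg : smooth_on D g)
  (gs : forall x, D x -> (g x)^T = g x)
  (gp : forall x v, D x -> v != 0 -> 0 < inner (g x) v v).
Variables (U : set 'rV[R]_2) (F : 'rV[R]_2 -> 'rV[R]_4).
Hypotheses (Uo : open U) (sF : smooth_on U F) (FD : forall u, U u -> D (fst4 (F u)))
  (rx : forall u, U u -> \rank ('J (fun u => fst4 (F u)) u) = 1%N)
  (rF : forall u, U u -> \rank ('J F u) = 2%N)
  (lagr : forall u, U u -> forall v w : 'rV[R]_2,
    Omega g (F u) (v *m 'J F u) (w *m 'J F u) = 0).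

Let x u := fst4 (F u).
Let y u := snd4 (F u).

(** The map psi = (arclength, normal coefficient) is a local diffeomorphism: a vector killed by its
    Jacobian kills p and the normal coefficient, hence is 0 by [adapted_direction]. The base point
    and the tangential coefficient do not vary along the second coordinate, and so become functions
    of s alone. *)
Theorem rank_one_local_form u0 : U u0 ->
  exists (r : R) (psi chi : 'rV[R]_2 -> 'rV[R]_2) (gamma : R -> 'rV[R]_2) (a : R -> R),
  [/\ 0 < r, chi (psi u0) = u0, smooth_on (ball (psi u0) r) chi,
      open (chi @` ball (psi u0) r) & smooth_on (chi @` ball (psi u0) r) psi] /\
  [/\ forall w, ball (psi u0) r w ->
        [/\ U (chi w), psi (chi w) = w & 'J psi (chi w) \in unitmx],
      smooth_on (ball (psi u0 0 0) r) gamma,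
      smooth_on (ball (psi u0 0 0) r) a,
      forall s, ball (psi u0 0 0) r s -> D (gamma s) /\
        inner (g (gamma s)) ('D_1 gamma s) ('D_1 gamma s) = 1 &
      forall w, ball (psi u0) r w -> F (chi w) = affine_normal_map g gamma a w].
Proof.
move=> Uu0; have sx : smooth_on U x := smooth_on_fst4_comp Uo sF.
have [k [r1 [f [U2 [r10 sf U2o U2u0 [xf fk fx]]]]]] := rank_one_curve Uo Uu0 sx rx.
pose p u := x u 0 k.
(* [primitive_ex] yields the arclength on the ball of half the radius. *)
pose B1 := ball (p u0) r1; pose B := ball (p u0) (r1 / 2).
have B1o : open B1 by exact: ball_open.
have Bo : open B by exact: ball_open.
have BB1 : B `<=` B1 by apply: le_ball; rewrite ler_pdivrMr// ler_pMr// ler1n.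
have fD q : B1 q -> D (f q) by move=> /fx[u Uu ->]; exact: FD.
(* The component k of [f] is the identity, so [f] is regular. *)
have f1 q : B1 q -> 'D_1 f q != 0.
  move=> Bq; apply/eqP => f0; have df := smooth_on_differentiable sf Bq.
  have := @derive_rVE _ _ _ f q 1 k df; rewrite f0 mxE.
  have E : {near q, (fun t => f t 0 k) =1 (fun t : R => t)}.
    by apply: filterS (open_nbhs_nbhs (conj B1o Bq)) => t; exact: fk.
  have D1 : 'D_1 (fun t => f t 0 k) q = 1.
    by apply: etrans (near_eq_derive _ E) _; exact: derive_id.
  by rewrite D1 => /esym/eqP; rewrite oner_eq0.
have sf' := sub_smooth_on BB1 sf.
have fD' q (Bq : B q) := fD q (BB1 q Bq).
have f1' q (Bq : B q) := f1 q (BB1 q Bq).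
have ss := smooth_on_speed Do sg gp B1o sf fD f1.
(* The arclength of [f] as a function of the parameter p. *)
have [sigma dsigma] : exists sigma, forall q, B q -> is_derive q 1 sigma (speed g f q).
  apply: (primitive_ex (f := speed g f) r10) => q Bq.
  exact: (smooth_on_continuous ss Bq).
have ssigma : smooth_on B sigma.
  exact: (smooth_on_primitive Bo dsigma (sub_smooth_on BB1 ss)).
have sp : smooth_on U p by exact: (smooth_on_rVP _ Uo).1 sx k.
pose V := U2 `&` (U `&` p @^-1` B).
have Vo : open V.
  apply: openI => //; apply: open_preimage_on => // u Uu.
  exact: (smooth_on_continuous sp Uu).
have VU : V `<=` U by move=> u [_ []].
have VB u : V u -> B (p u) by move=> [_ []].
have Vxf u : V u -> x u = f (p u) by move=> [/xf[]].
have Vu0 : V u0 by split=> //; split=> //; apply: ballxx; rewrite divr_gt0.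
have spV := sub_smooth_on VU sp.
pose t := normal_coef g F f p; pose al := tangent_coef g F f p.
have st : smooth_on V t.
  exact: (smooth_on_normal_coef Do sg gs gp Uo sF FD Bo sf' fD' f1' Vo VU VB spV).
have sal : smooth_on V al.
  exact: (smooth_on_tangent_coef Do sg gp Uo sF FD Bo sf' fD' f1' Vo VU VB spV).
have ssp : smooth_on V (sigma \o p).
  exact: (smooth_on_comp_R_scalar Vo VB ssigma spV).
have key u v (Vu : V u) := adapted_direction Do sg gs gp Uo sF FD rx rF lagr
  Bo sf' fD' f1' Vo VU VB spV Vxf Vu (v := v).
have dpV u : V u -> differentiable p u.
  by move=> Vu; exact: (smooth_on_differentiable spV Vu).
have Dsp u v : V u -> 'D_v (sigma \o p) u = 'D_v p u * speed g f (p u).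
  move=> Vu; have [ds Ds] := dsigma _ (VB _ Vu).
  apply: etrans (derive_comp_R v (dpV _ Vu) _) _; first exact/derivable1_diffP.
  by rewrite Ds.
have sp0 u : V u -> 0 < speed g f (p u).
  by move=> Vu; exact: (speed_gt0 gp fD f1 (BB1 _ (VB _ Vu))).
have p0 u v : V u -> 'D_v (sigma \o p) u = 0 -> 'D_v p u = 0.
  move=> Vu; rewrite (Dsp _ _ Vu) => /eqP.
  by rewrite mulf_eq0 [X in _ || X]gt_eqF ?sp0// orbF => /eqP.
pose psi u := pt (sigma (p u)) (t u).
have psi0 : (fun u => psi u 0 0) = sigma \o p by apply/funext => u; exact: pt0.
have psi1 : (fun u => psi u 0 1) = t by apply/funext => u; exact: pt1.
have spsi : smooth_on V psi.
  apply/smooth_on_rVP => //; apply: ord2P; first by rewrite psi0.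
  by rewrite psi1.
have dpsi u : V u -> differentiable psi u.
  by move=> Vu; exact: (smooth_on_differentiable spsi Vu).
have Dpsi u v : V u -> 'D_v psi u 0 0 = 'D_v (sigma \o p) u /\ 'D_v psi u 0 1 = 'D_v t u.
  move=> Vu; split; apply: etrans (derive_rVE _ _ (dpsi _ Vu)) _.
    by rewrite psi0.
  by rewrite psi1.
have Ju0 : 'J psi u0 \in unitmx.
  apply: unitmx_ker => v vJ.
  have v0 : 'D_v psi u0 = 0 by rewrite (deriveEjacobian _ (dpsi _ Vu0)).
  have [] := Dpsi u0 v Vu0; rewrite v0 !mxE => /esym h0 /esym h1.
  have [_ _] := key _ v Vu0 (p0 _ _ Vu0 h0); exact.
have [r [chi [r0 chi0 schi Wo chiP]]] := inverse_function Vo Vu0 spsi Ju0.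
pose W := ball (psi u0) r; pose I := ball (psi u0 0 0) r.
have WB : open W by exact: ball_open.
have Io : open I by exact: ball_open.
have chiV w : W w -> V (chi w) by move=> /chiP[].
have dchi w : W w -> differentiable chi w.
  by move=> Ww; exact: (smooth_on_differentiable schi Ww).
have Dchi w v : W w -> 'D_('D_v chi w) psi (chi w) = v.
  move=> Ww; have E : {near w, (psi \o chi) =1 id}.
    by apply: filterS (open_nbhs_nbhs (conj WB Ww)) => z /chiP[].
  apply: etrans (esym (derive_comp v (dchi _ Ww) (dpsi _ (chiV _ Ww)))) _.
  by apply: etrans (near_eq_derive _ E) _; exact: derive_id.
have Dchip w v : W w -> 'D_('D_v chi w) (sigma \o p) (chi w) = v 0 0.
  by move=> Ww; have [<- _] := Dpsi _ ('D_v chi w) (chiV _ Ww); rewrite Dchi.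
have dxU u : V u -> differentiable x u.
  by move=> /VU Uu; exact: (smooth_on_differentiable sx Uu).
have dal u : V u -> differentiable al u.
  by move=> Vu; exact: (smooth_on_differentiable sal Vu).
have second w : W w -> 'D_('D_(delta_mx 0 1) chi w) x (chi w) = 0 /\
    'D_('D_(delta_mx 0 1) chi w) al (chi w) = 0.
  move=> Ww; have Vc := chiV _ Ww.
  have h := Dchip w (delta_mx 0 1) Ww; rewrite mxE/= in h.
  by have [h1 h2 _] := key _ _ Vc (p0 _ _ Vc h).
pose t0 := psi u0 0 1.
have IW s : I s -> W (pt s t0).
  move=> Is; apply/ball_rV2P => //; rewrite pt0 pt1; split; first exact: Is.
  exact: ballxx.
have WI w : W w -> I (w 0 0) by move=> /(ball_rV2P _ _ r0)[].
(* Restrictions to the line t = t0; by [second] they determine [x] and [al] on the whole ball. *)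
pose gamma s := x (chi (pt s t0)); pose a s := al (chi (pt s t0)).
have xE w : W w -> x (chi w) = gamma (w 0 0).
  apply: (@const_in_second _ _ (x \o chi) _ _ r0) => {}w Ww.
  have Vc := chiV _ Ww.
  split; first exact: (differentiable_comp (dchi _ Ww) (dxU _ Vc)).
  apply: etrans (derive_comp _ (dchi _ Ww) (dxU _ Vc)) _.
  by have [] := second _ Ww.
have aE w : W w -> al (chi w) = a (w 0 0).
  apply: (@const_in_second_scalar _ (al \o chi) _ _ r0) => {}w Ww.
  have Vc := chiV _ Ww.
  split; first exact: (differentiable_comp (dchi _ Ww) (dal _ Vc)).
  apply: etrans (derive_comp _ (dchi _ Ww) (dal _ Vc)) _.
  by have [] := second _ Ww.
have Dgamma s : I s -> 'D_1 gamma s = unit_tangent g f (p (chi (pt s t0))).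
  move=> Is; have Ww := IW _ Is; have Vc := chiV _ Ww.
  have -> : 'D_1 gamma s = 'D_(delta_mx 0 0) (x \o chi) (pt s t0).
    have dl : differentiable (x \o chi) (pt s t0).
      exact: (differentiable_comp (dchi _ Ww) (dxU _ Vc)).
    by have [] := @is_derive_line _ _ _ (x \o chi) (t0 *: delta_mx 0 1) (delta_mx 0 0) s dl.
  apply: etrans (derive_comp _ (dchi _ Ww) (dxU _ Vc)) _.
  rewrite (derive_adapted sf' Vo VB spV Vxf _ Vc).
  (* The first coordinate is sigma(p), so the derivative of p in s times the speed is 1; this makes
     [gamma] of unit speed. *)
  have h := Dchip _ (delta_mx 0 0) Ww; rewrite mxE/= (Dsp _ _ Vc) in h.
  rewrite (unit_tangentK gp fD f1 (BB1 _ (VB _ Vc))) scalerA.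
  by rewrite [X in X *: _](_ : _ = 1) ?scale1r.
exists r, psi, chi, gamma, a; split; split.
- exact: r0.
- exact: chi0.
- exact: schi.
- exact: Wo.
- by apply: sub_smooth_on spsi => _ [w Ww <-]; exact: chiV.
- by move=> w Ww; have [h1 h2 h3] := chiP _ Ww; split; [exact: VU|exact: h2|exact: h3].
- apply: (@smooth_on_comp _ _ _ _ _ _ W (x \o chi) (pt^~ t0) Io WB IW).
    exact: (smooth_on_comp WB Vo chiV (sub_smooth_on VU sx) schi).
  exact: smooth_on_pt.
- apply: (@smooth_on_comp_scalar _ _ _ _ W (al \o chi) (pt^~ t0) Io IW).
    exact: (smooth_on_comp_scalar WB chiV sal schi).
  exact: smooth_on_pt.
- move=> s Is; have Vc := chiV _ (IW _ Is); split; first exact/FD/VU.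
  rewrite (Dgamma _ Is) /gamma (Vxf _ Vc).
  exact: (unit_tangent_unit gp fD f1 (BB1 _ (VB _ Vc))).
- move=> w Ww; have Vc := chiV _ Ww.
  have Is := WI _ Ww; have Vc0 := chiV _ (IW _ Is).
  have pE : p (chi (pt (w 0 0) t0)) = p (chi w) by rewrite /p (xE _ Ww).
  have tE : t (chi w) = w 0 1.
    have [_ h _] := chiP _ Ww.
    by move: (congr1 (fun v : 'rV[R]_2 => v 0 1) h); rewrite pt1.
  rewrite -[LHS]pair4K /affine_normal_map /ruled -/(x (chi w)) (xE _ Ww).
  congr (pair4 _ _).
  apply: etrans (snd4_adapted gs gp fD' f1' VB Vxf Vc) _.
  rewrite -/(al (chi w)) -/(t (chi w)) (aE _ Ww) tE (Dgamma _ Is) pE.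
  by rewrite -(Vxf _ Vc) (xE _ Ww).
Qed.

End LocalForm.

(** * Flatness and Hamiltonian stationarity *)

Section NearEq.
Context {R : realType} {n : nat}.
Variables (G : 'rV[R]_n -> 'M[R]_n) (X X' : 'rV[R]_2 -> 'rV[R]_n) (U : set 'rV[R]_2).
Hypotheses (Uo : open U) (XX' : {in U, X =1 X'}) (dX : forall u, U u -> differentiable X u).

Lemma eq_on_near (V W : normedModType R) (A : set V) (f f' : V -> W) u :
  open A -> {in A, f =1 f'} -> A u -> {near u, f =1 f'}.
Proof.
by move=> Ao ff Au; apply: filterS (open_nbhs_nbhs (conj Ao Au)) => z Az; exact/ff/mem_set.
Qed.

Lemma eq_on_jacobian u : U u -> 'J X u = 'J X' u.
Proof. by move=> Uu; exact: near_eq_jacobian (eq_on_near Uo XX' Uu) (dX Uu). Qed.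

Lemma eq_on_induced_metric u : U u -> induced_metric G X u = induced_metric G X' u.
Proof.
by move=> Uu; rewrite /induced_metric (eq_on_jacobian Uu) (XX' (mem_set Uu)).
Qed.

Lemma eq_on_mean_curvature u : U u -> mean_curvature G X u = mean_curvature G X' u.
Proof.
move=> Uu; have E1 i : {in U, pd i X =1 pd i X'} by exact: near_eq_derive_on.
have E2 i j : pd i (pd j X) u = pd i (pd j X') u.
  exact: (near_eq_derive_on _ Uo (E1 j) (mem_set Uu)).
rewrite /mean_curvature (eq_on_induced_metric Uu).
apply: (congr1 ( *:%R 2^-1)); apply: eq_bigr => i _; apply: eq_bigr => j _.
apply: (congr1 ( *:%R _)).
rewrite /second_fundamental_form /normal_part (eq_on_induced_metric Uu).
by rewrite (eq_on_jacobian Uu) (XX' (mem_set Uu)) E2 !(E1 _ _ (mem_set Uu)).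
Qed.

End NearEq.

(* When P' = E, the coordinates (s, t - P(s)/2) turn E ds^2 - 2 ds dt into the
   constant metric null_mx. *)
Section Shear.
Context {R : realType}.
Variables (P e : R -> R) (J : set R).
Hypotheses (Jo : open J) (dP : forall s, J s -> is_derive s 1 P (e s)).

Definition shear (w : 'rV[R]_2) : 'rV[R]_2 := pt (w 0 0) (w 0 1 - 2^-1 * P (w 0 0)).

Definition null_mx : 'M[R]_2 := \matrix_(i, j) (if i == j then 0 else -1).

Lemma null_mx_sym : null_mx^T = null_mx.
Proof. by apply/matrixP => i j; rewrite !mxE eq_sym. Qed.

Lemma null_mx_unit : null_mx \in unitmx.
Proof.
rewrite unitmxE unitfE det2 !mxE/= mulr0 sub0r mulrNN mulr1 oppr_eq0.
exact: oner_neq0.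
Qed.

Lemma smooth_on_shear : smooth_on J e -> smooth_on (strip J) shear.
Proof.
move=> se; have So := @strip_open R J Jo.
have sP := smooth_on_primitive Jo dP se.
have s0 := @smooth_on_coord R 1 2 (strip J) 0 0.
have s1 := @smooth_on_coord R 1 2 (strip J) 0 1.
have sPc : smooth_on (strip J) (fun w : 'rV[R]_2 => P (w 0 0)).
  exact: (smooth_on_comp_R_scalar (f := P) So (fun _ h => h) sP s0).
apply/smooth_on_rVP => //; apply: ord2P.
  by apply: eq_smooth_on s0 => // w _; rewrite pt0.
apply: eq_smooth_on (smooth_onB So s1
  (smooth_onM So (smooth_on_cst (strip J) (2^-1 : R)) sPc)) => // w _.
by rewrite pt1.
Qed.

Lemma jacobian_shear w : strip J w -> differentiable shear w ->
  [/\ 'J shear w 0 0 = 1, 'J shear w 1 0 = 0, 'J shear w 1 1 = 1 &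
      'J shear w 0 1 = - (2^-1 * e (w 0 0))].
Proof.
move=> Jw ds; have [dPs DP] := dP Jw.
have dPs' : differentiable P (w 0 0) by exact/derivable1_diffP.
have d0 := differentiable_coord_rV w 0; have d1 := differentiable_coord_rV w 1.
have dPc : differentiable (fun w : 'rV[R]_2 => P (w 0 0)) w.
  exact: (differentiable_comp d0 dPs').
have dc : differentiable (fun=> 2^-1 : R) w by exact: differentiable_cst.
have Dc v : 'D_v (fun=> 2^-1 : R) w = 0 by exact: derive_cst.
have DPc v : 'D_v (fun w : 'rV[R]_2 => P (w 0 0)) w = v 0 0 * e (w 0 0).
  apply: etrans (derive_comp_R v d0 dPs') _.
  by rewrite derive_coord DP.
have E0 i : 'J shear w i 0 = (delta_mx 0 i : 'rV[R]_2) 0 0.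
  apply: etrans (jacobianE i 0 ds) _.
  have -> : (fun y => shear y 0 0) = (fun y => y 0 0) by apply/funext => y; exact: pt0.
  exact: derive_coord.
have E1 i : 'J shear w i 1 = (delta_mx 0 i : 'rV[R]_2) 0 1 -
    2^-1 * ((delta_mx 0 i : 'rV[R]_2) 0 0 * e (w 0 0)).
  apply: etrans (jacobianE i 1 ds) _.
  have -> : (fun y => shear y 0 1) = (fun y => y 0 1 - 2^-1 * P (y 0 0)).
    by apply/funext => y; exact: pt1.
  rewrite /pd (derive_subE _ d1 (differentiable_mulE dc dPc)).
  by rewrite (derive_mulE _ dc dPc) Dc mulr0 addr0 derive_coord DPc.
by split; rewrite ?E0 ?E1 !mxE/=; ring.
Qed.

Lemma shear_metric (K h : 'M[R]_2) (E : R) :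
  [/\ K 0 0 = 1, K 1 0 = 0, K 1 1 = 1 & K 0 1 = - (2^-1 * E)] ->
  [/\ h 0 0 = E, h 0 1 = -1, h 1 0 = -1 & h 1 1 = 0] ->
  h = K *m null_mx *m K^T.
Proof.
move=> [K00 K10 K11 K01] [h00 h01 h10 h11]; apply/matrixP; apply: ord2P; apply: ord2P.
- by rewrite h00 !(mxE, sum2)/= K00 K01; field.
- by rewrite h01 !(mxE, sum2)/= K00 K01 K10 K11; ring.
- by rewrite h10 !(mxE, sum2)/= K00 K01 K10 K11; ring.
- by rewrite h11 !(mxE, sum2)/= K10 K11; ring.
Qed.

Lemma shear_unit (K : 'M[R]_2) (E : R) :
  [/\ K 0 0 = 1, K 1 0 = 0, K 1 1 = 1 & K 0 1 = - (2^-1 * E)] -> K \in unitmx.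
Proof.
move=> [K00 K10 K11 K01].
by rewrite unitmxE unitfE det2 K00 K10 K11 mulr0 subr0 mulr1 oner_neq0.
Qed.

End Shear.

(** * Curvature and divergence on a rank one Lagrangian surface *)

Section FlatStationary.
Context {R : realType}.
Variables (g : 'rV[R]_2 -> 'M[R]_2) (D : set 'rV[R]_2).
Hypotheses (Do : open D) (sg : smooth_on D g)
  (gs : forall x, D x -> (g x)^T = g x)
  (gp : forall x v, D x -> v != 0 -> 0 < inner (g x) v v).
Variables (U : set 'rV[R]_2) (F : 'rV[R]_2 -> 'rV[R]_4).
Hypotheses (Uo : open U) (sF : smooth_on U F) (FD : forall u, U u -> D (fst4 (F u)))
  (rx : forall u, U u -> \rank ('J (fun u => fst4 (F u)) u) = 1%N)
  (rF : forall u, U u -> \rank ('J F u) = 2%N)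
  (lagr : forall u, U u -> forall v w : 'rV[R]_2,
    Omega g (F u) (v *m 'J F u) (w *m 'J F u) = 0).

Let h := induced_metric (GG g) F.
Let JH u := JJ g (F u) (mean_curvature (GG g) F u).

(** Stationarity asks for one field [Z] on a whole chart domain, while the coordinates (s, t) exist
    only near [u0]. Hence [Z] is prescribed on all of [U] by a pseudo-inverse, and its divergence is
    then computed locally. *)
Theorem flat_stationary u0 : U u0 ->
  [/\ h u0 \in unitmx,
      forall l k i j, curvature h u0 l k i j = 0 &
      forall Z : 'rV[R]_2 -> 'rV[R]_2, (forall u, U u -> Z u = JH u *m pinvmx ('J F u)) ->
        JH u0 = Z u0 *m 'J F u0 /\ divergence h Z u0 = 0].
Proof.
move=> Uu0.
have [r [psi [chi [gamma [a [[r0 chi0 schi U1o spsi] [chiP sgam sa gamP FE]]]]]]] :=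
  rank_one_local_form Do sg gs gp Uo sF FD rx rF lagr Uu0.
pose I := ball (psi u0 0 0) r; pose J := ball (psi u0 0 0) (r / 2).
have Io : open I by exact: ball_open.
have Jo : open J by exact: ball_open.
have ID s : I s -> D (gamma s) by move=> /gamP[].
have us s : I s -> inner (g (gamma s)) ('D_1 gamma s) ('D_1 gamma s) = 1 by move=> /gamP[].
pose M := affine_normal_map g gamma a.
pose U1 := chi @` ball (psi u0) r.
have sM : smooth_on (strip I) M by exact: (smooth_on_affine_normal_map Do sg gs gp Io sgam ID sa).
have psiI u : U1 u -> strip I (psi u).
  move=> [w Ww <-]; have [_ -> _] := chiP _ Ww.
  by have [] := (ball_rV2P _ _ r0).1 Ww.
have FM : {in U1, F =1 M \o psi}.
  move=> u /set_mem [w Ww <-] /=; have [_ -> _] := chiP _ Ww.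
  exact: FE.
have U1U : U1 `<=` U by move=> _ [w Ww <-]; have [] := chiP _ Ww.
have U1J u : U1 u -> 'J psi u \in unitmx.
  by move=> [w Ww <-]; have [] := chiP _ Ww.
have U1u0 : U1 u0 by exists (psi u0) => //; exact: ballxx.
have dF u : U1 u -> differentiable F u.
  by move=> /U1U Uu; exact: (smooth_on_differentiable sF Uu).
have So : open (strip I) by exact: strip_open.
pose E := normal_bundle_coef g gamma a; pose kap := normal_curvature g gamma.
have sE : smooth_on I E := smooth_on_normal_bundle_coef Do sg gs gp Io sgam ID sa.
have skap : smooth_on I kap := smooth_on_normal_curvature Do sg gs gp Io sgam ID.
have hM w : strip I w -> _ := @affine_normal_metric _ _ _ Do sg gs gp _ _ _ Io sgam ID sa us w.
have hMu w : strip I w -> induced_metric (GG g) M w \in unitmx.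
  by move=> Iw; have [] := affine_normal_metric_inv Do sg gs gp Io sgam ID sa us Iw.
have hE1 u : U1 u -> h u = 'J psi u *m induced_metric (GG g) M (psi u) *m ('J psi u)^T.
  move=> U1u; apply: etrans (eq_on_induced_metric (GG g) U1o FM dF U1u) _.
  exact: (induced_metric_reparam (GG g) sM spsi psiI U1u).
have JE u : U1 u -> 'J F u = 'J psi u *m 'J M (psi u).
  move=> U1u; apply: etrans (eq_on_jacobian U1o FM dF U1u) _.
  exact: (jacobian_reparam sM spsi psiI U1u).
have HE u : U1 u -> JH u = kap (psi u 0 0) *: pd 1 M (psi u).
  move=> U1u; rewrite /JH (eq_on_mean_curvature (GG g) U1o FM dF U1u).
  rewrite (mean_curvature_reparam So U1o sM spsi psiI U1u (U1J _ U1u) (hMu _ (psiI _ U1u))).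
  rewrite (FM _ (mem_set U1u)).
  exact: (affine_normal_JJ Do sg gs gp Io sgam ID sa us (psiI _ U1u)).
have [P dP] : exists P, forall s, J s -> is_derive s 1 P (E s).
  by apply: (primitive_ex (f := E) r0) => s Is; exact: (smooth_on_continuous sE Is).
have JI : J `<=` I by apply: le_ball; rewrite ler_pdivrMr// ler_pMr// ler1n.
pose U2 := U1 `&` psi @^-1` strip J.
have U2o : open U2.
  apply: open_preimage_on => //; first exact: strip_open.
  by move=> u U1u; exact: (smooth_on_continuous spsi U1u).
have U2u0 : U2 u0 by split=> //; apply: ballxx; rewrite divr_gt0.
pose phi := shear P \o psi.
have sshear := smooth_on_shear Jo dP (sub_smooth_on JI sE).
have spsi2 : smooth_on U2 psi by apply: sub_smooth_on spsi => u [].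
have sphi : smooth_on U2 phi.
  apply: (smooth_on_comp U2o _ _ sshear spsi2); first exact: strip_open.
  by move=> u [].
have Jphi u : U2 u -> 'J phi u = 'J psi u *m 'J (shear P) (psi u).
  move=> U2u; apply: jacobian_comp; first exact: (smooth_on_differentiable spsi2 U2u).
  exact: (smooth_on_differentiable sshear U2u.2).
have KE u : U2 u -> _ := fun U2u => jacobian_shear dP U2u.2
  (smooth_on_differentiable sshear U2u.2).
have hphi u : U2 u -> h u = 'J phi u *m null_mx *m ('J phi u)^T.
  move=> U2u; rewrite (hE1 _ U2u.1) (Jphi _ U2u).
  rewrite (shear_metric (KE _ U2u) (hM _ (psiI _ U2u.1))).
  by rewrite trmx_mul !mulmxA.
have phiu u : U2 u -> 'J phi u \in unitmx.
  move=> U2u; rewrite (Jphi _ U2u) unitmx_mul; apply/andP.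
  by split; [exact: (U1J _ U2u.1)|exact: (shear_unit (KE _ U2u))].
split.
- exact: (flat_unit null_mx_unit phiu hphi U2u0).
- move=> l k i j.
  exact: (flat_curvature U2o sphi null_mx_sym null_mx_unit phiu hphi _ _ _ _ U2u0).
- move=> Z ZE.
  (* In the coordinates (s, t) the field is kappa(s) d_t; since J F has full row rank, [pinvmx] is a
     right inverse of it. *)
  have ZJ u : U1 u -> Z u *m 'J psi u = kap (psi u 0 0) *: delta_mx 0 1.
    move=> U1u; rewrite (ZE _ (U1U _ U1u)).
    have fJ : row_free ('J F u) by rewrite /row_free rF//; exact: U1U.
    have dM := smooth_on_differentiable sM (psiI _ U1u).
    have -> : JH u = ((kap (psi u 0 0) *: delta_mx 0 1) *m invmx ('J psi u)) *m 'J F u.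
      rewrite (HE _ U1u) (JE _ U1u) mulmxA mulmxKV ?U1J// -scalemxAl -rowE.
      by rewrite (row_jacobian _ dM).
    by rewrite (mulmxKp fJ) mulmxKV// U1J.
  split.
    rewrite (HE _ U1u0) (JE _ U1u0) mulmxA (ZJ _ U1u0) -scalemxAl -rowE.
    by rewrite (row_jacobian _ (smooth_on_differentiable sM (psiI _ U1u0))).
  have d0 : differentiable (fun u => psi u 0 0) u0.
    exact: (differentiable_rVP psi u0).1 (smooth_on_differentiable spsi U1u0) 0.
  have dk := smooth_on_differentiable skap (psiI _ U1u0).
  (* The shear preserves the coordinate s and the field d_t, so in the coordinates [phi] the field
     is still kappa(s) times the second basis vector. *)
  apply: (@flat_divergence _ _ h U2 phi null_mx U2o sphi null_mx_sym null_mx_unit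
    phiu hphi u0 Z (fun u => kap (psi u 0 0)) 0 1 ('D_1 kap (psi u0 0 0))) => //.
  + exact: (differentiable_comp d0 dk).
  + move=> i; apply: etrans (derive_comp_R _ d0 dk) _.
    rewrite (jacobianE _ _ (smooth_on_differentiable sphi U2u0)).
    have -> : (fun y => phi y 0 0) = (fun y => psi y 0 0).
      by apply/funext => y; exact: pt0.
    exact: mulrC.
  + apply: filterS (open_nbhs_nbhs (conj U2o U2u0)) => u U2u.
    rewrite (Jphi _ U2u) mulmxA (ZJ _ U2u.1) -scalemxAl -rowE; congr (_ *: _).
    have [_ K10 K11 _] := KE _ U2u.
    by apply: rowP2; rewrite [LHS]mxE ?K10 ?K11 [RHS]mxE.
Qed.

End FlatStationary.

(** * Passage to the charts *)

(* vector.v also has a [coord], which shadows the one of the charts. *)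
Local Notation coord := Defs.coord.

Section SurfaceCharts.
Context {R : realType} {S : smooth_surface R}.
Implicit Types c d : chart S.

Definition cimg c : set 'rV[R]_2 := coord c @` cdom c.

Lemma paramK c u : cimg c u -> coord c (param c u) = u.
Proof. by move=> [p cp <-]; rewrite coordK. Qed.

Lemma param_cdom c u : cimg c u -> cdom c (param c u).
Proof. by move=> [p cp <-]; rewrite coordK. Qed.

Definition tdom c d : set 'rV[R]_2 := coord c @` (cdom c `&` cdom d).

Lemma tdomP c d u : tdom c d u <-> cimg c u /\ cdom d (param c u).
Proof.
split=> [[p [cp dp] <-]|[[p cp <-]]]; first by split; [exists p|rewrite coordK].
by rewrite coordK// => dp; exists p.
Qed.

Lemma tdom_open c d : open (tdom c d).
Proof.
rewrite (_ : tdom c d = cimg c `&` param c @^-1` cdom d).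
  apply: open_preimage_on; [exact: cimg_open|exact: cdom_open|].
  exact: param_continuous.
by apply/seteqP; split=> u /tdomP.
Qed.

Lemma smooth_on_transition c d : smooth_on (tdom c d) (coord d \o param c).
Proof. exact: transition_smooth. Qed.

Lemma jacobian_left_inverse n (f h : 'rV[R]_n -> 'rV[R]_n) u :
  differentiable f u -> differentiable h (f u) -> {near u, forall y, h (f y) = y} ->
  'J f u *m 'J h (f u) = 1%:M.
Proof.
move=> df dh E; rewrite -(jacobian_comp df dh) -(jacobian_id u).
apply: near_eq_jacobian; first exact: E.
exact: differentiable_comp.
Qed.

Lemma transition_unit c d u : tdom c d u -> 'J (coord d \o param c) u \in unitmx.
Proof.
move=> tu; have [cu du] := (tdomP _ _ _).1 tu.
have tv : tdom d c ((coord d \o param c) u).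
  by apply/tdomP; split; [exists (param c u)|rewrite /= coordK//; exact: param_cdom].
have E : {near u, forall y, (coord c \o param d) ((coord d \o param c) y) = y}.
  have nb : nbhs u (tdom c d).
    by apply: open_nbhs_nbhs; split; [exact: tdom_open|exact: tu].
  apply: (@filterS _ _ (nbhs_filter u)) nb => y /tdomP[cy dy] /=.
  by rewrite coordK// paramK.
have h := jacobian_left_inverse (smooth_on_differentiable (@smooth_on_transition c d) tu)
  (smooth_on_differentiable (@smooth_on_transition d c) tv) E.
exact: (mulmx1_unit h).1.
Qed.

End SurfaceCharts.

(** * Flatness, stationarity and minimality in charts *)

Section LagrangianCharts.
Context {R : realType} {S : oriented_riemannian_surface R} {L : smooth_surface R}.
Variable X : L -> tangent_bundle S.
Hypotheses (X_immersed : immersed_surface X) (X_lagrangian : lagrangian X)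
  (X_rank_one : rank_one X).

Lemma smooth_on_chart_metric (d : chart S) : smooth_on (cimg d) (metric d).
Proof. exact: Defs.metric_smooth. Qed.

Lemma chart_metric_sym (d : chart S) x : cimg d x -> (metric d x)^T = metric d x.
Proof. by move=> [p dp <-]; exact: Defs.metric_sym. Qed.

Lemma chart_metric_pos (d : chart S) x v : cimg d x -> v != 0 -> 0 < inner (metric d x) v v.
Proof. by move=> [p dp <-]; exact: Defs.metric_pos. Qed.

Lemma ldom_open c d : open (ldom X c d).
Proof.
have [Xc _ _] := X_immersed.
rewrite (_ : ldom X c d = cimg c `&` (fun u => base (X (param c u))) @^-1` cdom d)//.
apply: open_preimage_on; [exact: cimg_open|exact: cdom_open|] => u cu.
apply: (@continuous_comp _ _ _ (param c) (fun q => base (X q))).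
  exact: param_continuous.
exact: Xc.
Qed.

Lemma fst4_lrep c d : (fun u => fst4 (lrep X c d u)) = lbase X c d.
Proof. by apply/funext => u; rewrite fst4K. Qed.

Lemma lrep_domain c d u : ldom X c d u -> cimg d (fst4 (lrep X c d u)).
Proof. by move=> [_ du]; rewrite fst4K; exists (base (X (param c u))). Qed.

Lemma lrep_smooth c d : smooth_on (ldom X c d) (lrep X c d).
Proof. by have [_ + _] := X_immersed; exact. Qed.

Lemma lrep_rank c d u : ldom X c d u -> \rank ('J (lrep X c d) u) = 2%N.
Proof. by have [_ _] := X_immersed; exact. Qed.

Lemma lbase_rank c d u : ldom X c d u ->
  \rank ('J (fun u => fst4 (lrep X c d u)) u) = 1%N.
Proof. by rewrite fst4_lrep; exact: X_rank_one. Qed.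

Lemma lrep_flat_stationary c d u : ldom X c d u ->
  [/\ lmetric X c d u \in unitmx,
      forall l k i j, curvature (lmetric X c d) u l k i j = 0 &
      forall Z : 'rV[R]_2 -> 'rV[R]_2,
        (forall v, ldom X c d v -> Z v = JJ (metric d) (lrep X c d v)
          (mean_curvature (GG (metric d)) (lrep X c d) v) *m pinvmx ('J (lrep X c d) v)) ->
        JJ (metric d) (lrep X c d u) (mean_curvature (GG (metric d)) (lrep X c d) u) =
          Z u *m 'J (lrep X c d) u /\ divergence (lmetric X c d) Z u = 0].
Proof.
exact: (flat_stationary (@cimg_open R S d) (@smooth_on_chart_metric d) (@chart_metric_sym d)
  (@chart_metric_pos d) (@ldom_open c d) (@lrep_smooth c d) (@lrep_domain c d)
  (@lbase_rank c d) (@lrep_rank c d) (@X_lagrangian c d)).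
Qed.

Lemma lagrangian_flat : flat_induced_metric X.
Proof. by move=> c d u /lrep_flat_stationary[]. Qed.

Lemma lagrangian_stationary : hamiltonian_stationary X.
Proof.
move=> c d; exists (fun u => JJ (metric d) (lrep X c d u)
  (mean_curvature (GG (metric d)) (lrep X c d) u) *m pinvmx ('J (lrep X c d) u)).
by move=> u /lrep_flat_stationary[_ _]; exact.
Qed.

(** Read in the chart d, the immersion composed with [psi] is the affine normal map, and the mean
    curvature is invariant under reparametrization. The piece is arbitrary, so the criterion for
    minimality concerns every base curve and not only the constructed one. *)
Lemma piece_mean_curvature N I gamma a W psi : affine_normal_piece X N I gamma a W psi ->
  forall c d w, W w -> cdom c (psi w) -> cdom d (base (X (psi w))) ->
  [/\ ldom X c d (coord c (psi w)), cdom d (gamma (w 0 0)), I (w 0 0) &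
    mean_curvature (GG (metric d)) (lrep X c d) (coord c (psi w)) =
    pair4 0 (- jrot (metric d (coord d (gamma (w 0 0))))
      (covariant_derivative (metric d) (coord d \o gamma)
        ('D_1 (coord d \o gamma)) (w 0 0)))].
Proof.
move=> [[Io Ii Ic Is Iu] sa [[Wo No] Wbij Wc Ws Wr] WI WX] c d w Ww cw dw.
have Iw : I (w 0 0) by rewrite -WI; exists w.
have [bw pw] := WX _ Ww.
have dgw : cdom d (gamma (w 0 0)) by rewrite -bw.
have luw : ldom X c d (coord c (psi w)).
  by split; [exists (psi w)|rewrite coordK].
split=> //.
pose J := [set s | I s /\ cdom d (gamma s)].
have Jo : open J.
  exact: (open_preimage_on Io (cdom_open d) Ic).
pose W1 := [set w | W w /\ cdom c (psi w)].
have W1o : open W1 by exact: (open_preimage_on Wo (cdom_open c) Wc).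
pose W2 := W1 `&` strip J.
have W2o : open W2 by apply: openI => //; exact: strip_open.
have W2w : W2 w by split.
pose chi := coord c \o psi.
have schi : smooth_on W2 chi by apply: sub_smooth_on (Ws c) => z [].
have W2l z : W2 z -> ldom X c d (chi z).
  move=> [[Wz cz] [_ dz]]; split; first by exists (psi z).
  by rewrite /chi /= coordK//; have [-> _] := WX _ Wz.
pose gd := coord d \o gamma.
have sgd : smooth_on J gd := Is d.
have JD s : J s -> cimg d (gd s) by move=> [_ ds]; exists (gamma s).
have saJ : smooth_on J a by apply: sub_smooth_on sa => s [].
have uJ s : J s -> inner (metric d (gd s)) ('D_1 gd s) ('D_1 gd s) = 1.
  by move=> [Is' ds]; exact: Iu.
have FM : {in W2, lrep X c d \o chi =1 affine_normal_map (metric d) gd a}.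
  move=> z /set_mem [[Wz cz] [Iz dz]]; have [bz pz] := WX _ Wz.
  rewrite /= /chi /lrep /lbase /= coordK// bz.
  by rewrite (pz d dz).
have [hu _ _] := lrep_flat_stationary luw.
have Jchi : 'J chi w \in unitmx by rewrite -row_free_unit /row_free (Wr c w Ww cw).
have lo := @ldom_open c d.
have sl := @lrep_smooth c d.
have dlc z : W2 z -> differentiable (lrep X c d \o chi) z.
  move=> W2z; apply: differentiable_comp.
    exact: (smooth_on_differentiable schi W2z).
  exact: (smooth_on_differentiable sl (W2l _ W2z)).
apply: etrans (esym (mean_curvature_reparam lo W2o sl schi W2l W2w Jchi hu)) _.
apply: etrans (eq_on_mean_curvature _ W2o FM dlc W2w) _.
exact: (affine_normal_mean_curvature (@cimg_open R S d)
  (@smooth_on_chart_metric d) (@chart_metric_sym d)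
  (@chart_metric_pos d) Jo sgd JD saJ uJ (conj Iw dgw)).
Qed.

Lemma piece_minimal N I gamma a W psi : affine_normal_piece X N I gamma a W psi ->
  minimal_on X N <-> geodesic I gamma.
Proof.
move=> P; have H := piece_mean_curvature P.
have [_ _ [_ [WN _ NW] _ _ _] WI WX] := P.
split=> [mN d s Is dgs|geo c d u lu Nu].
  (* [I] consists exactly of the values of s on the piece, so each s is seen by a point of [N]. *)
  move: Is; rewrite -WI => -[w Ww ws]; rewrite -ws in dgs *.
  have [bw _] := WX _ Ww.
  have [c cw] := chart_cover (psi w).
  have dbw : cdom d (base (X (psi w))) by rewrite bw.
  have [lw _ _ HE] := H c d w Ww cw dbw.
  have Np : N (param c (coord c (psi w))) by rewrite coordK//; exact: WN.
  move: (mN c d _ lw Np); rewrite HE => h.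
  have j0 : jrot (metric d (coord d (gamma (w 0 0))))
      (covariant_derivative (metric d) (coord d \o gamma)
        ('D_1 (coord d \o gamma)) (w 0 0)) = 0.
    have := congr1 (@snd4 R) h; rewrite snd4K -[0 in RHS]pair40 snd4K => /eqP.
    by rewrite oppr_eq0 => /eqP.
  have Dg : cimg d (coord d (gamma (w 0 0))) by exists (gamma (w 0 0)).
  (* From jA = 0, a second rotation gives A = 0. *)
  have := jrotK (chart_metric_sym Dg) (metric_det (@chart_metric_sym d) (@chart_metric_pos d) Dg)
    (covariant_derivative (metric d) (coord d \o gamma)
        ('D_1 (coord d \o gamma)) (w 0 0)).
  by rewrite j0 jrot0 => /esym/eqP; rewrite oppr_eq0 => /eqP.
have [w Ww ws] := NW _ Nu; have [cu du] := lu.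
have cw : cdom c (psi w) by rewrite ws; exact: param_cdom.
have dw : cdom d (base (X (psi w))) by rewrite ws.
have [_ dgw Iw HE] := H c d w Ww cw dw.
move: HE; rewrite ws paramK// => ->.
have -> : covariant_derivative (metric d) (coord d \o gamma)
    ('D_1 (coord d \o gamma)) (w 0 0) = 0 by exact: (geo d _ Iw dgw).
by rewrite jrot0 oppr0 pair40.
Qed.

End LagrangianCharts.

(** * Existence of affine normal pieces *)

Section Existence.
Context {R : realType} {S : oriented_riemannian_surface R} {L : smooth_surface R}.
Variable X : L -> tangent_bundle S.
Hypotheses (X_immersed : immersed_surface X) (X_lagrangian : lagrangian X)
  (X_rank_one : rank_one X).

Lemma chart_curve_velocity (c d : chart S) (gamma : R -> 'rV[R]_2) s :
  differentiable gamma s -> tdom c d (gamma s) ->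
  velocity (param c \o gamma) d s = 'D_1 gamma s *m 'J (coord d \o param c) (gamma s).
Proof.
move=> dg ts; have dt := smooth_on_differentiable (@smooth_on_transition _ _ c d) ts.
apply: etrans (derive_comp (f := coord d \o param c) (1 : R) dg dt) _.
exact: deriveEjacobian.
Qed.

Lemma metric_tdom (c d : chart S) u : tdom c d u ->
  metric c u = 'J (coord d \o param c) u *m metric d (coord d (param c u))
    *m ('J (coord d \o param c) u)^T.
Proof. by move=> [p [cp dp] <-]; rewrite coordK//; exact: Defs.metric_change. Qed.

Lemma oriented_tdom (c d : chart S) u : tdom c d u ->
  0 < \det ('J (coord d \o param c) u).
Proof. by move=> [p [cp dp] <-]; exact: Defs.oriented_atlas cp dp. Qed.

(** The speed does not depend on the chart, by the transformation laws of velocity and metric. *)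
Lemma chart_curve_unit_speed (c : chart S) (I : set R) (gamma : R -> 'rV[R]_2) :
  open I -> is_interval I -> smooth_on I gamma -> (forall s, I s -> cimg c (gamma s)) ->
  (forall s, I s -> inner (metric c (gamma s)) ('D_1 gamma s) ('D_1 gamma s) = 1) ->
  unit_speed_curve I (param c \o gamma).
Proof.
move=> Io Ii sg ID us.
have gc s : I s -> {for s, continuous (param c \o gamma)}.
  move=> Is; apply: continuous_comp; first exact: (smooth_on_continuous sg Is).
  exact: (param_continuous (ID _ Is)).
have td d s : I s -> cdom d (param c (gamma s)) -> tdom c d (gamma s).
  by move=> Is ds; apply/tdomP; split=> //; exact: ID.
split=> //.
- move=> d; pose J := [set s | I s /\ cdom d ((param c \o gamma) s)].
  have Jo : open J by exact: (open_preimage_on Io (cdom_open d) gc).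
  apply: (smooth_on_comp (f := coord d \o param c) Jo (@tdom_open _ _ c d) _
    (@smooth_on_transition _ _ c d)).
    by move=> s [Is ds]; exact: td.
  by apply: sub_smooth_on sg => s [].
- move=> d s Is ds; have ts := td _ _ Is ds.
  rewrite (chart_curve_velocity (smooth_on_differentiable sg Is) ts).
  rewrite -[RHS](us _ Is) (metric_tdom ts) /inner trmx_mul /=.
  by rewrite !mulmxA.
Qed.

Lemma jacobian_section n (f h : 'rV[R]_n -> 'rV[R]_n) (W : set 'rV[R]_n) w :
  open W -> W w -> smooth_on W f -> differentiable h (f w) ->
  (forall w, W w -> h (f w) = w) -> 'J f w \in unitmx.
Proof.
move=> Wo Ww sf dh hf.
have nb : {near w, forall y, h (f y) = y}.
  by apply: filterS (open_nbhs_nbhs (conj Wo Ww)) => y; exact: hf.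
exact: (mulmx1_unit (jacobian_left_inverse (smooth_on_differentiable sf Ww) dh nb)).1.
Qed.

Lemma chart_parametrization (c : chart L) (W : set 'rV[R]_2) (chi psi : 'rV[R]_2 -> 'rV[R]_2) :
  open W -> open (chi @` W) -> smooth_on W chi -> smooth_on (chi @` W) psi ->
  (forall w, W w -> cimg c (chi w) /\ psi (chi w) = w) ->
  local_parametrization W (param c @` (chi @` W)) (param c \o chi).
Proof.
move=> Wo Vo sc sp chiP.
have Wc w : W w -> {for w, continuous (param c \o chi)}.
  move=> Ww; apply: continuous_comp; first exact: (smooth_on_continuous sc Ww).
  exact: (param_continuous (chiP _ Ww).1).
have Jchi w : W w -> 'J chi w \in unitmx.
  move=> Ww; apply: (jacobian_section Wo Ww sc _ (fun w Ww => (chiP w Ww).2)).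
  by apply: (smooth_on_differentiable sp); exists w.
have td d w : W w -> cdom d (param c (chi w)) -> tdom c d (chi w).
  by move=> Ww dw; apply/tdomP; split=> //; exact: (chiP _ Ww).1.
split.
- split=> //.
  (* Openness in [L] is seen from the preimage under the continuous chart. *)
  rewrite (_ : _ @` _ = cdom c `&` coord c @^-1` (chi @` W)).
    apply: open_preimage_on => //; first exact: cdom_open.
    by move=> p cp; exact: Defs.coord_continuous.
  apply/seteqP; split=> p.
    move=> [_ [w Ww <-] <-]; have [cw _] := chiP _ Ww.
    by split; [exact: param_cdom|exists w; rewrite ?paramK].
  move=> [cp [w Ww wp]]; exists (chi w); first by exists w.
  by rewrite wp coordK.
- split.
  + by move=> w Ww; exists (chi w) => //; exists w.
  + move=> w w' /set_mem Ww /set_mem Ww' /= e.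
    have [cw pw] := chiP _ Ww; have [cw' pw'] := chiP _ Ww'.
    by rewrite -pw -pw' -(paramK cw) -(paramK cw') e.
  + by move=> _ [_ [w Ww <-] <-]; exists w.
- exact: Wc.
- move=> d; pose W1 := [set w | W w /\ cdom d ((param c \o chi) w)].
  have W1o : open W1 by exact: (open_preimage_on Wo (cdom_open d) Wc).
  apply: (smooth_on_comp (f := coord d \o param c) W1o (@tdom_open _ _ c d) _
    (@smooth_on_transition _ _ c d)).
    by move=> w [Ww dw]; exact: td.
  by apply: sub_smooth_on sc => w [].
- move=> d w Ww dw; have tw := td _ _ Ww dw.
  have E : 'J ((coord d \o param c) \o chi) w = 'J chi w *m 'J (coord d \o param c) (chi w).
    apply: jacobian_comp; first exact: (smooth_on_differentiable sc Ww).
    exact: (smooth_on_differentiable (@smooth_on_transition _ _ c d) tw).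
  have u : 'J chi w *m 'J (coord d \o param c) (chi w) \in unitmx.
    by rewrite unitmx_mul; apply/andP; split; [exact: Jchi|exact: transition_unit].
  by apply: etrans (congr1 (fun A => \rank A) E) _; exact: mxrank_unit.
Qed.

Lemma is_interval_ball (x r : R) : is_interval (ball x r).
Proof.
move=> a b; rewrite /ball/= !ltr_distlC => /andP[xa ax] /andP[xb bx] z /andP[az zb].
by rewrite ltr_distlC (lt_le_trans xa az) (le_lt_trans zb bx).
Qed.

(** The local form is obtained in a single chart d of the base, but the definition of a piece tests
    every chart; the formula for the vector part is carried over by the transition Jacobians. *)
Lemma affine_normal_piece_ex (q : L) : exists (N : set L) (I : set R) (gamma : R -> S)
  (a : R -> R) (W : set 'rV[R]_2) (psi : 'rV[R]_2 -> L),
  N q /\ affine_normal_piece X N I gamma a W psi.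
Proof.
have [c cq] := chart_cover q; have [d dq] := chart_cover (base (X q)).
pose u0 := coord c q.
have lu0 : ldom X c d u0 by split; [exists q|rewrite /u0 coordK].
have [r [psi [chi [gamma [a [[r0 chi0 schi Vo spsi] [chiP sgam sa gamP FE]]]]]]] :=
  rank_one_local_form (@cimg_open R S d) (@smooth_on_chart_metric R S d) (@chart_metric_sym R S d)
  (@chart_metric_pos R S d) (ldom_open X_immersed (c := c) (d := d))
  (@lrep_smooth _ _ _ _ X_immersed c d) (@lrep_domain _ _ _ X c d)
  (@lbase_rank _ _ _ _ X_rank_one c d) (@lrep_rank _ _ _ _ X_immersed c d)
  (@X_lagrangian c d) lu0.
pose W := ball (psi u0) r; pose I := ball (psi u0 0 0) r.
have Wo : open W by exact: ball_open.
have Io : open I by exact: ball_open.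
have chiW w : W w -> cimg c (chi w) /\ psi (chi w) = w.
  by move=> /chiP[[h _] e _].
have ID s : I s -> cimg d (gamma s) by move=> /gamP[].
have us s : I s -> inner (metric d (gamma s)) ('D_1 gamma s) ('D_1 gamma s) = 1.
  by move=> /gamP[].
have P := chart_parametrization Wo Vo schi spsi chiW.
exists (param c @` (chi @` W)), I, (param d \o gamma), a, W, (param c \o chi).
split.
  exists u0; last by rewrite /u0 coordK.
  by exists (psi u0) => //; exact: ballxx.
split; [|exact: sa|exact: P| |].
- exact: (chart_curve_unit_speed Io (@is_interval_ball _ _) sgam ID us).
- apply/seteqP; split=> [_ [w Ww <-]|s Is].
    by have [] := (ball_rV2P _ _ r0).1 Ww.
  exists (pt s (psi u0 0 1)); last exact: pt0.
  by apply/ball_rV2P => //; rewrite pt0 pt1; split; [exact: Is|exact: ballxx].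
- move=> w Ww; have Iw : I (w 0 0) by have [] := (ball_rV2P _ _ r0).1 Ww.
  have := FE _ Ww; rewrite /affine_normal_map /ruled => E.
  have [[cw dw] _ _] := chiP _ Ww.
  have E1 : coord d (base (X (param c (chi w)))) = gamma (w 0 0).
    by have := congr1 (@fst4 R) E; rewrite !fst4K.
  have E2 : Defs.comp (X (param c (chi w))) d = a (w 0 0) *: 'D_1 gamma (w 0 0) +
      w 0 1 *: jrot (metric d (gamma (w 0 0))) ('D_1 gamma (w 0 0)).
    by have := congr1 (@snd4 R) E; rewrite !snd4K.
  have B : base (X (param c (chi w))) = param d (gamma (w 0 0)).
    by rewrite -E1 coordK.
  split; first exact: B.
  move=> d' d'w; have tw : tdom d d' (gamma (w 0 0)).
    by apply/tdomP; split; [exact: ID|exact: d'w].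
  have d'b : cdom d' (base (X (param c (chi w)))) by rewrite B.
  have dg := smooth_on_differentiable sgam Iw.
  rewrite [LHS](comp_change dw d'b) E2 E1 (chart_curve_velocity dg tw).
  rewrite mulmxDl -[X in X + _]scalemxAl -[X in _ + X]scalemxAl.
  congr (_ + _ *: _).
  have Dd' : cimg d' (coord d' (param d (gamma (w 0 0)))).
    by exists (param d (gamma (w 0 0))).
  (* The rotation commutes with the change of chart because the atlas is oriented. *)
  apply: jrot_change; [exact: oriented_tdom| |exact: chart_metric_sym|exact: metric_tdom].
  exact: (metric_det (@chart_metric_sym R S d') (@chart_metric_pos R S d') Dd').
Qed.

End Existence.

(** Base curves exist only locally, so the criterion for minimality is given twice: piece by piece,
    and for all of [L] through all its pieces. *)
Theorem proposition2p1 (R : realType) (S : oriented_riemannian_surface R)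
    (L : smooth_surface R) (X : L -> tangent_bundle S)
    (X_immersed : immersed_surface X) (X_lagrangian : lagrangian X)
    (X_rank_one : rank_one X) :
  [/\ forall q : L, exists (N : set L) (I : set R) (gamma : R -> S)
        (a : R -> R) (W : set 'rV[R]_2) (psi : 'rV[R]_2 -> L),
        N q /\ affine_normal_piece X N I gamma a W psi,
      hamiltonian_stationary X,
      flat_induced_metric X,
      (forall (N : set L) (I : set R) (gamma : R -> S)
        (a : R -> R) (W : set 'rV[R]_2) (psi : 'rV[R]_2 -> L),
        affine_normal_piece X N I gamma a W psi ->
        (minimal_on X N <-> geodesic I gamma)) &
      (minimal X <->
       forall (N : set L) (I : set R) (gamma : R -> S)
        (a : R -> R) (W : set 'rV[R]_2) (psi : 'rV[R]_2 -> L),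
        affine_normal_piece X N I gamma a W psi -> geodesic I gamma)].
Proof.
have piece := affine_normal_piece_ex X_immersed X_lagrangian X_rank_one.
have pm := piece_minimal X_immersed X_lagrangian X_rank_one.
split; [exact: piece|exact: lagrangian_stationary|exact: lagrangian_flat| |].
  by move=> N I gamma a W psi; exact: pm.
split=> [mX N I gamma a W psi P|geo c d u lu _].
  by apply/(pm _ _ _ _ _ _ P) => c d u lu _; exact: mX.
(* The pieces cover [L], and vanishing of the mean curvature is tested point by point. *)
have [N [I [gamma [a [W [psi [Nq P]]]]]]] := piece (param c u).
exact: ((pm _ _ _ _ _ _ P).2 (geo _ _ _ _ _ _ P) c d u lu Nq).
Qed.
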